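(* There are an infinite number of (non $C^2$) evolving manifolds for the metric $\mathfrak g_{ij}=g^*_{ij}$, all with the same initial wrinkled data at $t=0$. Furthermore, for all these solutions the energy remains constant: $$E(t)=\int_\Omega(\partial_i\mathbf y_{\rm w}\cdot\partial_i\mathbf y_{\rm w})\,d\mathbf x=\text{const.},$$ where the manifold is defined by the $C^{1,\alpha}$ solution of $\partial_i\mathbf y_{\rm w}\cdot\partial_j\mathbf y_{\rm w}=g^*_{ij}$, which satisfies $\partial_i\mathbf y_{\rm w}\cdot\partial_i\mathbf y_{\rm w}=g^*_{ii}$, so that $\partial_i\mathbf y_{\rm w}$ is in $L^\infty$ in time.
   Context: Repeated indices are summed over $i=1,2$ in the energy. $\Omega$ is a small bounded neighborhood of the origin in $\mathbb R^2$. $\mathbf g^*=(g^*_{ij})$ is the time-independent metric induced by the developable surface $(Ax_2,Ax_1,f(x_2))$: $g^*_{11}=A^2$, $g^*_{12}=0$, $g^*_{22}=(f'(x_2))^2+A^2$, with $A>1$ constant and $f'(x_2)=A\tan\big(-A\int_0^{x_2}\bar u^2(s)ds\big)$ for a given smooth shear profile $\bar u$. An ''evolving manifold for $\mathbf g^*$'' is a time-dependent family $\mathbf y_{\rm w}(t,\cdot)$, $t\in[0,T]$, of wrinkled embeddings, i.e. embeddings in $C^{1,\alpha}(\Omega;\mathbb R^3)$, for some $\alpha\in(0,1)$, that are not $C^2$ and satisfy $\partial_i\mathbf y_{\rm w}\cdot\partial_j\mathbf y_{\rm w}=g^*_{ij}$. In the paper these families approximate in $C^0$ the analytic evolving short embedding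 $\mathbf y_{\mathbf g}(t,\cdot)$, $t\in[0,T]$, that is the geometric image of a locally analytic solution of the incompressible Euler equations with $uv\neq 0$; that is, $\partial_i\mathbf y_{\mathbf g}\cdot\partial_j\mathbf y_{\mathbf g}=g_{ij}$ with $(g_{ij})<(g^*_{ij})$ as quadratic forms, and the second fundamental form of $\mathbf y_{\mathbf g}$ divided by $\sqrt{\det\mathbf g}$ is $(v^2+p,-uv,u^2+p)$. ''The same initial wrinkled data'' means that all the families have the same $\mathbf y_{\rm w}(0,\cdot)$. *)

(* Defs.v *)
From HB Require Import structures.
From mathcomp Require Import all_boot all_order all_algebra.
From mathcomp Require Import all_classical all_reals all_analysis.
Set Implicit Arguments.
Unset Strict Implicit.
Unset Printing Implicit Defensive.
Import Order.TTheory GRing.Theory Num.Theory.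
Import numFieldNormedType.Exports.
Local Open Scope classical_set_scope.
Local Open Scope ring_scope.

(* Points of the plane are pairs [x : R * R] (x_1 = x.1, x_2 = x.2), so that   *)
(* the product Lebesgue measure applies; points of R^3 are row vectors.  The   *)
(* index i = 1, 2 of the coordinates is [i : 'I_2], with 0 standing for 1 and  *)
(* 1 for 2.  The norms on R * R and 'rV[R]_3 are the library's sup norms; they *)
(* are only used where equivalent norms give the same notion.                  *)

Section Calculus.
Variable R : realType.

Definition axis (i : 'I_2) : R * R := if i == 0 then (1, 0) else (0, 1).

Definition pd (W : normedModType R) (i : 'I_2) (F : R * R -> W) (x : R * R) : W :=
  'D_(axis i) F x.

Fixpoint Ck (W : normedModType R) (n : nat) (D : set (R * R)) (F : R * R -> W)
    : Prop :=
  match n with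
  | 0%N => forall x, D x -> {for x, continuous F}
  | m.+1 => (forall x, D x -> differentiable F x) /\
            (forall i : 'I_2, Ck m D (pd i F))
  end.

Definition C1holder (W : normedModType R) (alpha : R) (D : set (R * R))
    (F : R * R -> W) : Prop :=
  Ck 1 D F /\
  exists K : R,
    [/\ forall x, D x -> `|F x| <= K,
        forall i x, D x -> `|pd i F x| <= K
      & forall i x z, D x -> D z ->
          `|pd i F x - pd i F z| <= K * `|x - z| `^ alpha].

(* G is real analytic on [0, T] x D: near every point it is the sum of a power *)
(* series; the bound on the coefficients gives absolute convergence, so the    *)
(* limit of the cubical partial sums is the sum of the series.  At t = 0 and   *)
(* t = T the expansion is only required for times inside [0, T].               *)
Definition analytic_on (T : R) (D : set (R * R)) (G : R -> R * R -> R) : Prop :=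
  forall t x, 0 <= t <= T -> D x ->
  exists (c : nat -> nat -> nat -> R) (rho M : R),
    [/\ 0 < rho,
        forall i j k, `|c i j k| * rho ^+ (i + j + k) <= M
      & forall s z, 0 <= t + s <= T -> `|s| < rho -> `|z.1| < rho -> `|z.2| < rho ->
          (fun n : nat => \sum_(i < n) \sum_(j < n) \sum_(k < n)
              c i j k * s ^+ i * z.1 ^+ j * z.2 ^+ k) @ \oo --> G (t + s) (x + z)].

Definition oint (F : R -> R) (a b : R) : R :=
  if a <= b then Rintegral lebesgue_measure `[a, b] F
  else - Rintegral lebesgue_measure `[b, a] F.

End Calculus.

Section Surfaces.
Variable R : realType.
Implicit Types (y : R * R -> 'rV[R]_3) (x : R * R) (D : set (R * R)).

Definition dot (a b : 'rV[R]_3) : R := \sum_(k < 3) a 0 k * b 0 k.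

(* the indices k + 1 and k + 2 are taken modulo 3 *)
Definition cross (a b : 'rV[R]_3) : 'rV[R]_3 :=
  \row_(k < 3) (a 0 (k + 1) * b 0 (k + 2) - a 0 (k + 2) * b 0 (k + 1)).

Definition metric y x : 'M[R]_2 := \matrix_(i, j) dot (pd i y x) (pd j y x).

Definition normal y x : 'rV[R]_3 :=
  let m := cross (pd 0 y x) (pd 1 y x) in (Num.sqrt (dot m m))^-1 *: m.

Definition second_form y x : 'M[R]_2 :=
  \matrix_(i, j) dot (pd i (pd j y) x) (normal y x).

Definition lt_form (G H : 'M[R]_2) : Prop :=
  forall xi : 'rV[R]_2, xi != 0 ->
    (xi *m G *m xi^T) 0 0 < (xi *m H *m xi^T) 0 0.

(* injective C^1 immersion which is a homeomorphism onto its image *)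
Definition embedding D y : Prop :=
  [/\ Ck 1 D y,
      forall x, D x -> row_free (\matrix_(i < 2) pd i y x),
      {in D &, injective y}
    & forall x, D x -> forall N, nbhs x N ->
        exists2 B, nbhs (y x) B & D `&` y @^-1` B `<=` N].

Definition wrinkled_embedding (alpha : R) D (G : R * R -> 'M[R]_2) y : Prop :=
  [/\ embedding D y, C1holder alpha D y, ~ Ck 2 D y
    & forall x, D x -> metric y x = G x].

Definition evolving_manifold (T : R) D (G : R * R -> 'M[R]_2)
    (y : R -> R * R -> 'rV[R]_3) : Prop :=
  exists2 alpha : R, 0 < alpha < 1 &
    forall t, 0 <= t <= T -> wrinkled_embedding alpha D G (y t).

Definition energy D y : \bar R :=
  \int[(lebesgue_measure \x lebesgue_measure)%E]_(x in D)
    (\sum_(i < 2) dot (pd i y x) (pd i y x))%:E.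

(* the maps t |-> \partial_i y(t, x), x in D, are measurable on [0, T] and     *)
(* bounded uniformly in x                                                      *)
Definition gradient_Linfty (T : R) D (y : R -> R * R -> 'rV[R]_3) : Prop :=
  (forall (i : 'I_2) (k : 'I_3) x, D x ->
     measurable_fun (`[0, T] : set R) (fun t => pd i (y t) x 0 k)) /\
  exists M : R, forall i t x, 0 <= t <= T -> D x -> `|pd i (y t) x| <= M.

Definition fprime (A : R) (ubar : R -> R) (x2 : R) : R :=
  A * tan (- A * oint (fun s => ubar s ^+ 2) 0 x2).

(* first fundamental form of (A x_2, A x_1, f(x_2)) *)
Definition gstar (A : R) (ubar : R -> R) x : 'M[R]_2 :=
  \matrix_(i, j)
    if i != j then 0
    else if i == 0 then A ^+ 2 else fprime A ubar x.2 ^+ 2 + A ^+ 2.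

(* ubar is smooth on ]-delta, delta[, and the argument of the tangent in       *)
(* [fprime] stays in ]-pi/2, pi/2[ there                                       *)
Definition shear_profile (A delta : R) (ubar : R -> R) : Prop :=
  forall s, `|s| < delta ->
    (forall n, derivable (derive1n n ubar) s 1) /\
    `|A * oint (fun r => ubar r ^+ 2) 0 s| < pi / 2.

(* incompressible Euler equations with unit density, in conservation form *)
Definition euler_solution (T : R) D (u v p : R -> R * R -> R) : Prop :=
  forall t x, 0 < t < T -> D x ->
  [/\ derive1 (u ^~ x) t + pd 0 (fun z => u t z ^+ 2 + p t z) x
        + pd 1 (fun z => u t z * v t z) x = 0,
      derive1 (v ^~ x) t + pd 0 (fun z => u t z * v t z) x
        + pd 1 (fun z => v t z ^+ 2 + p t z) x = 0
    & pd 0 (u t) x + pd 1 (v t) x = 0].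

Definition euler_form (u v p : R) : 'M[R]_2 :=
  \matrix_(i, j)
    if i != j then - (u * v)
    else if i == 0 then v ^+ 2 + p else u ^+ 2 + p.

Definition euler_image (T : R) D (u v p : R -> R * R -> R)
    (y : R -> R * R -> 'rV[R]_3) : Prop :=
  forall t x, 0 <= t <= T -> D x ->
    (Num.sqrt (\det (metric (y t) x)))^-1 *: second_form (y t) x
    = euler_form (u t x) (v t x) (p t x).

End Surfaces.

(* Main.v *)
(*
A C^{1,alpha} Nash-Kuiper argument, carried out near the origin and uniformly
in time.  At a fixed time the short map is extended from a small ball to the
whole plane as a C^{1,1} map with nearly constant gradient.  A corrugation adds
to a map u the increment h (sin theta N - sin (2 theta) X) with theta = nu.x/h,
N normal and X tangential, which adds a multiple of nu (x) nu to the induced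
metric up to a small error; three of them make a stage, along directions nu for
which the forms nu (x) nu represent the metric defect with positive
coefficients.  A loop of stages leaves a defect that is the square of the
previous one, while the second derivatives grow by a fixed power of it, so the
limit is C^{1,alpha} for a universal alpha (here 1/32).  Each corrugation makes
the gradient oscillate near the origin on a scale much smaller than its
amplitude, so the gradient of the limit is not differentiable there.

A solution only has to be isometric at each time, so a step function of t whose
values are isometric maps close to y_g at finitely many times is an evolving
manifold, with gradient piecewise constant in t.  A translation switched on
for t > 0 gives infinitely many of them with the same initial data.
*)
Require Import Defs.
From HB Require Import structures.
From mathcomp Require Import all_boot all_order all_algebra.
From mathcomp Require Import all_classical all_reals all_analysis.
From mathcomp Require Import ring lra.
Import Order.TTheory GRing.Theory Num.Theory.
Import numFieldNormedType.Exports.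
Local Open Scope classical_set_scope.
Local Open Scope ring_scope.
Set Implicit Arguments.
Unset Strict Implicit.
Unset Printing Implicit Defensive.

(** The normal field of a map with Lipschitz gradient is only Lipschitz, so a corrugation built on
    it need not be differentiable. Each amplitude is therefore interpolated by cubics on a lattice
    of mesh [h], the length scale of the wave. The price is of order [h L], with [L] the Lipschitz
    constant of the gradient, and [h = e^4 / (c L)] makes it comparable to the terms of order [e^4]
    neglected in the metric. No derivative is taken during the iteration: a map travels with a pair
    [(p, q)] and a quadratic remainder. The exponents come from one count. Each of the three steps
    of a stage multiplies [L] by [e^-4], and normalising the defect costs [e^-2]. As the rate [s] is
    squared at each round, a bound [s^-15] reproduces itself because [15 + 14 < 30]; the spare [s]
    absorbs the constants. Balancing [s] against [s^-15 d] at distance [d] gives [d] near [s^16],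
    and the squaring between rounds halves the exponent 1/16 to 1/32. The tolerances depend only on
    the metric and its gap to [gstar] at the origin at one time, so one neighbourhood serves all
    nearby times and, by compactness, all of [[0, T]]. *)

Section Vectors.
Variable R : realType.
Implicit Types a b c : 'rV[R]_3.

Lemma dotE a b : dot a b = a 0 0 * b 0 0 + a 0 1 * b 0 1 + a 0 2 * b 0 2.
Proof.
rewrite /dot !big_ord_recr big_ord0 /= add0r.
by congr (_ * _ + _ * _ + _ * _); congr (_ 0 _); apply/val_inj.
Qed.

Lemma crossE0 a b : cross a b 0 0 = a 0 1 * b 0 2 - a 0 2 * b 0 1.
Proof. by rewrite mxE !add0r. Qed.

Lemma crossE1 a b : cross a b 0 1 = a 0 2 * b 0 0 - a 0 0 * b 0 2.
Proof.
rewrite mxE; have -> : (1 + 2 : 'I_3) = 0 by apply/val_inj.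
by have -> : (1 + 1 : 'I_3) = 2 by apply/val_inj.
Qed.

Lemma crossE2 a b : cross a b 0 2 = a 0 0 * b 0 1 - a 0 1 * b 0 0.
Proof.
rewrite mxE; have -> : (2 + 2 : 'I_3) = 1 by apply/val_inj.
by have -> : (2 + 1 : 'I_3) = 0 by apply/val_inj.
Qed.

Definition crossE := (crossE0, crossE1, crossE2).

Lemma ord3P (Q : 'I_3 -> Prop) : Q 0 -> Q 1 -> Q 2 -> forall k, Q k.
Proof.
move=> Q0 Q1 Q2 [[|[|[|//]]] H].
- by have -> : Ordinal H = 0 by apply/val_inj.
- by have -> : Ordinal H = 1 by apply/val_inj.
- by have -> : Ordinal H = 2 by apply/val_inj.
Qed.

Lemma row3P a b : a 0 0 = b 0 0 -> a 0 1 = b 0 1 -> a 0 2 = b 0 2 -> a = b.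
Proof. by move=> h0 h1 h2; apply/rowP; apply: ord3P. Qed.

Lemma norm_coord a k : `|a 0 k| <= `|a|.
Proof.
rewrite [leRHS]/Num.norm/= mx_normrE.
exact: (le_bigmax_cond _ (fun ij : 'I_1 * 'I_3 => `|a ij.1 ij.2|) (j := (0, k))).
Qed.

Lemma norm_leP a (e : R) : 0 <= e -> (forall k, `|a 0 k| <= e) -> `|a| <= e.
Proof.
move=> e0 h; rewrite [leLHS]/Num.norm/= mx_normrE.
by apply: bigmax_le => // -[i k] _ /=; rewrite (ord1 i).
Qed.

Lemma dotC a b : dot a b = dot b a.
Proof. by rewrite !dotE; ring. Qed.

Lemma dotDl a b c : dot (a + b) c = dot a c + dot b c.
Proof. by rewrite !dotE !mxE; ring. Qed.

Lemma dotDr a b c : dot c (a + b) = dot c a + dot c b.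
Proof. by rewrite !dotE !mxE; ring. Qed.

Lemma dotNl a b : dot (- a) b = - dot a b.
Proof. by rewrite !dotE !mxE; ring. Qed.

Lemma dotNr a b : dot a (- b) = - dot a b.
Proof. by rewrite !dotE !mxE; ring. Qed.

Lemma dotZl (k : R) a b : dot (k *: a) b = k * dot a b.
Proof. by rewrite !dotE !mxE; ring. Qed.

Lemma dotZr (k : R) a b : dot a (k *: b) = k * dot a b.
Proof. by rewrite !dotE !mxE; ring. Qed.

Lemma dot_ge0 a : 0 <= dot a a.
Proof. by rewrite dotE -!expr2 !addr_ge0 // sqr_ge0. Qed.

Lemma dot_norm a b : `|dot a b| <= 3 * (`|a| * `|b|).
Proof.
have H k : `|a 0 k * b 0 k| <= `|a| * `|b|.
  by rewrite normrM ler_pM // norm_coord.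
rewrite dotE; have := ler_normD (a 0 0 * b 0 0 + a 0 1 * b 0 1) (a 0 2 * b 0 2).
have := ler_normD (a 0 0 * b 0 0) (a 0 1 * b 0 1).
move: (H 0) (H 1) (H 2); lra.
Qed.

Lemma norm_dot a : `|a| ^+ 2 <= dot a a.
Proof.
have d0 := dot_ge0 a; rewrite -(sqr_sqrtr d0) ler_sqr ?nnegrE ?sqrtr_ge0 //.
apply: norm_leP; rewrite ?sqrtr_ge0// => k.
rewrite -sqrtr_sqr ler_sqrt // dotE -!expr2.
move: k; apply: ord3P; move: (sqr_ge0 (a 0 0)) (sqr_ge0 (a 0 1)) (sqr_ge0 (a 0 2)); lra.
Qed.

Lemma cross_norm a b : `|cross a b| <= 2 * (`|a| * `|b|).
Proof.
have H i j : `|a 0 i * b 0 j| <= `|a| * `|b|.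
  by rewrite normrM ler_pM // norm_coord.
apply: norm_leP; first by rewrite !mulr_ge0.
move=> k; rewrite mxE (le_trans (ler_normB _ _)) // mulr_natl mulr2n.
exact: lerD.
Qed.

Lemma crossBl a b c : cross (a - b) c = cross a c - cross b c.
Proof. by apply: row3P; rewrite !mxE; ring. Qed.

Lemma crossBr a b c : cross c (a - b) = cross c a - cross c b.
Proof. by apply: row3P; rewrite !mxE; ring. Qed.

Lemma dot_cross_l a b : dot a (cross a b) = 0.
Proof. by rewrite !dotE !crossE; ring. Qed.

Lemma dot_cross_r a b : dot b (cross a b) = 0.
Proof. by rewrite !dotE !crossE; ring. Qed.

Lemma dot_cross_rot a b c : dot a (cross b c) = dot (cross a b) c.
Proof. by rewrite !dotE !crossE; ring. Qed.

Lemma dot_cross_cross a b :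
  dot (cross a b) (cross a b) = dot a a * dot b b - dot a b ^+ 2.
Proof. by rewrite !dotE !crossE; ring. Qed.

End Vectors.

(** * Global estimates on the plane, without derivatives *)

Section Estimates.
Variable R : realType.
Local Notation P := (R * R)%type.
Implicit Types (W : normedModType R).

Definition bnd W (B : R) (f : P -> W) := forall x, `|f x| <= B.

Definition lip W (L : R) (f : P -> W) := forall x z, `|f z - f x| <= L * `|z - x|.

Definition lin W (p q : P -> W) (x h : P) : W := h.1 *: p x + h.2 *: q x.

(** Plays the role of [u] having gradient [(p, q)]: with [lip] bounds on [p] and [q] it expresses
    that [u] is C^{1,1}, and it is stable under sums and rescaling. *)
Definition tay W (K : R) (u p q : P -> W) :=
  forall x z, `|u z - u x - lin p q x (z - x)| <= K * `|z - x| ^+ 2.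

(** Quantitative injectivity, which survives uniform limits; in the end it gives both injectivity
    and the continuity of the inverse. *)
Definition bil W (c : R) (u : P -> W) := forall x z, c * `|z - x| <= `|u z - u x|.

Lemma norm1_le (x : P) : `|x.1| <= `|x|.
Proof. by rewrite prod_normE le_max lexx. Qed.

Lemma norm2_le (x : P) : `|x.2| <= `|x|.
Proof. by rewrite prod_normE le_max lexx orbT. Qed.

Lemma pair_norm_le (x : P) (e : R) : `|x.1| <= e -> `|x.2| <= e -> `|x| <= e.
Proof. by rewrite prod_normE ge_max => -> ->. Qed.

Lemma bnd_le W B B' (f : P -> W) : B <= B' -> bnd B f -> bnd B' f.
Proof. by move=> h H x; rewrite (le_trans (H x)). Qed.

Lemma lip_le W L L' (f : P -> W) : L <= L' -> lip L f -> lip L' f.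
Proof. by move=> h H x z; rewrite (le_trans (H x z)) // ler_wpM2r. Qed.

Lemma tay_le W K K' (u p q : P -> W) : K <= K' -> tay K u p q -> tay K' u p q.
Proof. by move=> h H x z; rewrite (le_trans (H x z)) // ler_wpM2r // exprn_ge0. Qed.

Lemma bil_le W c c' (u : P -> W) : c' <= c -> bil c u -> bil c' u.
Proof. by move=> h H x z; rewrite (le_trans _ (H x z)) // ler_wpM2r. Qed.

Lemma lipD W L L' (f g : P -> W) : lip L f -> lip L' g -> lip (L + L') (fun x => f x + g x).
Proof.
move=> hf hg x z; rewrite opprD addrACA (le_trans (ler_normD _ _)) // mulrDl.
exact: lerD.
Qed.

Lemma lipN W L (f : P -> W) : lip L f -> lip L (fun x => - f x).
Proof. by move=> hf x z; rewrite opprK addrC distrC. Qed.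

Lemma lipZ W L (k : R) (f : P -> W) : lip L f -> lip (`|k| * L) (fun x => k *: f x).
Proof. by move=> hf x z; rewrite -scalerBr normrZ -mulrA ler_wpM2l. Qed.

Lemma bndD W L L' (f g : P -> W) : bnd L f -> bnd L' g -> bnd (L + L') (fun x => f x + g x).
Proof. by move=> hf hg x; rewrite (le_trans (ler_normD _ _)) // lerD. Qed.

Lemma lip_cst W L (w : W) : 0 <= L -> lip L (fun=> w).
Proof. by move=> L0 x z; rewrite subrr normr0 mulr_ge0. Qed.

Lemma linD W (p q p' q' : P -> W) x h :
  lin (fun x => p x + p' x) (fun x => q x + q' x) x h = lin p q x h + lin p' q' x h.
Proof. by rewrite /lin !scalerDr addrACA. Qed.

Lemma tayD W K K' (u p q u' p' q' : P -> W) : tay K u p q -> tay K' u' p' q' ->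
  tay (K + K') (fun x => u x + u' x) (fun x => p x + p' x) (fun x => q x + q' x).
Proof.
move=> h h' x z; rewrite linD.
have -> : u z + u' z - (u x + u' x) - (lin p q x (z - x) + lin p' q' x (z - x)) =
  (u z - u x - lin p q x (z - x)) + (u' z - u' x - lin p' q' x (z - x)).
  move: (lin _ _ _ _) (lin p' _ _ _) => l l'.
  by rewrite !opprD (addrACA (u z)) [LHS]addrACA.
by rewrite (le_trans (ler_normD _ _)) // mulrDl lerD.
Qed.

Lemma lin_le W B (p q : P -> W) x h : `|p x| <= B -> `|q x| <= B ->
  `|lin p q x h| <= 2 * B * `|h|.
Proof.
move=> hp hq; rewrite (le_trans (ler_normD _ _)) // !normrZ.
rewrite -mulrA mulr_natl mulr2n lerD //.
  rewrite mulrC; apply: ler_pM => //; exact: norm1_le.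
rewrite mulrC; apply: ler_pM => //; exact: norm2_le.
Qed.

End Estimates.

(** * Piecewise cubic interpolation of Lipschitz functions on the integer lattice *)

Section Interpolation.
Variable R : realType.
Local Notation P := (R * R)%type.
Implicit Types (a b : int -> R) (s x z eta : R) (k : int).

(** The cubic Hermite weight: it goes from 0 to 1 with slope 0 at both ends, so that consecutive
    cells of [interp] join with equal derivatives. *)
Definition step (t : R) : R := 3 * t ^+ 2 - 2 * t ^+ 3.

Definition dstep (t : R) : R := 6 * t * (1 - t).

Definition frac s : R := s - (Num.floor s)%:~R.

Definition interp a s : R :=
  a (Num.floor s) + step (frac s) * (a (Num.floor s + 1) - a (Num.floor s)).

Definition dinterp a s : R :=
  dstep (frac s) * (a (Num.floor s + 1) - a (Num.floor s)).

Definition zlip eta a := forall m k, `|a m - a k| <= eta * `|m%:~R - k%:~R|.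

Lemma frac_itv s : 0 <= frac s < 1.
Proof.
have := floor_le s; have := floorD1_gt s; rewrite /frac intrD.
lra.
Qed.

Lemma floor_ge k s : k%:~R <= s -> k <= Num.floor s.
Proof. by move=> h; rewrite floor_ge_int. Qed.

Lemma floor_cell k s : k%:~R <= s -> s <= k%:~R + 1 ->
  Num.floor s = k \/ s = k%:~R + 1 /\ Num.floor s = k + 1.
Proof.
move=> h1; rewrite le_eqVlt => /orP[/eqP ->|h2].
  by right; split => //; rewrite -(intrD _ k 1) intrKfloor.
by left; apply: floor_def; rewrite h1 intrD.
Qed.

(** At the right end of a cell the floor jumps to [k + 1], yet the formulas of cell [k] still give
    the right values; hence cells can be treated as closed intervals. *)
Lemma interp_cell a k s : k%:~R <= s -> s <= k%:~R + 1 ->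
  interp a s = a k + step (s - k%:~R) * (a (k + 1) - a k) /\
  dinterp a s = dstep (s - k%:~R) * (a (k + 1) - a k).
Proof.
move=> h1 h2; rewrite /interp /dinterp /frac.
case: (floor_cell h1 h2) => [-> //|[-> ->]].
by rewrite intrD /step /dstep; split; ring.
Qed.

Lemma zlip1 eta a : zlip eta a -> forall k, `|a (k + 1) - a k| <= eta.
Proof. by move=> + k => /(_ (k + 1) k); rewrite intrD addrAC subrr add0r normr1 mulr1. Qed.

Lemma step_itv t : 0 <= t <= 1 -> 0 <= step t <= 1.
Proof.
move=> ht; rewrite /step.
have h1 : 0 <= t ^+ 2 * (3 - 2 * t) by rewrite mulr_ge0 ?sqr_ge0 //; lra.
have h2 : 0 <= (1 - t) ^+ 2 * (1 + 2 * t) by rewrite mulr_ge0 ?sqr_ge0 //; lra.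
by apply/andP; split; lra.
Qed.

Lemma step_le t : 0 <= t <= 1 -> `|step t| <= 3 * t ^+ 2.
Proof.
move=> ht; have := step_itv ht => h; rewrite ger0_norm; last lra.
have : 0 <= t ^+ 2 * t by rewrite mulr_ge0 ?sqr_ge0 //; lra.
by rewrite /step; lra.
Qed.

Lemma dstepC t : dstep t = dstep (1 - t).
Proof. by rewrite /dstep; ring. Qed.

Lemma dstep_le t : 0 <= t <= 1 -> `|dstep t| <= 6 * t.
Proof.
move=> ht; rewrite /dstep ger0_norm; last by rewrite !mulr_ge0 //; lra.
have : 0 <= t * t by rewrite mulr_ge0; lra.
lra.
Qed.

Lemma interp_floor eta a s : zlip eta a -> `|interp a s - a (Num.floor s)| <= eta.
Proof.
move=> /zlip1 /(_ (Num.floor s)) h; rewrite /interp addrAC subrr add0r normrM.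
have := frac_itv s; set t := frac s => ht.
have /step_itv ht' : 0 <= t <= 1 by lra.
rewrite (ger0_norm (_ : 0 <= step t)); last lra.
have := normr_ge0 (a (Num.floor s + 1) - a (Num.floor s)); nra.
Qed.

Lemma interp_bnd (B : R) a s : (forall k, `|a k| <= B) -> `|interp a s| <= B.
Proof.
move=> h; rewrite /interp; have := frac_itv s; set t := frac s => ht.
have /step_itv ht' : 0 <= t <= 1 by lra.
have := h (Num.floor s + 1); have := h (Num.floor s).
by rewrite !ler_norml; nra.
Qed.

Lemma dinterp_bnd eta a s : (forall k, `|a (k + 1) - a k| <= eta) ->
  `|dinterp a s| <= 2 * eta.
Proof.
move=> /(_ (Num.floor s)) h; rewrite /dinterp normrM.
have := frac_itv s; set t := frac s => ht.
have ht' : 0 <= dstep t <= 2 by rewrite /dstep; nra.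
rewrite (ger0_norm (_ : 0 <= dstep t)); last lra.
have := normr_ge0 (a (Num.floor s + 1) - a (Num.floor s)); nra.
Qed.

Lemma dinterp_bnd' (B : R) a s : (forall k, `|a k| <= B) -> `|dinterp a s| <= 4 * B.
Proof.
move=> h; have -> : 4 * B = 2 * (2 * B) by ring.
apply: dinterp_bnd => k; rewrite (le_trans (ler_normB _ _)) //.
have := h k; have := h (k + 1); lra.
Qed.

Lemma interpB a b s : interp (fun k => a k - b k) s = interp a s - interp b s.
Proof. by rewrite /interp; ring. Qed.

Lemma interpM a c s : interp (fun k => a k * c) s = interp a s * c.
Proof. by rewrite /interp; ring. Qed.

Lemma dinterpB a b s : dinterp (fun k => a k - b k) s = dinterp a s - dinterp b s.
Proof. by rewrite /dinterp; ring. Qed.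

(* Both factors vanish at the lattice points; across a lattice point the two   *)
(* sides are therefore compared with it separately.                            *)
Lemma dinterp_lip_le eta a x z : 0 <= eta -> zlip eta a -> x <= z ->
  `|dinterp a z - dinterp a x| <= 6 * eta * (z - x).
Proof.
move=> e0 ha xz; have hk := zlip1 ha.
set k := Num.floor x; have := frac_itv x; rewrite /frac -/k => kx.
case: (leP z (k%:~R + 1)) => hz.
  have [||_ ->] := @interp_cell a k z; [lra|exact: hz|].
  have [||_ ->] := @interp_cell a k x; [lra..|].
  rewrite -mulrBl normrM.
  have -> : dstep (z - k%:~R) - dstep (x - k%:~R) =
    6 * (z - x) * (1 - (z - k%:~R) - (x - k%:~R)) by rewrite /dstep; ring.
  have h1 : `|1 - (z - k%:~R) - (x - k%:~R)| <= 1 by rewrite ler_norml; lra.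
  have h2 := ler_pM (normr_ge0 _) (normr_ge0 _) h1 (hk k).
  rewrite normrM (ger0_norm (_ : 0 <= 6 * (z - x))) ?mulr_ge0 ?subr_ge0 // -mulrA.
  have -> : 6 * eta * (z - x) = 6 * (z - x) * (1 * eta) by ring.
  by rewrite ler_wpM2l // mulr_ge0 // subr_ge0.
set m := Num.floor z; have := frac_itv z; rewrite /frac -/m => mz.
have km : k + 1 <= m by apply: floor_ge; rewrite intrD; lra.
have {}km : k%:~R + 1 <= m%:~R :> R by rewrite -(intrD _ k 1) ler_int.
have [||_ ->] := @interp_cell a m z; [lra..|].
have [||_ ->] := @interp_cell a k x; [lra..|].
rewrite (le_trans (ler_normB _ _)) //.
rewrite (normrM (dstep (z - _))) (normrM (dstep (x - _))).
have d1 : `|dstep (z - m%:~R)| <= 6 * (z - m%:~R).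
  by apply: dstep_le => //; lra.
have d2 : `|dstep (x - k%:~R)| <= 6 * (k%:~R + 1 - x).
  by rewrite dstepC -(_ : 1 - (x - k%:~R) = k%:~R + 1 - x) ?dstep_le; lra.
have e1 := ler_pM (normr_ge0 _) (normr_ge0 _) d1 (hk m).
have e2 := ler_pM (normr_ge0 _) (normr_ge0 _) d2 (hk k).
have : 0 <= eta * (m%:~R - (k%:~R + 1)) by rewrite mulr_ge0 // subr_ge0.
lra.
Qed.

Lemma dinterp_lip eta a x z : 0 <= eta -> zlip eta a ->
  `|dinterp a z - dinterp a x| <= 6 * eta * `|z - x|.
Proof.
move=> e0 ha; case: (leP x z) => h.
  by rewrite (ger0_norm (_ : 0 <= z - x)) ?subr_ge0 // dinterp_lip_le.
by rewrite distrC (distrC z) (ger0_norm (_ : 0 <= x - z)) ?subr_ge0 ?dinterp_lip_le // ltW.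
Qed.

(** In one cell this is a polynomial identity. In adjacent cells both pieces deviate quadratically
    from the common lattice value, where the slope is 0. Otherwise [z - x] exceeds 1, and bounds
    linear in [z - x] are enough. *)
Lemma interp_tay_le eta a x z : 0 <= eta -> zlip eta a -> x <= z ->
  `|interp a z - interp a x - dinterp a x * (z - x)| <= 9 * eta * (z - x) ^+ 2.
Proof.
move=> e0 ha xz; have hk := zlip1 ha.
set k := Num.floor x; have := frac_itv x; rewrite /frac -/k => kx.
have [||-> ->] := @interp_cell a k x; [lra..|].
case: (leP z (k%:~R + 1)) => hz.
  have [||-> _] := @interp_cell a k z; [lra|exact: hz|].
  have := hk k; set d := a (k + 1) - a k => hd.
  have -> : a k + step (z - k%:~R) * d - (a k + step (x - k%:~R) * d) -
      dstep (x - k%:~R) * d * (z - x) =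
      (z - x) ^+ 2 * (3 - 4 * (x - k%:~R) - 2 * (z - k%:~R)) * d.
    by rewrite /step /dstep; ring.
  rewrite (normrM _ d) (normrM ((z - x) ^+ 2)) (ger0_norm (sqr_ge0 _)) -mulrA.
  have h3 : `|3 - 4 * (x - k%:~R) - 2 * (z - k%:~R)| <= 9 by rewrite ler_norml; lra.
  have := ler_pM (normr_ge0 _) (normr_ge0 _) h3 hd.
  by move=> h4; rewrite [leRHS]mulrC; apply: ler_wpM2l => //; exact: sqr_ge0.
set m := Num.floor z; have := frac_itv z; rewrite /frac -/m => mz.
have km : k + 1 <= m by apply: floor_ge; rewrite intrD; lra.
have {}km' : k%:~R + 1 <= m%:~R :> R by rewrite -(intrD _ k 1) ler_int.
have d2 : `|dstep (x - k%:~R) * (a (k + 1) - a k)| <= 6 * (k%:~R + 1 - x) * eta.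
  rewrite normrM; apply: ler_pM => //.
  by rewrite dstepC -(_ : 1 - (x - k%:~R) = k%:~R + 1 - x) ?dstep_le; lra.
case: (leP z (k%:~R + 2)) => hz2.
  have [||-> _] := @interp_cell a (k + 1) z; rewrite ?intrD; [lra..|].
  have := hk k; have := hk (k + 1).
  move: d2; set d := a (k + 1) - a k; set d' := a (k + 1 + 1) - a (k + 1) => d2 hd' hd.
  have -> : a (k + 1) + step (z - (k%:~R + 1)) * d' - (a k + step (x - k%:~R) * d) -
     dstep (x - k%:~R) * d * (z - x) = step (z - (k%:~R + 1)) * d' +
     step (k%:~R + 1 - x) * d - dstep (x - k%:~R) * d * (z - x).
    by rewrite /step /d; ring.
  have s1 : `|step (z - (k%:~R + 1))| <= 3 * (z - (k%:~R + 1)) ^+ 2.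
    by apply: step_le; lra.
  have s2 : `|step (k%:~R + 1 - x)| <= 3 * (k%:~R + 1 - x) ^+ 2.
    by apply: step_le; lra.
  have e1 := ler_pM (normr_ge0 _) (normr_ge0 _) s1 hd'.
  have e2 := ler_pM (normr_ge0 _) (normr_ge0 _) s2 hd.
  rewrite -!normrM in e1 e2.
  have e3 : `|dstep (x - k%:~R) * d * (z - x)| <= 6 * (k%:~R + 1 - x) * eta * (z - x).
    by rewrite normrM (ger0_norm (_ : 0 <= z - x)) ?subr_ge0 // ler_wpM2r // subr_ge0.
  rewrite (le_trans (ler_normB _ _)) // (le_trans (lerD (ler_normD _ _) e3)) //.
  apply: (le_trans (lerD (lerD e1 e2) (lexx _))).
  have : 0 <= eta * ((z - x) * (z - (k%:~R + 1))) by rewrite !mulr_ge0; lra.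
  have : 0 <= eta * ((k%:~R + 1 - x) * (z - (k%:~R + 1))) by rewrite !mulr_ge0; lra.
  nra.
have h1 := interp_floor z ha; rewrite -/m in h1.
have h2 := interp_floor x ha; rewrite -/k in h2.
have [||ex dx] := @interp_cell a k x; [lra..|]; rewrite ex in h2.
have {}d2 : `|dstep (x - k%:~R) * (a (k + 1) - a k)| <= 2 * eta.
  by rewrite -dx; apply: dinterp_bnd.
have h3 := ha m k; rewrite (ger0_norm (_ : 0 <= m%:~R - k%:~R)) in h3; last lra.
move: h1 h2 h3 d2; set u := interp a z; set v := a k + _; set w := dstep _ * _.
set t := k%:~R in kx hz km' hz2 *; set t' := m%:~R in mz km' *.
move=> h1 h2 h3 d2.
have e3 : `|w * (z - x)| <= 2 * eta * (z - x).
  rewrite normrM (ger0_norm (_ : 0 <= z - x)) ?subr_ge0 // ler_wpM2r ?subr_ge0 //.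
have -> : u - v - w * (z - x) = (u - a m) + (a m - a k) - (v - a k) - w * (z - x) by ring.
rewrite (le_trans (ler_normB _ _)) // (le_trans (lerD (ler_normB _ _) e3)) //.
rewrite (le_trans (lerD (lerD (ler_normD _ _) h2) (lexx _))) //.
rewrite (le_trans (lerD (lerD (lerD h1 h3) (lexx _)) (lexx _))) //.
have : 0 <= eta * ((z - x) + 1 - (t' - t)) by rewrite mulr_ge0 //; lra.
have : 0 <= eta * ((z - x) - 1) by apply: mulr_ge0 => //; lra.
have : 0 <= eta * ((z - x) * ((z - x) - 1)) by rewrite !mulr_ge0 //; lra.
have : 0 <= eta * (z - x) ^+ 2 by rewrite mulr_ge0 // sqr_ge0.
lra.
Qed.

(** For [z < x] the expansion is made at [z] and its slope is carried to [x]; the constant is 9 from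
    [interp_tay_le] plus 6 from [dinterp_lip_le]. *)
Lemma interp_tay eta a x z : 0 <= eta -> zlip eta a ->
  `|interp a z - interp a x - dinterp a x * (z - x)| <= 15 * eta * `|z - x| ^+ 2.
Proof.
move=> e0 ha; rewrite real_normK ?num_real //.
case: (leP x z) => h.
  apply: (le_trans (interp_tay_le e0 ha h)); have := sqr_ge0 (z - x); nra.
have h1 := interp_tay_le e0 ha (ltW h).
have h2 := dinterp_lip_le e0 ha (ltW h).
have -> : interp a z - interp a x - dinterp a x * (z - x) =
  - (interp a x - interp a z - dinterp a z * (x - z))
  + (dinterp a x - dinterp a z) * (x - z) by ring.
rewrite (le_trans (ler_normD _ _)) // normrN normrM (ger0_norm (_ : 0 <= x - z)); last lra.
nra.
Qed.

Lemma interp_lip eta a x z : 0 <= eta -> zlip eta a ->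
  `|interp a z - interp a x| <= 17 * eta * `|z - x|.
Proof.
move=> e0 ha; have h1 := interp_tay x z e0 ha.
have h2 : `|dinterp a x| <= 2 * eta by apply: dinterp_bnd => k; exact: zlip1.
case: (leP `|z - x| 1) => hzx.
  have -> : interp a z - interp a x = (interp a z - interp a x - dinterp a x * (z - x))
     + dinterp a x * (z - x) by ring.
  rewrite (le_trans (ler_normD _ _)) // normrM.
  have := normr_ge0 (z - x) => n0.
  have : 0 <= eta * `|z - x| * (1 - `|z - x|) by rewrite !mulr_ge0 //; lra.
  have := ler_wpM2r n0 h2; nra.
have f1 := interp_floor z ha; have f2 := interp_floor x ha.
have f3 := ha (Num.floor z) (Num.floor x).
have f4 : `|(Num.floor z)%:~R - (Num.floor x)%:~R| <= `|z - x| + 1 :> R.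
  have := frac_itv z; have := frac_itv x; rewrite /frac.
  have := ler_norm (z - x); have := ler_norm (- (z - x)); rewrite normrN ler_norml; lra.
have -> : interp a z - interp a x = (interp a z - a (Num.floor z)) +
  (a (Num.floor z) - a (Num.floor x)) - (interp a x - a (Num.floor x)) by ring.
rewrite (le_trans (ler_normB _ _)) // (le_trans (lerD (ler_normD _ _) f2)) //.
have := ler_wpM2l e0 f4; have : 0 <= eta * (`|z - x| - 1) by rewrite mulr_ge0 //; lra.
lra.
Qed.

Section Plane.
Variables (F : P -> R) (eta : R).
Hypotheses (e0 : 0 <= eta) (hF : lip eta F).

Let a (j k : int) : R := F (k%:~R, j%:~R).
Let g (s : R) (j : int) := interp (a j) s.
Let d (s : R) (j : int) := dinterp (a j) s.

Let pair_norm1 (s s' t : R) : `|(s, t) - (s', t)| = `|s - s'|.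
Proof. by rewrite prod_normE /= subrr normr0 max_l. Qed.

Let pair_norm2 (s s' t : R) : `|(t, s) - (t, s')| = `|s - s'|.
Proof. by rewrite prod_normE /= subrr normr0 max_r. Qed.

Let b1 (x1 x2 z1 z2 : R) : `|z1 - x1| <= `|(z1, z2) - (x1, x2)|.
Proof. exact: (norm1_le ((z1, z2) - (x1, x2))). Qed.

Let b2 (x1 x2 z1 z2 : R) : `|z2 - x2| <= `|(z1, z2) - (x1, x2)|.
Proof. exact: (norm2_le ((z1, z2) - (x1, x2))). Qed.

Let alip j : zlip eta (a j).
Proof. by move=> m k; rewrite (le_trans (hF _ _)) // pair_norm1. Qed.

Let alip' j j' k : `|a j k - a j' k| <= eta * `|j%:~R - j'%:~R|.
Proof. by rewrite (le_trans (hF _ _)) // pair_norm2. Qed.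

Let glip s : zlip eta (g s).
Proof. by move=> j j'; rewrite /g -interpB; apply: interp_bnd => k. Qed.

Let dlip s : zlip (4 * eta) (d s).
Proof. by move=> j j'; rewrite /d -dinterpB -mulrA; apply: dinterp_bnd' => k. Qed.

Let dbnd s j : `|d s j| <= 2 * eta.
Proof. by apply: dinterp_bnd => k; apply: zlip1. Qed.

Let e4 : 0 <= 4 * eta. Proof. by rewrite mulr_ge0. Qed.

(** Tensor-product interpolation of the lattice values. Interpolating in the second variable is
    linear in the data and preserves bounds, so every estimate in the first variable passes through
    it. Cells have size 1, hence all errors are of order [eta]; 100 is a common upper bound of the
    constants. *)
Lemma smoothing : exists U A B : P -> R,
  [/\ forall x : P, `|U x - F x| <= 100 * eta, lip (100 * eta) U,
      bnd (100 * eta) A /\ bnd (100 * eta) B,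
      lip (100 * eta) A /\ lip (100 * eta) B
    & tay (100 * eta) U A B].
Proof.
have e0' := e0; exists (fun x : P => interp (g x.1) x.2), (fun x : P => interp (d x.1) x.2),
  (fun x : P => dinterp (g x.1) x.2); split.
- move=> [x y] /=.
  have h1 := interp_floor y (glip x); have h2 := interp_floor x (alip (Num.floor y)).
  have h3 := hF (x, y) ((Num.floor x)%:~R, (Num.floor y)%:~R).
  have h4 : `|((Num.floor x)%:~R, (Num.floor y)%:~R) - (x, y)| <= 1.
    have := frac_itv x; have := frac_itv y; rewrite /frac => h h'.
    by apply: pair_norm_le => /=; rewrite ler_norml; lra.
  have -> : interp (g x) y - F (x, y) = (interp (g x) y - g x (Num.floor y)) +
    (interp (a (Num.floor y)) x - a (Num.floor y) (Num.floor x)) +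
    (a (Num.floor y) (Num.floor x) - F (x, y)) by rewrite /g; ring.
  rewrite (le_trans (ler_normD _ _)) // (le_trans (lerD (ler_normD _ _) h3)) //.
  apply: (le_trans (lerD (lerD h1 h2) (ler_wpM2l e0 h4))).
  lra.
- move=> [x1 x2] [z1 z2] /=.
  have h1 : `|interp (g z1) z2 - interp (g x1) z2| <= 17 * eta * `|z1 - x1|.
    by rewrite -interpB; apply: interp_bnd => j; apply: interp_lip.
  have h2 := interp_lip x2 z2 e0 (glip x1).
  have -> : interp (g z1) z2 - interp (g x1) x2 = (interp (g z1) z2 - interp (g x1) z2)
    + (interp (g x1) z2 - interp (g x1) x2) by ring.
  rewrite (le_trans (ler_normD _ _)) //.
  have := ler_wpM2l e0 (b1 x1 x2 z1 z2); have := ler_wpM2l e0 (b2 x1 x2 z1 z2).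
  have := mulr_ge0 e0 (normr_ge0 ((z1, z2) - (x1, x2))); lra.
- split=> -[x y] /=.
    by apply: (le_trans (interp_bnd _ (dbnd x))); lra.
  have h : forall k, `|g x (k + 1) - g x k| <= eta by move=> k; apply: zlip1.
  by apply: (le_trans (dinterp_bnd _ h)); lra.
- split=> -[x1 x2] [z1 z2] /=.
    have h1 : `|interp (d z1) z2 - interp (d x1) z2| <= 6 * eta * `|z1 - x1|.
      by rewrite -interpB; apply: interp_bnd => j; apply: dinterp_lip.
    have h2 := interp_lip x2 z2 e4 (dlip x1).
    have -> : interp (d z1) z2 - interp (d x1) x2 = (interp (d z1) z2 - interp (d x1) z2)
      + (interp (d x1) z2 - interp (d x1) x2) by ring.
    rewrite (le_trans (ler_normD _ _)) //.
    have := ler_wpM2l e0 (b1 x1 x2 z1 z2); have := ler_wpM2l e0 (b2 x1 x2 z1 z2).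
    have := mulr_ge0 e0 (normr_ge0 ((z1, z2) - (x1, x2))); lra.
  have h1 : `|dinterp (g z1) z2 - dinterp (g x1) z2| <= 4 * (17 * eta * `|z1 - x1|).
    by rewrite -dinterpB; apply: dinterp_bnd' => j; apply: interp_lip.
  have h2 := dinterp_lip x2 z2 e0 (glip x1).
  have -> : dinterp (g z1) z2 - dinterp (g x1) x2 = (dinterp (g z1) z2 - dinterp (g x1) z2)
    + (dinterp (g x1) z2 - dinterp (g x1) x2) by ring.
  rewrite (le_trans (ler_normD _ _)) //.
  have := ler_wpM2l e0 (b1 x1 x2 z1 z2); have := ler_wpM2l e0 (b2 x1 x2 z1 z2).
  have := mulr_ge0 e0 (normr_ge0 ((z1, z2) - (x1, x2))); lra.
move=> [x1 x2] [z1 z2]; rewrite /lin /=.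
have h1 : `|interp (g z1) z2 - interp (g x1) z2 - interp (d x1) z2 * (z1 - x1)|
    <= 15 * eta * `|z1 - x1| ^+ 2.
  rewrite -interpB -interpM -interpB; apply: interp_bnd => j; exact: interp_tay.
have h2 := interp_lip x2 z2 e4 (dlip x1).
have h3 := interp_tay x2 z2 e0 (glip x1).
(* The first variable moves along row [z2], the slope is corrected from row [z2] to row [x2], then
   the second variable moves at [x1]. *)
have -> : interp (g z1) z2 - interp (g x1) x2 -
  ((z1 - x1) *: interp (d x1) x2 + (z2 - x2) *: dinterp (g x1) x2) =
  (interp (g z1) z2 - interp (g x1) z2 - interp (d x1) z2 * (z1 - x1)) +
  (interp (d x1) z2 - interp (d x1) x2) * (z1 - x1) +
  (interp (g x1) z2 - interp (g x1) x2 - dinterp (g x1) x2 * (z2 - x2)).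
  by rewrite /GRing.scale /=; ring.
rewrite (le_trans (ler_normD _ _)) // (le_trans (lerD (ler_normD _ _) h3)) //.
rewrite (le_trans (lerD (lerD h1 (lexx _)) (lexx _))) // normrM.
have := b1 x1 x2 z1 z2; have := b2 x1 x2 z1 z2.
set n := `|(z1, z2) - _|; have := normr_ge0 (z1 - x1); have := normr_ge0 (z2 - x2).
have n0 : 0 <= n by rewrite normr_ge0.
move: h2; set n1 := `|z1 - x1|; set n2 := `|z2 - x2|; set q := `|_ - _| => h2 n20 n10 c2 c1.
have p1 : q * n1 <= 17 * (4 * eta) * n2 * n1 by rewrite ler_wpM2r.
have p2 : n2 * n1 <= n ^+ 2 by rewrite expr2 ler_pM.
have p3 : n1 ^+ 2 <= n ^+ 2 by rewrite ler_sqr.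
have p4 : n2 ^+ 2 <= n ^+ 2 by rewrite ler_sqr.
have := ler_wpM2l e0 p2; have := ler_wpM2l e0 p3; have := ler_wpM2l e0 p4.
have : 0 <= eta * n ^+ 2 by rewrite mulr_ge0 ?sqr_ge0.
lra.
Qed.

End Plane.
End Interpolation.

(** * Sine waves with a Lipschitz amplitude *)

Section Waves.
Variable R : realType.
Local Notation P := (R * R)%type.
Local Notation V := 'rV[R]_3.

Lemma MVT_abs (f df : R -> R) (B a b : R) : (forall x : R, is_derive x (1 : R) f (df x)) ->
  (forall x, `|x - a| <= `|b - a| -> `|df x| <= B) -> `|f b - f a| <= B * `|b - a|.
Proof.
move=> fd hB; case: (ltgtP a b) => [ab|ba|->]; last by rewrite !subrr normr0 mulr0.
- have [|c] := @MVT R f df a b ab.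
    by apply: derivable_within_continuous => x _; exact: ex_derive.
  rewrite in_itv /= => /andP[ac cb] ->; rewrite normrM ler_wpM2r // hB //.
  by rewrite !ger0_norm; lra.
- have [|c] := @MVT R f df b a ba.
    by apply: derivable_within_continuous => x _; exact: ex_derive.
  rewrite in_itv /= => /andP[bc ca] h; rewrite distrC h normrM distrC ler_wpM2r // hB //.
  by rewrite !ler0_norm; lra.
Qed.

Lemma sin_lip (a b : R) : `|sin b - sin a| <= `|b - a|.
Proof.
by rewrite -[leRHS]mul1r; apply: (@MVT_abs _ cos) => // x _; rewrite cos_max.
Qed.

Lemma cos_lip (a b : R) : `|cos b - cos a| <= `|b - a|.
Proof.
rewrite -[leRHS]mul1r; apply: (@MVT_abs _ (fun x => - sin x)) => // x _.
by rewrite normrN sin_max.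
Qed.

Lemma sin_tay (a b : R) : `|sin b - sin a - cos a * (b - a)| <= `|b - a| ^+ 2.
Proof.
have -> : sin b - sin a - cos a * (b - a) =
  (sin b - cos a * b) - (sin a - cos a * a) by ring.
rewrite expr2; apply: (@MVT_abs (fun x => sin x - cos a * x) (fun x => cos x - cos a)).
  move=> x; apply: is_deriveB; rewrite -[X in is_derive _ _ _ X]mulr1.
  exact: (@is_deriveZ _ _ _ (fun x => x)).
by move=> x hx; rewrite (le_trans (cos_lip _ _)).
Qed.

Definition phase (nu x : P) : R := nu.1 * x.1 + nu.2 * x.2.

Lemma phaseB nu x z : phase nu z - phase nu x = phase nu (z - x).
Proof. by rewrite /phase /=; ring. Qed.

Lemma phase_le (nu x : P) : `|phase nu x| <= 2 * `|nu| * `|x|.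
Proof.
have h1 := ler_pM (normr_ge0 _) (normr_ge0 _) (norm1_le nu) (norm1_le x).
have h2 := ler_pM (normr_ge0 _) (normr_ge0 _) (norm2_le nu) (norm2_le x).
by rewrite (le_trans (ler_normD _ _)) // !normrM; lra.
Qed.

(** The amplitude is replaced by its smoothing [U]. As [eta] controls both [U - F] and the gradient
    of [U], the gradient and the increments of [sin (phase) U] agree up to order [eta] with those
    expected from a constant amplitude [F x]. The clause on increments, valid for arbitrary pairs of
    points, is what the bounds on [bil] need. *)
Let unit_wave (Lam eta : R) (nu : P) (F : P -> R) : 1 <= Lam -> `|nu| <= Lam ->
  0 <= eta <= 1 -> bnd Lam F -> lip eta F ->
  let C := 1000 * Lam ^+ 3 in
  exists w p q : P -> R,
  [/\ tay C w p q, lip C p /\ lip C q, bnd C w,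
      forall x, `|p x - nu.1 * cos (phase nu x) * F x| <= C * eta /\
                `|q x - nu.2 * cos (phase nu x) * F x| <= C * eta
    & forall x z, `|w z - w x - (sin (phase nu z) - sin (phase nu x)) * F x|
        <= C * eta * `|z - x|].
Proof.
move=> L1 hnu /andP[e0 e1] bF lF C.
have [U [A [B [hU lU [bA bB] [lA lB] tU]]]] := smoothing e0 lF.
have LL : 1 <= Lam ^+ 2 by rewrite exprn_ege1.
have LLL : Lam ^+ 2 <= Lam ^+ 3 by rewrite ler_weXn2l.
have L12 : Lam <= Lam ^+ 2 by rewrite expr2; nra.
have Le : 0 <= Lam * (1 - eta) by rewrite mulr_ge0; lra.
have num1 : 2 * Lam ^+ 3 + 200 * Lam ^+ 2 + 300 * (Lam * eta) + 100 * eta <= C.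
  by rewrite /C; lra.
have num2 : 100 * eta + 400 * (Lam * eta) + 4 * Lam ^+ 3 + 400 * Lam ^+ 2 <= C.
  by rewrite /C; lra.
have num3 : 200 * Lam + 100 <= C by rewrite /C; lra.
have num4 : 100 * Lam + 100 <= C by rewrite /C; lra.
have num5 : 1 * (Lam + 100) <= C by rewrite /C; lra.
have bU x : `|U x| <= Lam + 100.
  have -> : U x = F x + (U x - F x) by ring.
  by rewrite (le_trans (ler_normD _ _)) // lerD //= (le_trans (hU x)) //; lra.
have hnu1 := le_trans (norm1_le nu) hnu; have hnu2 := le_trans (norm2_le nu) hnu.
have hph x z : `|phase nu z - phase nu x| <= 2 * Lam * `|z - x|.
  rewrite phaseB (le_trans (phase_le _ _)) // ler_wpM2r //; lra.
have grad (n : R) (G : P -> R) : `|n| <= Lam -> bnd (100 * eta) G -> lip (100 * eta) G ->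
  lip C (fun x => n * cos (phase nu x) * U x + sin (phase nu x) * G x) /\
  forall x, `|n * cos (phase nu x) * U x + sin (phase nu x) * G x
     - n * cos (phase nu x) * F x| <= C * eta.
  move=> hn bG lG; split=> [x z|x].
    have -> : n * cos (phase nu z) * U z + sin (phase nu z) * G z -
      (n * cos (phase nu x) * U x + sin (phase nu x) * G x) =
      n * ((cos (phase nu z) - cos (phase nu x)) * U z) +
      n * (cos (phase nu x) * (U z - U x)) +
      (sin (phase nu z) - sin (phase nu x)) * G z + sin (phase nu x) * (G z - G x) by ring.
    have z0 := normr_ge0 (z - x).
    have h1 := ler_pM (normr_ge0 _) (normr_ge0 _)
      (le_trans (cos_lip (phase nu x) (phase nu z)) (hph x z)) (bU z).
    have h2 := ler_pM (normr_ge0 _) (normr_ge0 _) (cos_max (phase nu x)) (lU x z).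
    have h3 := ler_pM (normr_ge0 _) (normr_ge0 _)
      (le_trans (sin_lip (phase nu x) (phase nu z)) (hph x z)) (bG z).
    have h4 := ler_pM (normr_ge0 _) (normr_ge0 _) (sin_max (phase nu x)) (lG x z).
    rewrite -normrM in h1; rewrite -normrM in h2.
    have h5 := ler_pM (normr_ge0 _) (normr_ge0 _) hn h1.
    have h6 := ler_pM (normr_ge0 _) (normr_ge0 _) hn h2.
    rewrite -!normrM in h3 h4 h5 h6.
    rewrite (le_trans (ler_normD _ _)) // (le_trans (lerD (ler_normD _ _) h4)) //.
    rewrite (le_trans (lerD (lerD (ler_normD _ _) h3) (lexx _))) //.
    rewrite (le_trans (lerD (lerD (lerD h5 h6) (lexx _)) (lexx _))) //.
    have -> : Lam * (2 * Lam * `|z - x| * (Lam + 100)) + Lam * (1 * (100 * eta * `|z - x|))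
      + 2 * Lam * `|z - x| * (100 * eta) + 1 * (100 * eta * `|z - x|) =
      (2 * Lam ^+ 3 + 200 * Lam ^+ 2 + 300 * (Lam * eta) + 100 * eta) * `|z - x| by ring.
    by rewrite ler_wpM2r.
  have -> : n * cos (phase nu x) * U x + sin (phase nu x) * G x - n * cos (phase nu x) * F x
    = n * (cos (phase nu x) * (U x - F x)) + sin (phase nu x) * G x by ring.
  have h1 := ler_pM (normr_ge0 _) (normr_ge0 _) (cos_max (phase nu x)) (hU x).
  rewrite -normrM in h1; have h2 := ler_pM (normr_ge0 _) (normr_ge0 _) hn h1.
  have h3 := ler_pM (normr_ge0 _) (normr_ge0 _) (sin_max (phase nu x)) (bG x).
  rewrite -!normrM in h2 h3.
  rewrite (le_trans (ler_normD _ _)) // (le_trans (lerD h2 h3)) //.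
  have -> : Lam * (1 * (100 * eta)) + 1 * (100 * eta) = (100 * Lam + 100) * eta by ring.
  by rewrite ler_wpM2r.
have [lp ep] := grad nu.1 A hnu1 bA lA; have [lq eq] := grad nu.2 B hnu2 bB lB.
exists (fun x => sin (phase nu x) * U x),
  (fun x => nu.1 * cos (phase nu x) * U x + sin (phase nu x) * A x),
  (fun x => nu.2 * cos (phase nu x) * U x + sin (phase nu x) * B x); split=> //.
- move=> x z.
  pose l := (z.1 - x.1) * A x + (z.2 - x.2) * B x.
  have -> : sin (phase nu z) * U z - sin (phase nu x) * U x -
    lin (fun x => nu.1 * cos (phase nu x) * U x + sin (phase nu x) * A x)
     (fun x => nu.2 * cos (phase nu x) * U x + sin (phase nu x) * B x) x (z - x) =
    sin (phase nu z) * (U z - U x - lin A B x (z - x)) +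
    (sin (phase nu z) - sin (phase nu x)) * lin A B x (z - x) +
    (sin (phase nu z) - sin (phase nu x) - cos (phase nu x) * (phase nu z - phase nu x)) * U x.
    by rewrite phaseB /lin /phase /GRing.scale /=; ring.
  have h1 := ler_pM (normr_ge0 _) (normr_ge0 _) (sin_max (phase nu z)) (tU x z).
  have h2 := ler_pM (normr_ge0 _) (normr_ge0 _)
    (le_trans (sin_lip (phase nu x) (phase nu z)) (hph x z)) (lin_le (z - x) (bA x) (bB x)).
  have h4 : `|phase nu z - phase nu x| ^+ 2 <= (2 * Lam * `|z - x|) ^+ 2.
    by rewrite ler_sqr ?nnegrE // (le_trans _ (hph x z)).
  have h3 := ler_pM (normr_ge0 _) (normr_ge0 _)
    (le_trans (sin_tay (phase nu x) (phase nu z)) h4) (bU x).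
  rewrite -!normrM in h1 h2 h3.
  rewrite (le_trans (ler_normD _ _)) // (le_trans (lerD (ler_normD _ _) h3)) //.
  rewrite (le_trans (lerD (lerD h1 h2) (lexx _))) //.
  have -> : 1 * (100 * eta * `|z - x| ^+ 2)
    + 2 * Lam * `|z - x| * (2 * (100 * eta) * `|z - x|) +
    (2 * Lam * `|z - x|) ^+ 2 * (Lam + 100) =
    (100 * eta + 400 * (Lam * eta) + 4 * Lam ^+ 3 + 400 * Lam ^+ 2) * `|z - x| ^+ 2 by ring.
  by rewrite ler_wpM2r ?sqr_ge0.
- move=> x; rewrite normrM.
  have h1 := ler_pM (normr_ge0 _) (normr_ge0 _) (sin_max (phase nu x)) (bU x).
  exact: le_trans h1 _.
move=> x z.
have -> : sin (phase nu z) * U z - sin (phase nu x) * U x -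
  (sin (phase nu z) - sin (phase nu x)) * F x =
  (sin (phase nu z) - sin (phase nu x)) * (U x - F x) + sin (phase nu z) * (U z - U x) by ring.
have h2 := ler_pM (normr_ge0 _) (normr_ge0 _)
  (le_trans (sin_lip (phase nu x) (phase nu z)) (hph x z)) (hU x).
have h1 := ler_pM (normr_ge0 _) (normr_ge0 _) (sin_max (phase nu z)) (lU x z).
rewrite -!normrM in h1 h2.
rewrite (le_trans (ler_normD _ _)) // (le_trans (lerD h2 h1)) //.
have -> : 2 * Lam * `|z - x| * (100 * eta) + 1 * (100 * eta * `|z - x|) =
  (200 * Lam + 100) * eta * `|z - x| by ring.
by rewrite ler_wpM2r // ler_wpM2r.
Qed.

Lemma pairZ_norm (k : R) (x : P) : 0 <= k -> `|k *: x| = k * `|x|.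
Proof. by move=> k0; rewrite normrZ ger0_norm. Qed.

(** In the variable [x / h] the amplitude has Lipschitz constant [h L <= 1] and the unit case
    applies; in the original variable the lattice has mesh [h]. *)
Let scalar_wave (Lam h L : R) (nu : P) (F : P -> R) : 1 <= Lam -> `|nu| <= Lam ->
  0 < h -> 0 <= L -> h * L <= 1 -> bnd Lam F -> lip L F ->
  let C := 1000 * Lam ^+ 3 in
  exists w p q : P -> R,
  [/\ tay (C / h) w p q, lip (C / h) p /\ lip (C / h) q, bnd (C * h) w,
      forall x, `|p x - nu.1 * cos (phase nu x / h) * F x| <= C * (h * L) /\
                `|q x - nu.2 * cos (phase nu x / h) * F x| <= C * (h * L)
    & forall x z, `|w z - w x - h * (sin (phase nu z / h) - sin (phase nu x / h)) * F x|
        <= C * (h * L) * `|z - x|].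
Proof.
move=> L1 hnu h0 L0 hL bF lF C.
have hn : h != 0 by rewrite gt_eqF.
have hi : 0 <= h^-1 by rewrite invr_ge0 ltW.
have bF' : bnd Lam (fun y => F (h *: y)) by move=> y; exact: bF.
have lF' : lip (h * L) (fun y => F (h *: y)).
  move=> x z; rewrite (le_trans (lF _ _)) // -scalerBr pairZ_norm ?(ltW h0) //.
  by rewrite mulrA (mulrC L).
have hL0 : 0 <= h * L <= 1 by rewrite hL mulr_ge0 // ltW.
have [w [p [q [tw [lp lq] bw ep ew]]]] := unit_wave L1 hnu hL0 bF' lF'.
have ph (x : P) : phase nu (h^-1 *: x) = phase nu x / h.
  by rewrite /phase /= /GRing.scale /=; ring.
have nm (x z : P) : `|h^-1 *: z - h^-1 *: x| = `|z - x| / h.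
  by rewrite -scalerBr pairZ_norm // mulrC.
have sc (x : P) : h *: (h^-1 *: x) = x by rewrite scalerA divff // scale1r.
exists (fun x => h * w (h^-1 *: x)), (fun x => p (h^-1 *: x)), (fun x => q (h^-1 *: x)).
split.
- move=> x z.
  have -> : h * w (h^-1 *: z) - h * w (h^-1 *: x) -
      lin (fun x => p (h^-1 *: x)) (fun x => q (h^-1 *: x)) x (z - x) =
    h * (w (h^-1 *: z) - w (h^-1 *: x) - lin p q (h^-1 *: x) (h^-1 *: z - h^-1 *: x)).
    by rewrite /lin /= /GRing.scale /=; field.
  rewrite normrM (gtr0_norm h0) (le_trans (ler_wpM2l (ltW h0) (tw _ _))) // nm.
  by rewrite le_eqVlt; apply/orP; left; apply/eqP; rewrite -/C; field.
- split=> x z; [rewrite (le_trans (lp _ _)) //|rewrite (le_trans (lq _ _)) //];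
  by rewrite nm -/C (mulrAC C h^-1) mulrA.
- move=> x; rewrite normrM (gtr0_norm h0) [leRHS]mulrC ler_wpM2l ?(ltW h0) //; exact: bw.
- by move=> x; have := ep (h^-1 *: x); rewrite ph sc.
- move=> x z; have := ler_wpM2l (ltW h0) (ew (h^-1 *: x) (h^-1 *: z)).
  rewrite !ph sc nm -[X in X * `|_|](gtr0_norm h0) -normrM => H.
  have -> : h * w (h^-1 *: z) - h * w (h^-1 *: x) -
    h * (sin (phase nu z / h) - sin (phase nu x / h)) * F x = h * (w (h^-1 *: z) -
    w (h^-1 *: x) - (sin (phase nu z / h) - sin (phase nu x / h)) * F x) by ring.
  apply: (le_trans H); rewrite -/C le_eqVlt; apply/orP; left; apply/eqP; field.
  by [].
Qed.

Lemma wave (Lam h L : R) (nu : P) (F : P -> V) : 1 <= Lam -> `|nu| <= Lam ->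
  0 < h -> 0 <= L -> h * L <= 1 -> bnd Lam F -> lip L F ->
  let C := 1000 * Lam ^+ 3 in
  exists w p q : P -> V,
  [/\ tay (C / h) w p q, lip (C / h) p /\ lip (C / h) q, bnd (C * h) w,
      forall x, `|p x - (nu.1 * cos (phase nu x / h)) *: F x| <= C * (h * L) /\
                `|q x - (nu.2 * cos (phase nu x / h)) *: F x| <= C * (h * L)
    & forall x z, `|w z - w x - (h * (sin (phase nu z / h) - sin (phase nu x / h))) *: F x|
        <= C * (h * L) * `|z - x|].
Proof.
move=> L1 hnu h0 L0 hL bF lF C.
have C0 : 0 <= C by apply: mulr_ge0; [exact: ler0n|apply: exprn_ge0; lra].
have H (k : 'I_3) : exists t : (P -> R) * (P -> R) * (P -> R),
  [/\ tay (C / h) t.1.1 t.1.2 t.2, lip (C / h) t.1.2 /\ lip (C / h) t.2, bnd (C * h) t.1.1,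
      forall x, `|t.1.2 x - nu.1 * cos (phase nu x / h) * F x 0 k| <= C * (h * L) /\
                `|t.2 x - nu.2 * cos (phase nu x / h) * F x 0 k| <= C * (h * L)
    & forall x z, `|t.1.1 z - t.1.1 x -
        h * (sin (phase nu z / h) - sin (phase nu x / h)) * F x 0 k|
        <= C * (h * L) * `|z - x|].
  have bk : bnd Lam (fun x => F x 0 k) by move=> x; exact: le_trans (norm_coord _ _) (bF x).
  have lk : lip L (fun x => F x 0 k).
    move=> x z; have := norm_coord (F z - F x) k; rewrite !mxE => /le_trans; apply.
    exact: lF.
  by have [w [p [q h']]] := scalar_wave L1 hnu h0 L0 hL bk lk; exists (w, p, q).
have [t ht] := choice H; clear H; clearbody C.
have Ch : 0 <= C / h by rewrite divr_ge0 // ltW.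
have Chm : 0 <= C * h by rewrite mulr_ge0 // ltW.
have ChL : 0 <= C * (h * L) by rewrite !mulr_ge0 // ltW.
exists (fun x => \row_k (t k).1.1 x), (fun x => \row_k (t k).1.2 x), (fun x => \row_k (t k).2 x).
split.
- move=> x z; apply: norm_leP => [|k]; first by rewrite mulr_ge0 ?sqr_ge0.
  by rewrite !mxE; case: (ht k).
- split=> x z; (apply: norm_leP => [|k]; first exact: mulr_ge0);
  by rewrite !mxE; case: (ht k) => _ [].
- move=> x; apply: norm_leP => [//|k].
  by rewrite !mxE; case: (ht k).
- move=> x; split; (apply: norm_leP => [//|k]);
  by rewrite !mxE; case: (ht k) => _ _ _ /(_ x)[].
- move=> x z; apply: norm_leP => [|k]; first exact: mulr_ge0.
  by rewrite !mxE; case: (ht k).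
Qed.

End Waves.

(** * Bounds and Lipschitz constants uniform over a family *)

Section Families.
Variables (R : realType) (I : Type) (L : I -> R).
Hypothesis L0 : forall i, 0 <= L i.
Local Notation P := (R * R)%type.
Implicit Types W : normedModType R.

(* Estimates uniform over a family of instances [i : I], with a constant that  *)
(* is not tracked: [L i] measures the Lipschitz constants of the instance.     *)
Definition tame W (f : I -> P -> W) :=
  exists2 C, 0 <= C & forall i, bnd C (f i) /\ lip (C * L i) (f i).

Lemma tame_bilinear W1 W2 W3 (op : W1 -> W2 -> W3) (c : R) f g : 0 <= c ->
  (forall a b, `|op a b| <= c * (`|a| * `|b|)) ->
  (forall a a' b b', op a b - op a' b' = op (a - a') b + op a' (b - b')) ->
  tame f -> tame g -> tame (fun i x => op (f i x) (g i x)).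
Proof.
move=> c0 hop hD [C1 C10 hf] [C2 C20 hg].
exists (2 * c * C1 * C2); rewrite ?mulr_ge0 // => i.
have [bf lf] := hf i; have [bg lg] := hg i; split=> [x|x z].
  have -> : 2 * c * C1 * C2 = c * (2 * C1 * C2) by ring.
  rewrite (le_trans (hop _ _)) // ler_wpM2l //.
  have := ler_pM (normr_ge0 _) (normr_ge0 _) (bf x) (bg x).
  have := mulr_ge0 C10 C20; lra.
rewrite hD (le_trans (ler_normD _ _)) // (le_trans (lerD (hop _ _) (hop _ _))) //.
have h1 := ler_pM (normr_ge0 _) (normr_ge0 _) (lf x z) (bg z).
have h2 := ler_pM (normr_ge0 _) (normr_ge0 _) (bf x) (lg x z).
rewrite -mulrDr (le_trans (ler_wpM2l c0 (lerD h1 h2))) //.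
by rewrite le_eqVlt; apply/orP; left; apply/eqP; ring.
Qed.

Lemma tameD W (f g : I -> P -> W) : tame f -> tame g -> tame (fun i x => f i x + g i x).
Proof.
move=> [C1 C10 hf] [C2 C20 hg]; exists (C1 + C2); first exact: addr_ge0.
move=> i; have [bf lf] := hf i; have [bg lg] := hg i; split; first exact: bndD.
by rewrite mulrDl; apply: lipD.
Qed.

Lemma tame_cst W (C : R) (w : I -> W) : 0 <= C -> (forall i, `|w i| <= C) ->
  tame (fun i _ => w i).
Proof.
move=> C0 h; exists C => // i; split=> [x //|].
by apply: lip_cst; rewrite mulr_ge0.
Qed.

Lemma tame_inv (c : R) (f : I -> P -> R) : 0 < c -> (forall i x, c <= f i x) ->
  tame f -> tame (fun i x => (f i x)^-1).
Proof.
move=> c0 hc [C C0 hf]; exists (c^-1 + C * c^-1 * c^-1).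
  by rewrite addr_ge0 ?mulr_ge0 ?invr_ge0 // ltW.
have f0 i x : 0 < f i x by rewrite (lt_le_trans c0).
have hi i x : `|(f i x)^-1| <= c^-1.
  by rewrite gtr0_norm ?invr_gt0 // lef_pV2 ?posrE.
move=> i; have [bf lf] := hf i; split=> [x|x z].
  by rewrite (le_trans (hi _ _)) // lerDl !mulr_ge0 ?invr_ge0 // ltW.
have -> : (f i z)^-1 - (f i x)^-1 = - (f i z - f i x) * (f i z)^-1 * (f i x)^-1.
  by field; rewrite !gt_eqF.
rewrite !normrM normrN.
have h := ler_pM (mulr_ge0 (normr_ge0 _) (normr_ge0 _)) (normr_ge0 _)
  (ler_pM (normr_ge0 _) (normr_ge0 _) (lf x z) (hi i z)) (hi i x).
rewrite (le_trans h) //.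
have : 0 <= c^-1 * (L i * `|z - x|) by rewrite !mulr_ge0 // invr_ge0 ltW.
lra.
Qed.

Lemma tame_sqrt (c : R) (f : I -> P -> R) : 0 < c -> (forall i x, c ^+ 2 <= f i x) ->
  tame f -> tame (fun i x => Num.sqrt (f i x)).
Proof.
move=> c0 hc [C C0 hf]; exists (1 + C + C * c^-1).
  by rewrite !addr_ge0 ?mulr_ge0 ?invr_ge0 // ltW.
have f0 i x : 0 <= f i x by rewrite (le_trans _ (hc i x)) // sqr_ge0.
have hs i x : c <= Num.sqrt (f i x).
  by rewrite -(ler_sqr) ?nnegrE ?sqrtr_ge0 ?sqr_sqrtr // ltW.
have Cc : 0 <= C * c^-1 by rewrite mulr_ge0 // invr_ge0 ltW.
move=> i; have [bf lf] := hf i; split=> [x|x z].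
  rewrite ger0_norm ?sqrtr_ge0 //; have := bf x; rewrite ger0_norm // => h.
  have := sqr_sqrtr (f0 i x); have := sqrtr_ge0 (f i x); nra.
have := sqr_sqrtr (f0 i x); have := sqr_sqrtr (f0 i z); move: (hs i x) (hs i z) (lf x z).
set a := Num.sqrt _; set b := Num.sqrt _ => ha hb + hz hx; rewrite -hz -hx => h.
have h2 : `|b - a| * c <= C * L i * `|z - x|.
  apply: le_trans h; have -> : b ^+ 2 - a ^+ 2 = (b - a) * (b + a) by ring.
  rewrite normrM ler_wpM2l // ger0_norm; lra.
have -> : (1 + C + C * c^-1) * L i * `|z - x| =
  (1 + C) * (L i * `|z - x|) + C * L i * `|z - x| / c by ring.
have : `|b - a| <= C * L i * `|z - x| / c by rewrite ler_pdivlMr.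
have : 0 <= (1 + C) * (L i * `|z - x|) by rewrite !mulr_ge0 //; lra.
lra.
Qed.

Lemma tameM (f g : I -> P -> R) : tame f -> tame g -> tame (fun i x => f i x * g i x).
Proof.
apply: (@tame_bilinear R R R _ 1) => //; first by move=> a b; rewrite mul1r normrM.
by move=> a a' b b'; ring.
Qed.

Lemma tameZ W (f : I -> P -> R) (g : I -> P -> W) : tame f -> tame g ->
  tame (fun i x => f i x *: g i x).
Proof.
apply: (@tame_bilinear R W W (fun a b => a *: b) 1) => //.
  by move=> a b; rewrite mul1r normrZ.
by move=> a a' b b'; rewrite scalerBl scalerBr addrA subrK.
Qed.

Lemma tame_cross (f g : I -> P -> 'rV[R]_3) : tame f -> tame g ->
  tame (fun i x => cross (f i x) (g i x)).
Proof.
apply: (tame_bilinear (c := 2)) => //; first exact: cross_norm.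
by move=> a a' b b'; rewrite crossBl crossBr addrA subrK.
Qed.

Lemma tame_dot (f g : I -> P -> 'rV[R]_3) : tame f -> tame g ->
  tame (fun i x => dot (f i x) (g i x)).
Proof.
apply: (tame_bilinear (c := 3)) => //; first exact: dot_norm.
by move=> a a' b b'; rewrite dotDl dotNl dotDr dotNr addrA subrK.
Qed.

End Families.

(** * The normal and tangential amplitudes of a corrugation *)

Section Fields.
Variable R : realType.
Local Notation P := (R * R)%type.
Local Notation V := 'rV[R]_3.

(** The data of one corrugation, collected in a type so that it can index a [tame] family: the
    resulting constants depend on [Lam] only. By [dot_cross_cross], [fr_det] bounds the Gram
    determinant from below. *)
Record frame (Lam : R) := Frame {
  frL : R; frp : P -> V; frq : P -> V; frb : P -> R; frnu : P;
  frL0 : 0 <= frL;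
  frp_bnd : bnd Lam frp; frq_bnd : bnd Lam frq;
  frp_lip : lip frL frp; frq_lip : lip frL frq; frb_lip : lip frL frb;
  frb_itv : forall x, Lam^-1 <= frb x <= Lam;
  frnu_le : `|frnu| <= Lam;
  fr_det : forall x, Lam^-1 <= dot (cross (frp x) (frq x)) (cross (frp x) (frq x)) }.

(* [N] is normal and [X] tangential; [dot _ X] has to compensate the          *)
(* oscillating part of [(cos a)^2 dot N N = b + b cos (2 a)].                  *)
Lemma corrugation_fields (Lam : R) : 1 <= Lam -> exists2 C : R, 1 <= C &
  forall F : frame Lam, exists N X : P -> V,
  let p := frp F in let q := frq F in let b := frb F in
  [/\ bnd C N /\ bnd C X, lip (C * frL F) N /\ lip (C * frL F) X,
      forall x, [/\ dot (p x) (N x) = 0, dot (q x) (N x) = 0,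
                    dot (N x) (N x) = 2 * b x & dot (N x) (X x) = 0]
    & forall x, dot (p x) (X x) = b x / 4 * (frnu F).1 /\
                dot (q x) (X x) = b x / 4 * (frnu F).2].
Proof.
move=> L1; have L0 : 0 < Lam by lra.
have Li : 0 < Lam^-1 by rewrite invr_gt0.
pose I := frame Lam; pose L (i : I) := frL i.
have hL (i : I) : 0 <= L i by exact: frL0.
have tp : tame L (fun i : I => frp i).
  exists (Lam + 1); [lra|move=> i]; split.
    by apply: bnd_le (frp_bnd i); lra.
  by apply: lip_le (frp_lip i); have := hL i; rewrite /L; nra.
have tq : tame L (fun i : I => frq i).
  exists (Lam + 1); [lra|move=> i]; split.
    by apply: bnd_le (frq_bnd i); lra.
  by apply: lip_le (frq_lip i); have := hL i; rewrite /L; nra.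
have tb : tame L (fun i : I => frb i).
  exists (Lam + 1); [lra|move=> i]; split.
    by move=> x; have := frb_itv i x; rewrite ler_norml; lra.
  by apply: lip_le (frb_lip i); have := hL i; rewrite /L; nra.
have t1 : tame L (fun (i : I) _ => (frnu i).1).
  apply: (tame_cst hL (ltW L0)) => i; exact: le_trans (norm1_le _) (frnu_le i).
have t2 : tame L (fun (i : I) _ => (frnu i).2).
  apply: (tame_cst hL (ltW L0)) => i; exact: le_trans (norm2_le _) (frnu_le i).
have tc (k : R) : tame L (fun (i : I) _ => k).
  by apply: (tame_cst hL (normr_ge0 k)).
pose m (i : I) x := cross (frp i x) (frq i x).
have tm : tame L m by exact: tame_cross.
pose D (i : I) x := dot (m i x) (m i x).
have tD : tame L D by exact: tame_dot.
have D0 i x : 0 < D i x by rewrite (lt_le_trans Li) // fr_det.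
have tDi : tame L (fun i x => (D i x)^-1).
  apply: (tame_inv hL Li) => // i x; exact: fr_det.
have [CD CD0 hCD] := tD.
(* The radicand is kept away from 0, where the square root is not Lipschitz: [b] is at least
   [1 / Lam], and the squared length [D] of the cross product is at most [CD]. *)
have tr : tame L (fun i x => Num.sqrt (2 * frb i x * (D i x)^-1)).
  have c0 : 0 < (Lam * (CD + 1))^-1 by rewrite invr_gt0 mulr_gt0 //; lra.
  have c1 : (Lam * (CD + 1))^-1 <= 1.
    rewrite invf_le1 ?mulr_gt0 //; last lra.
    by nra.
  apply: (tame_sqrt hL c0); last first.
    by apply: tameM => //; apply: tameM => //; exact: tc.
  move=> i x; have [/(_ x) bD _] := hCD i.
  have /andP[b1 _] := frb_itv i x.
  have h1 : (Lam * (CD + 1))^-1 <= frb i x * (D i x)^-1.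
    rewrite invfM; apply: ler_pM; rewrite ?invr_ge0 //; [lra|lra|].
    rewrite lef_pV2 ?posrE //; last lra.
    by move: bD; rewrite ger0_norm ?(ltW (D0 _ _)) //; lra.
  nra.
(* [N] is the cross product [m] rescaled to squared length [2 b]. The vectors [cross q m] and
   [cross m p] are, up to the factor [D], the basis dual to [p], [q] in the tangent plane; [X]
   combines them to have the prescribed products. *)
have tN : tame L (fun i x => Num.sqrt (2 * frb i x * (D i x)^-1) *: m i x) by exact: tameZ.
have tX : tame L (fun i x => (frb i x * 4^-1 * (D i x)^-1) *:
   ((frnu i).1 *: cross (frq i x) (m i x) + (frnu i).2 *: cross (m i x) (frp i x))).
  apply: tameZ => //; first by apply: tameM => //; apply: tameM => //; exact: tc.
  by apply: tameD; apply: tameZ => //; apply: tame_cross.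
have [C1 C10 h1] := tN; have [C2 C20 h2] := tX.
exists (1 + C1 + C2); first lra.
move=> F; eexists; eexists; split.
- split; [apply: bnd_le (proj1 (h1 F))|apply: bnd_le (proj1 (h2 F))]; lra.
- have := hL F; rewrite /L => LF.
  split; [apply: lip_le (proj2 (h1 F))|apply: lip_le (proj2 (h2 F))]; rewrite ler_wpM2r //; lra.
- move=> x; rewrite !(dotZl, dotZr, dotDr) /m dot_cross_l dot_cross_r.
  rewrite (dot_cross_l (cross _ _)) (dot_cross_r (frq F x)) !mulr0 addr0 !mulr0; split=> //.
  have := D0 F x; have /andP[b1 _] := frb_itv F x => hD.
  rewrite mulrA -expr2 sqr_sqrtr -/(m F x) -/(D F x) ?mulfVK ?gt_eqF //.
  by rewrite !mulr_ge0 ?invr_ge0 //; lra.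
move=> x; have := D0 F x => hD; have hn : D F x != 0 by rewrite gt_eqF.
rewrite !(dotZl, dotZr, dotDr) !dot_cross_l !dot_cross_r.
rewrite (dot_cross_rot (frp F x)) (dotC (frq F x)) -(dot_cross_rot _ (frp F x)).
rewrite -/(m F x) -/(D F x) !mulr0 addr0 add0r; split; field.
  by [].
by [].
Qed.

End Fields.

(** * One corrugation: its data and its existence *)

Section Corrugation.
Variable R : realType.
Local Notation P := (R * R)%type.
Local Notation V := 'rV[R]_3.

(** With [N] and [X] frozen, the map [h (e sin a N - e^2 sin (2 a) X)] at phase [a = phase nu x / h]
    has partial derivatives [nu.1] and [nu.2] times this vector. *)
Definition profile (e a : R) (N X : V) : V :=
  (e * cos a) *: N - (2 * e ^+ 2 * cos (2 * a)) *: X.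

Definition nondeg (Lam : R) (p q : P -> V) :=
  [/\ bnd Lam p, bnd Lam q & forall x, Lam^-1 <= dot (cross (p x) (q x)) (cross (p x) (q x))].

(** By [co_hL] the amplitudes vary by about [e^4] over a length [h], the order of the metric terms
    that are neglected anyway. [co_grad] and [co_diff] give the same picture for gradients and for
    finite increments. *)
Record corrugation (c e h L : R) (nu : P) (b : P -> R) (u p q N X u' p' q' : P -> V)
    : Prop := Corrugation {
  co_c : 1 <= c;
  co_e : 0 < e <= 1;
  co_L : 1 <= L;
  co_h : 0 < h;
  co_hL : c * L * h = e ^+ 4;
  co_nu : `|nu| <= c;
  co_b : forall x, c^-1 <= b x <= c;
  co_nd : nondeg c p q;
  co_NX : bnd c N /\ bnd c X;
  co_lip : [/\ lip (c * L) N, lip (c * L) X & lip L q];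
  co_tay : tay L u p q;
  co_ortho : forall x, [/\ dot (p x) (N x) = 0, dot (q x) (N x) = 0,
                dot (N x) (N x) = 2 * b x & dot (N x) (X x) = 0];
  co_tang : forall x, dot (p x) (X x) = b x / 4 * nu.1 /\ dot (q x) (X x) = b x / 4 * nu.2;
  co_grad : forall x,
    `|p' x - p x - nu.1 *: profile e (phase nu x / h) (N x) (X x)| <= c * e ^+ 4 /\
    `|q' x - q x - nu.2 *: profile e (phase nu x / h) (N x) (X x)| <= c * e ^+ 4;
  co_diff : forall x z, `|(u' z - u z) - (u' x - u x)
     - (h * e * (sin (phase nu z / h) - sin (phase nu x / h))) *: N x
     + (h * e ^+ 2 * (sin (2 * (phase nu z / h)) - sin (2 * (phase nu x / h)))) *: X x|
     <= c * e ^+ 4 * `|z - x|;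
  co_dist : forall x, `|u' x - u x| <= c * h }.

Lemma profile_diff (e a s : R) (p p1 p2 N X : V) :
  p + (p1 - p2) - p - s *: profile e a N X =
  (p1 - (s * cos a) *: (e *: N)) - (p2 - (2 * s * cos (2 * a)) *: (e ^+ 2 *: X)).
Proof.
by rewrite /profile; move: (cos _) (cos _) => C1 C2; apply: row3P; rewrite !mxE; ring.
Qed.

(** Two waves are superposed: [e N] along [nu], and [e^2 X] along [2 nu], which doubles the phase.
    The regularity constant becomes of order [1 / h], that is [c L / e^4]. *)
Lemma corrugation_exists (Lam : R) : 1 <= Lam -> exists c c' : R, [/\ 1 <= c, 1 <= c' &
  forall (e L : R) nu b u p q, 0 < e <= 1 -> 1 <= L -> `|nu| <= Lam ->
    (forall x, Lam^-1 <= b x <= Lam) -> lip L b -> nondeg Lam p q ->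
    lip L p -> lip L q -> tay L u p q ->
  exists h N X u' p' q', corrugation c e h L nu b u p q N X u' p' q' /\
    [/\ tay (c' * L / e ^+ 4) u' p' q', lip (c' * L / e ^+ 4) p' & lip (c' * L / e ^+ 4) q']].
Proof.
move=> L1; have [C C1 HC] := corrugation_fields L1.
(* One constant for the amplitudes ([C]) and for the directions [nu] and [2 nu] ([2 Lam]). *)
pose Lw := C + 2 * Lam; have Lw1 : 1 <= Lw by rewrite /Lw; lra.
pose Cw := 1000 * Lw ^+ 3.
have Cw0 : 0 <= Cw by apply: mulr_ge0; [exact: ler0n|apply: exprn_ge0; lra].
pose c := Lw + 2 * Cw.
have cL : Lw <= c by rewrite /c; lra.
have cC : C <= c by rewrite /Lw in cL; lra.
have cLam : Lam <= c by rewrite /Lw in cL; lra.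
have cCw : 2 * Cw <= c by rewrite /c; lra.
have c1 : 1 <= c by lra.
have cV : c^-1 <= Lam^-1 by rewrite lef_pV2 ?posrE //; clear -L1 c1 cLam; lra.
have waveLw := fun h L nu F => @wave R Lw h L nu F.
rewrite -/Cw in waveLw.
clearbody Cw c.
have Cwc : 0 <= Cw * c by apply: mulr_ge0; lra.
exists c, (1 + 2 * Cw * c); split=> //; first lra.
move=> e L nu b u p q /andP[e0 e1] hL hnu hb lb [bp bq hdet] lp lq tu.
have L0 : 0 <= L by lra.
have [N [X [[bN bX] [lN lX] ort tang]]] :=
  HC (@Frame R Lam L p q b nu L0 bp bq lp lq lb hb hnu hdet).
rewrite /= in lN lX ort tang.
have e4 : 0 < e ^+ 4 by rewrite exprn_gt0.
have e41 : e ^+ 4 <= 1 by rewrite exprn_ile1 // ltW.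
have CL : 0 < C * L by rewrite mulr_gt0; lra.
pose h := e ^+ 4 / (c * L).
have cL0 : 0 < c * L by rewrite mulr_gt0; lra.
have h0 : 0 < h by rewrite divr_gt0.
have hcL : c * L * h = e ^+ 4 by rewrite /h; field; rewrite gt_eqF; lra.
have hCL : h * (C * L) <= e ^+ 4.
  rewrite -hcL mulrC ler_wpM2r ?(ltW h0) //; rewrite ler_wpM2r //; lra.
have hCL1 : h * (C * L) <= 1 by lra.
have bN' : bnd Lw (fun x => e *: N x).
  move=> x; rewrite normrZ gtr0_norm //.
  have := bN x; have := normr_ge0 (N x); rewrite /Lw; nra.
have e2 : 0 < e ^+ 2 <= 1 by rewrite exprn_gt0 //= exprn_ile1 // ltW.
have bX' : bnd Lw (fun x => e ^+ 2 *: X x).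
  move=> x; rewrite normrZ gtr0_norm; last lra.
  have := bX x; have := normr_ge0 (X x); rewrite /Lw; nra.
have lN' : lip (C * L) (fun x => e *: N x).
  apply: lip_le (lipZ _ lN); rewrite gtr0_norm // -[leRHS]mul1r ler_wpM2r //; lra.
have lX' : lip (C * L) (fun x => e ^+ 2 *: X x).
  apply: lip_le (lipZ _ lX); rewrite gtr0_norm ?exprn_gt0 // -[leRHS]mul1r ler_wpM2r //; lra.
have hnu1 : `|nu| <= Lw by rewrite /Lw; lra.
have hnu2 : `|2 *: nu| <= Lw.
  by rewrite normrZ ger0_norm // /Lw; lra.
have [w1 [p1 [q1 [tw1 [lp1 lq1] bw1 ep1 ew1]]]] :=
  waveLw h (C * L) nu _ Lw1 hnu1 h0 (ltW CL) hCL1 bN' lN'.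
have [w2 [p2 [q2 [tw2 [lp2 lq2] bw2 ep2 ew2]]]] :=
  waveLw h (C * L) (2 *: nu) _ Lw1 hnu2 h0 (ltW CL) hCL1 bX' lX'.
have err : Cw * (h * (C * L)) <= Cw * e ^+ 4 by rewrite ler_wpM2l.
have ph2 x : phase (2 *: nu) x / h = 2 * (phase nu x / h).
  by rewrite /phase /= /GRing.scale /=; ring.
have tw2' : tay (Cw / h) (fun x => - w2 x) (fun x => - p2 x) (fun x => - q2 x).
  move=> x z; have := tw2 x z; rewrite -normrN; congr (`|_| <= _).
  by rewrite /lin /= !scalerN; move: (_ *: p2 x) (_ *: q2 x) (w2 x) (w2 z) => ? ? ? ?; clear; apply: row3P; rewrite !mxE; ring.
have K' : L + (Cw / h + Cw / h) <= (1 + 2 * Cw * c) * L / e ^+ 4.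
  have hi : h^-1 = c * L / e ^+ 4 by rewrite /h invf_div.
  rewrite hi -(@ler_pM2r _ (e ^+ 4)) // mulfVK ?gt_eqF // mulrDl.
  have -> : (Cw * (c * L / e ^+ 4) + Cw * (c * L / e ^+ 4)) * e ^+ 4 = 2 * Cw * c * L.
    by field; rewrite gt_eqF.
  have := ler_wpM2l L0 e41; clear; lra.
exists h, N, X, (fun x => u x + (w1 x - w2 x)), (fun x => p x + (p1 x - p2 x)),
  (fun x => q x + (q1 x - q2 x)); split; last first.
  split; first by apply: tay_le K' _; apply: tayD => //; exact: (tayD tw1 tw2').
    by apply: lip_le K' _; apply: lipD => //; exact: (lipD lp1 (lipN lp2)).
  by apply: lip_le K' _; apply: lipD => //; exact: (lipD lq1 (lipN lq2)).
split; [exact: c1|by rewrite e0|exact: hL|exact: h0|exact: hcL|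
  exact: le_trans hnu cLam|..|exact: tu|exact: ort|exact: tang| | |].
- by move=> x; have /andP[h1 h2] := hb x; rewrite (le_trans cV h1) (le_trans h2 cLam).
- split; [exact: bnd_le bp|exact: bnd_le bq|move=> x].
  exact: le_trans cV (hdet x).
- by split; [exact: bnd_le bN|exact: bnd_le bX].
- have : C * L <= c * L by rewrite ler_wpM2r.
  by move=> cl; split=> //; [exact: lip_le lN|exact: lip_le lX].
- move=> x; have [a1 a2] := ep1 x; have [a3 a4] := ep2 x.
  rewrite ph2 in a3 a4; split.
    have -> : p x + (p1 x - p2 x) - p x - nu.1 *: profile e (phase nu x / h) (N x) (X x) =
      (p1 x - (nu.1 * cos (phase nu x / h)) *: (e *: N x)) -
      (p2 x - ((2 *: nu).1 * cos (2 * (phase nu x / h))) *: (e ^+ 2 *: X x)).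
      exact: profile_diff.
    rewrite (le_trans (ler_normB _ _)) // (le_trans (lerD a1 a3)) //.
    by have := ler_wpM2r (ltW e4) cCw; move: err; clear; lra.
  have -> : q x + (q1 x - q2 x) - q x - nu.2 *: profile e (phase nu x / h) (N x) (X x) =
    (q1 x - (nu.2 * cos (phase nu x / h)) *: (e *: N x)) -
    (q2 x - ((2 *: nu).2 * cos (2 * (phase nu x / h))) *: (e ^+ 2 *: X x)).
    exact: profile_diff.
  rewrite (le_trans (ler_normB _ _)) // (le_trans (lerD a2 a4)) //.
  by have := ler_wpM2r (ltW e4) cCw; move: err; clear; lra.
- move=> x z; have a1 := ew1 x z; have a2 := ew2 x z; rewrite !ph2 in a2.
  set s1 := sin (phase nu z / h) - _ in a1 *.
  set s2 := sin (2 * _) - _ in a2 *.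
  have -> : u z + (w1 z - w2 z) - u z - (u x + (w1 x - w2 x) - u x) -
     (h * e * s1) *: N x + (h * e ^+ 2 * s2) *: X x =
     (w1 z - w1 x - (h * s1) *: (e *: N x)) - (w2 z - w2 x - (h * s2) *: (e ^+ 2 *: X x)).
    rewrite !scalerA -(mulrA h e) (mulrC e s1) mulrA -(mulrA h _ s2) (mulrC _ s2) mulrA.
    move: (_ *: N x) (_ *: X x) (u z) (u x) (w1 z) (w1 x) (w2 z) (w2 x) => ? ? ? ? ? ? ? ?.
    by clear; apply: row3P; rewrite !mxE; ring.
  rewrite (le_trans (ler_normB _ _)) // (le_trans (lerD a1 a2)) //.
  rewrite -mulrDl ler_wpM2r //; clear a1 a2.
  by have := ler_wpM2r (ltW e4) cCw; move: err; clear; lra.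
- move=> x; have -> : u x + (w1 x - w2 x) - u x = w1 x - w2 x by rewrite addrAC subrr add0r.
  rewrite (le_trans (ler_normB _ _)) // (le_trans (lerD (bw1 x) (bw2 x))) //.
  by have := ler_wpM2r (ltW h0) cCw; clear; lra.
Qed.

End Corrugation.

(** * The metric of a corrugated frame *)

Section StepEstimates.
Variable R : realType.
Local Notation P := (R * R)%type.
Local Notation V := 'rV[R]_3.

Lemma cos_double (a : R) : cos (2 * a) = 2 * cos a ^+ 2 - 1.
Proof.
rewrite mulr_natl mulr2n cosD -!expr2.
have := cos2Dsin2 a; lra.
Qed.

Lemma profile_le (c e a : R) (N X : V) : 0 < e <= 1 -> `|N| <= c -> `|X| <= c ->
  `|profile e a N X| <= 3 * c * e.
Proof.
move=> /andP[e0 e1] hN hX; rewrite (le_trans (ler_normB _ _)) // (normrZ _ N) (normrZ _ X).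
have c0 : 0 <= c by rewrite (le_trans _ hN).
have h1 : `|e * cos a| <= e * 1 by rewrite normrM gtr0_norm // ler_pM2l // cos_max.
have h2 : `|2 * e ^+ 2 * cos (2 * a)| <= 2 * e * 1.
  rewrite normrM ler_pM ?cos_max // ger0_norm; first by rewrite expr2; nra.
  by rewrite mulr_ge0 // sqr_ge0.
have h3 := ler_pM (normr_ge0 _) (normr_ge0 _) h1 hN.
have h4 := ler_pM (normr_ge0 _) (normr_ge0 _) h2 hX.
by apply: (le_trans (lerD h3 h4)); lra.
Qed.

(** The normal part contributes [2 e^2 b (cos a)^2 = e^2 b (1 + cos (2 a))] times [n1 n2]. The
    products of [P1], [P2] with [X] contribute [- e^2 b cos (2 a)] times [n1 n2], so the oscillation
    cancels at order [e^2]. *)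
Lemma metric_identity (e b n1 n2 a : R) (P1 P2 N X r1 r2 : V) :
  dot P1 N = 0 -> dot P2 N = 0 -> dot P1 X = b / 4 * n1 -> dot P2 X = b / 4 * n2 ->
  dot N N = 2 * b -> dot N X = 0 ->
  let s := profile e a N X in
  dot (P1 + n1 *: s + r1) (P2 + n2 *: s + r2) - dot P1 P2 - e ^+ 2 * b * (n1 * n2) =
  4 * e ^+ 4 * cos (2 * a) ^+ 2 * (n1 * n2) * dot X X + (dot P1 r2 + dot r1 P2)
   + (n1 * dot s r2 + n2 * dot r1 s) + dot r1 r2.
Proof.
move=> h1 h2 h3 h4 h5 h6 s.
have sP Q n : dot Q N = 0 -> dot Q X = b / 4 * n ->
    dot Q s = - (2 * e ^+ 2 * cos (2 * a)) * (b / 4 * n).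
  by move=> hN hX; rewrite /s /profile dotDr dotNr !dotZr hN hX; ring.
have ss : dot s s = e ^+ 2 * cos a ^+ 2 * (2 * b) + 4 * e ^+ 4 * cos (2 * a) ^+ 2 * dot X X.
  rewrite /s /profile !(dotDl, dotDr, dotNl, dotNr, dotZl, dotZr) (dotC X N) h5 h6.
  by ring.
clearbody s; rewrite !(dotDl, dotDr, dotZl, dotZr) (dotC s P2) (sP _ _ h1 h3) (sP _ _ h2 h4) ss.
by rewrite cos_double; field.
Qed.

Lemma metric_error (c e b n1 n2 a : R) (P1 P2 N X r1 r2 : V) : 1 <= c -> 0 < e <= 1 ->
  [/\ `|P1| <= c, `|P2| <= c, `|N| <= c & `|X| <= c] -> `|n1| <= c -> `|n2| <= c ->
  `|r1| <= c * e ^+ 4 -> `|r2| <= c * e ^+ 4 ->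
  dot P1 N = 0 -> dot P2 N = 0 -> dot P1 X = b / 4 * n1 -> dot P2 X = b / 4 * n2 ->
  dot N N = 2 * b -> dot N X = 0 ->
  `|dot (P1 + n1 *: profile e a N X + r1) (P2 + n2 *: profile e a N X + r2) - dot P1 P2
    - e ^+ 2 * b * (n1 * n2)| <= 40 * c ^+ 4 * e ^+ 4.
Proof.
move=> c1 he [bP1 bP2 bN bX] bn1 bn2 br1 br2 h1 h2 h3 h4 h5 h6; set s := profile e a N X.
rewrite (@metric_identity e b n1 n2 a) // -/s.
have bs : `|s| <= 3 * c by have := profile_le a he bN bX; move/le_trans; apply; nra.
have e40 : 0 <= e ^+ 4 by rewrite exprn_ge0; lra.
have e41 : e ^+ 4 <= 1 by rewrite exprn_ile1; lra.
have pw k m : (k <= m)%N -> c ^+ k * e ^+ 4 <= c ^+ m * e ^+ 4.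
  by move=> km; rewrite ler_wpM2r // ler_weXn2l.
have p24 := pw 2%N 4%N isT; have p34 := pw 3%N 4%N isT.
have dn (x y : V) (A B : R) : `|x| <= A -> `|y| <= B -> `|dot x y| <= 3 * (A * B).
  move=> hx hy; rewrite (le_trans (dot_norm _ _)) // ler_wpM2l // ler_pM //.
have d1 := dn _ _ _ _ bP1 br2; have d2 := dn _ _ _ _ br1 bP2.
have d3 := ler_pM (normr_ge0 _) (normr_ge0 _) bn1 (dn _ _ _ _ bs br2).
have d4 := ler_pM (normr_ge0 _) (normr_ge0 _) bn2 (dn _ _ _ _ br1 bs).
have d5 := dn _ _ _ _ br1 br2; have d6 := dn _ _ _ _ bX bX.
rewrite -normrM in d3; rewrite -normrM in d4.
have d7 : `|4 * e ^+ 4 * cos (2 * a) ^+ 2 * (n1 * n2) * dot X X| <=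
    4 * e ^+ 4 * 1 * (c * c) * (3 * (c * c)).
  have e44 : 0 <= 4 * e ^+ 4 by rewrite mulr_ge0.
  have k1 : `|cos (2 * a) ^+ 2| <= 1 by rewrite normrX exprn_ile1 // cos_max.
  have k2 : `|n1 * n2| <= c * c by rewrite normrM ler_pM.
  have m1 := ler_pM e44 (normr_ge0 _) (lexx _) k1.
  have m2 := ler_pM (mulr_ge0 e44 (normr_ge0 _)) (normr_ge0 _) m1 k2.
  have m3 := ler_pM (mulr_ge0 (mulr_ge0 e44 (normr_ge0 _)) (normr_ge0 _)) (normr_ge0 _) m2 d6.
  by rewrite (normrM _ (dot X X)) (normrM _ (n1 * n2)) (normrM (4 * e ^+ 4)) (ger0_norm e44).
rewrite (le_trans (ler_normD _ _)) // (le_trans (lerD (ler_normD _ _) d5)) //.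
rewrite (le_trans (lerD (lerD (ler_normD _ _) (ler_normD _ _)) (lexx _))) //.
rewrite (le_trans (lerD (lerD (lerD d7 (ler_normD _ _)) (lerD d3 d4)) (lexx _))) //.
rewrite (le_trans (lerD (lerD (lerD (lexx _) (lerD d1 d2)) (lexx _)) (lexx _))) //.
have e48 : e ^+ 4 * e ^+ 4 <= e ^+ 4 by nra.
have d8 : 3 * (c * e ^+ 4 * (c * e ^+ 4)) <= 3 * (c ^+ 2 * e ^+ 4).
  have := ler_wpM2l (sqr_ge0 c) e48; lra.
apply: (le_trans (lerD (lexx _) d8)).
have p0 : 0 <= c ^+ 4 * e ^+ 4 by rewrite mulr_ge0 // exprn_ge0; lra.
clear -p24 p34 p0; lra.
Qed.

(** With Gram entries [E], [F], [G] and quadratic form [Q], completing the square gives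
    [E Q >= (E G - F^2) k.2^2], and symmetrically for [k.1]; here [c (E G - F^2) >= 1] and [E], [G]
    are at most [3 c^2]. *)
Lemma quadratic_lower (c : R) (p q : P -> V) x (k : P) : 1 <= c -> nondeg c p q ->
  `|k| ^+ 2 <= 3 * c ^+ 3 * dot (lin p q x k) (lin p q x k).
Proof.
move=> c1 [bp bq /(_ x)]; rewrite dot_cross_cross /lin.
rewrite !(dotDl, dotDr, dotZl, dotZr) (dotC (q x) (p x)).
have hE : dot (p x) (p x) <= 3 * c ^+ 2.
  have := dot_norm (p x) (p x); have := ler_norm (dot (p x) (p x)).
  have := ler_pM (normr_ge0 _) (normr_ge0 _) (bp x) (bp x); rewrite expr2; lra.
have hG : dot (q x) (q x) <= 3 * c ^+ 2.
  have := dot_norm (q x) (q x); have := ler_norm (dot (q x) (q x)).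
  have := ler_pM (normr_ge0 _) (normr_ge0 _) (bq x) (bq x); rewrite expr2; lra.
have E0 := dot_ge0 (p x); have G0 := dot_ge0 (q x).
move: hE hG E0 G0; set E := dot (p x) (p x); set G := dot (q x) (q x); set F := dot (p x) _.
move=> hE hG E0 G0 hD.
have c0 : 0 < c by lra.
have {}hD : 1 <= c * (E * G - F ^+ 2) by rewrite -ler_pdivrMl // mulr1.
set Q := (X in _ <= 3 * c ^+ 3 * X).
have hQ : Q = k.1 ^+ 2 * E + 2 * k.1 * k.2 * F + k.2 ^+ 2 * G by rewrite /Q; ring.
have Q0 : 0 <= Q.
  have <- : dot (k.1 *: p x + k.2 *: q x) (k.1 *: p x + k.2 *: q x) = Q.
    by rewrite !(dotDl, dotDr, dotZl, dotZr) (dotC (q x) (p x)) hQ -/E -/F -/G; ring.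
  exact: dot_ge0.
have a1 : c * (E * G - F ^+ 2) * k.2 ^+ 2 <= 3 * c ^+ 3 * Q.
  have : c * (E * G - F ^+ 2) * k.2 ^+ 2 <= c * (E * Q).
    have -> : c * (E * Q) = c * (E * G - F ^+ 2) * k.2 ^+ 2 + c * (k.1 * E + k.2 * F) ^+ 2.
      by rewrite hQ; ring.
    by rewrite lerDl mulr_ge0 ?sqr_ge0 // ltW.
  move/le_trans; apply; have := ler_wpM2l (ltW c0) (ler_wpM2r Q0 hE); lra.
have a2 : c * (E * G - F ^+ 2) * k.1 ^+ 2 <= 3 * c ^+ 3 * Q.
  have : c * (E * G - F ^+ 2) * k.1 ^+ 2 <= c * (G * Q).
    have -> : c * (G * Q) = c * (E * G - F ^+ 2) * k.1 ^+ 2 + c * (k.2 * G + k.1 * F) ^+ 2.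
      by rewrite hQ; ring.
    by rewrite lerDl mulr_ge0 ?sqr_ge0 // ltW.
  move/le_trans; apply; have := ler_wpM2l (ltW c0) (ler_wpM2r Q0 hG); lra.
have := ler_wpM2r (sqr_ge0 k.1) hD; have := ler_wpM2r (sqr_ge0 k.2) hD; rewrite !mul1r.
move=> b2 b1; have {a1 b2}a1 := le_trans b2 a1; have {a2 b1}a2 := le_trans b1 a2.
rewrite prod_normE /Num.max; case: ifP => _; by rewrite real_normK ?num_real.
Qed.

End StepEstimates.

(** * Consequences of one corrugation *)

Section Step.
Variable R : realType.
Local Notation P := (R * R)%type.
Local Notation V := 'rV[R]_3.

(* the entries (1,1), (1,2), (2,2) of a symmetric form *)
Definition sqform := (R * R * R)%type.

Definition met (p q : P -> V) (x : P) : sqform := (dot (p x) (p x), dot (p x) (q x), dot (q x) (q x)).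

Definition rank1 (nu : P) : sqform := (nu.1 * nu.1, nu.1 * nu.2, nu.2 * nu.2).

Lemma sqform_norm_le (a : sqform) (B : R) : `|a.1.1| <= B -> `|a.1.2| <= B -> `|a.2| <= B ->
  `|a| <= B.
Proof. by rewrite !prod_normE !ge_max => -> -> ->. Qed.

Implicit Types (c e h L : R) (nu : P) (b : P -> R) (u p q N X : P -> V).

Lemma corrugation_metric c e h L nu b u p q N X u' p' q'
    (H : corrugation c e h L nu b u p q N X u' p' q') x :
  `|met p' q' x - met p q x - (e ^+ 2 * b x) *: rank1 nu| <= 40 * c ^+ 4 * e ^+ 4.
Proof.
have [bp bq _] := co_nd H; have [bN bX] := co_NX H.
have [ort1 ort2 ort3 ort4] := co_ortho H x; have [t1 t2] := co_tang H x.
have [] := co_grad H x; set a := phase nu x / h; set s := profile _ _ _ _ => g1 g2.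
have n1 := le_trans (norm1_le _) (co_nu H); have n2 := le_trans (norm2_le _) (co_nu H).
have e1 : p' x = p x + nu.1 *: s + (p' x - p x - nu.1 *: s).
  by apply: row3P; rewrite !mxE; ring.
have e2 : q' x = q x + nu.2 *: s + (q' x - q x - nu.2 *: s).
  by apply: row3P; rewrite !mxE; ring.
have hc := co_c H; have he := co_e H.
have := bX x; have := bN x; have := bp x; have := bq x => hq hp hN hX.
apply: sqform_norm_le.
- change (`|dot (p' x) (p' x) - dot (p x) (p x) - e ^+ 2 * b x * (nu.1 * nu.1)|
    <= 40 * c ^+ 4 * e ^+ 4).
  rewrite e1; exact: (@metric_error _ c e (b x) nu.1 nu.1 a (p x) (p x) (N x) (X x)).
- change (`|dot (p' x) (q' x) - dot (p x) (q x) - e ^+ 2 * b x * (nu.1 * nu.2)|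
    <= 40 * c ^+ 4 * e ^+ 4).
  rewrite e1 e2; exact: (@metric_error _ c e (b x) nu.1 nu.2 a (p x) (q x) (N x) (X x)).
- change (`|dot (q' x) (q' x) - dot (q x) (q x) - e ^+ 2 * b x * (nu.2 * nu.2)|
    <= 40 * c ^+ 4 * e ^+ 4).
  rewrite e2; exact: (@metric_error _ c e (b x) nu.2 nu.2 a (q x) (q x) (N x) (X x)).
Qed.

Lemma corrugation_num c e h L nu b u p q N X u' p' q'
    (H : corrugation c e h L nu b u p q N X u' p' q') :
  [/\ 1 <= c, 0 < e, e <= 1, e ^+ 4 <= e & c <= c ^+ 2].
Proof.
have c1 := co_c H; have /andP[e0 e1] := co_e H; split=> //.
  by rewrite -[leRHS]expr1 ler_wiXn2l // ltW.
by rewrite -[leLHS]expr1 ler_weXn2l.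
Qed.

Lemma corrugation_gradient c e h L nu b u p q N X u' p' q'
    (H : corrugation c e h L nu b u p q N X u' p' q') x : `|p' x - p x| <= 4 * c ^+ 2 * e /\ `|q' x - q x| <= 4 * c ^+ 2 * e.
Proof.
have [c1 e0 e1 e4e cc] := corrugation_num H.
have [bN bX] := co_NX H.
have [] := co_grad H x; set a := phase nu x / h; set s := profile _ _ _ _ => g1 g2.
have hs : `|s| <= 3 * c * e by apply: profile_le (co_e H) (bN x) (bX x).
have n1 := le_trans (norm1_le _) (co_nu H); have n2 := le_trans (norm2_le _) (co_nu H).
have k1 := ler_pM (normr_ge0 _) (normr_ge0 _) n1 hs.
have k2 := ler_pM (normr_ge0 _) (normr_ge0 _) n2 hs.
have k3 : c * e ^+ 4 <= c ^+ 2 * e.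
  by apply: ler_pM => //; [exact: (le_trans ler01 c1)|rewrite exprn_ge0 // ltW].
have fin y n (w : V) : `|w - y - n *: s| <= c * e ^+ 4 -> `|n| * `|s| <= c * (3 * c * e) ->
    `|w - y| <= 4 * c ^+ 2 * e.
  move=> m1 m2; have -> : w - y = (w - y - n *: s) + n *: s by rewrite subrK.
  rewrite (le_trans (ler_normD _ _)) // (normrZ n s) (le_trans (lerD m1 m2)) //.
  by clear -k3; lra.
by split; [exact: fin g1 k1|exact: fin g2 k2].
Qed.

(** The factor [h] compensates the division by [h] in the phase, so the bound does not see the
    wavelength. *)
Lemma sin_phase_le c e h L nu b u p q N X u' p' q'
    (H : corrugation c e h L nu b u p q N X u' p' q') k x z : 0 <= k ->
  `|h * (sin (k * (phase nu z / h)) - sin (k * (phase nu x / h)))| <= 2 * k * c * `|z - x|.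
Proof.
move=> k0; have h0 := co_h H; rewrite normrM gtr0_norm //.
rewrite (le_trans (ler_wpM2l (ltW h0) (sin_lip _ _))) //.
have -> : k * (phase nu z / h) - k * (phase nu x / h) = k / h * phase nu (z - x).
  by rewrite -phaseB; ring.
rewrite normrM (ger0_norm (_ : 0 <= k / h)) ?divr_ge0 ?(ltW h0) //.
have -> : h * (k / h * `|phase nu (z - x)|) = k * `|phase nu (z - x)|.
  by field; rewrite gt_eqF.
have := phase_le nu (z - x); have := ler_wpM2r (normr_ge0 (z - x)) (co_nu H) => m1 m2.
by apply: (le_trans (ler_wpM2l k0 m2)); have := ler_wpM2l k0 m1; lra.
Qed.

(** Smallness of the gradient correction in terms of increments; in this form it telescopes through
    the iteration. *)
Lemma corrugation_lip c e h L nu b u p q N X u' p' q'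
    (H : corrugation c e h L nu b u p q N X u' p' q') : lip (7 * c ^+ 2 * e) (fun x => u' x - u x).
Proof.
have [c1 e0 e1 e4e cc] := corrugation_num H.
move=> x z; have [bN bX] := co_NX H.
have := co_diff H x z; have := sin_phase_le H x z (ler0n R 2).
have := sin_phase_le H x z ler01; rewrite !mul1r mulr1.
set s1 := sin _ - _; set s2 := sin _ - _; set n := `|z - x| => b1 b2.
have n0 : 0 <= n by rewrite normr_ge0.
set D := _ - _ - (u' x - u x) => hD.
have -> : D = (D - (h * e * s1) *: N x + (h * e ^+ 2 * s2) *: X x)
   + e *: ((h * s1) *: N x) - e ^+ 2 *: ((h * s2) *: X x).
  by apply: row3P; rewrite !mxE; ring.
have f1 := ler_pM (normr_ge0 _) (normr_ge0 _) b1 (bN x).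
have f2 := ler_pM (normr_ge0 _) (normr_ge0 _) b2 (bX x).
have e2 : e ^+ 2 <= e by rewrite -[leRHS]expr1 ler_wiXn2l // ltW.
rewrite (le_trans (ler_normB _ _)) // (le_trans (lerD (ler_normD _ _) (lexx _))) //.
rewrite (normrZ e) (normrZ (e ^+ 2)) (normrZ _ (N x)) (normrZ _ (X x)).
rewrite (gtr0_norm e0) (ger0_norm (sqr_ge0 e)).
have g1 := ler_wpM2l (ltW e0) f1.
have f20 : 0 <= 2 * 2 * c * n * c by rewrite !mulr_ge0 ?(le_trans ler01 c1).
have g2 := ler_pM (sqr_ge0 e) (mulr_ge0 (normr_ge0 _) (normr_ge0 _)) e2 f2.
have g3 : c * e ^+ 4 * n <= c ^+ 2 * e * n.
  rewrite ler_wpM2r //; apply: ler_pM => //; first exact: (le_trans ler01 c1).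
  by rewrite exprn_ge0 // ltW.
apply: (le_trans (lerD (lerD (le_trans hD g3) g1) g2)).
by rewrite le_eqVlt; apply/orP; left; apply/eqP; ring.
Qed.

Lemma corrugation_bnd c e h L nu b u p q N X u' p' q'
    (H : corrugation c e h L nu b u p q N X u' p' q') x : `|u' x - u x| <= e ^+ 4.
Proof.
have [c1 e0 e1 e4e cc] := corrugation_num H.
rewrite (le_trans (co_dist H x)) // -(co_hL H) mulrAC ler_peMr ?(co_L H) //.
by rewrite mulr_ge0 ?(ltW (co_h H)) // (le_trans ler01 c1).
Qed.

(** At distances above [1 / (60 c^4 L)] the displacement, at most [c h] at each point, is small
    compared with the distance because [c L h = e^4]. For closer points the increment is tested
    against its tangential part [l]: the leading oscillation is along [N], orthogonal to [l], and
    the rest is small. This gives the absolute constant [1 / (1000 c^6)], which is at least [c0]. *)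
Lemma corrugation_bil c e h L nu b u p q N X u' p' q'
    (H : corrugation c e h L nu b u p q N X u' p' q') c0 : 1000 * c ^+ 6 * e <= 1 -> 1000 * c ^+ 6 * c0 <= 1 -> bil c0 u ->
  bil (c0 - 1000 * c ^+ 6 * e ^+ 4) u'.
Proof.
have [c1 e0 e1 e4e cc] := corrugation_num H.
move=> he hc0 hu x z.
have c0' : 0 < c by lra.
have c60 : 0 < c ^+ 6 by rewrite exprn_gt0.
have e40 : 0 < e ^+ 4 by rewrite exprn_gt0.
have L0 : 0 < L by have := co_L H; lra.
have c4 : 1 <= c ^+ 4 by rewrite exprn_ege1.
have c46 : c ^+ 4 <= c ^+ 6 by rewrite ler_weXn2l.
set n := `|z - x|; have n0 : 0 <= n by rewrite normr_ge0.
case: (leP (60 * c ^+ 4 * (L * n)) 1) => hn; last first.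
  have h1 := hu x z; have h2 := co_dist H x; have h3 := co_dist H z.
  have h4 : c * h <= 60 * c ^+ 4 * e ^+ 4 * n.
    have : c * h * L <= 60 * c ^+ 4 * e ^+ 4 * n * L.
      rewrite mulrAC (co_hL H); have := ler_wpM2l (ltW e40) (ltW hn); lra.
    by rewrite ler_pM2r.
  have h5 : `|u z - u x| <= `|u' z - u' x| + (c * h + c * h).
    have -> : u z - u x = (u' z - u' x) - ((u' z - u z) - (u' x - u x)).
      by apply: row3P; rewrite !mxE; ring.
    rewrite (le_trans (ler_normB _ _)) // lerD2l (le_trans (ler_normB _ _)) //.
    exact: lerD.
  have h6 : c ^+ 4 * (e ^+ 4 * n) <= c ^+ 6 * (e ^+ 4 * n).
    by rewrite ler_wpM2r // mulr_ge0 // ltW.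
  have h7 : 0 <= c ^+ 6 * (e ^+ 4 * n) by rewrite !mulr_ge0 // ltW.
  move: h1; rewrite -/n => h1.
  clear -h1 h4 h5 h6 h7; lra.
have [bp bq _] := co_nd H; have [bN bX] := co_NX H.
pose l := lin p q x (z - x).
have [ort1 ort2 _ _] := co_ortho H x.
have lN : dot l (N x) = 0 by rewrite /l /lin dotDl !dotZl ort1 ort2; ring.
have := quadratic_lower x (z - x) c1 (co_nd H); rewrite -/n -/l => hq.
have hl : `|l| <= 2 * c * n by apply: lin_le.
have := co_diff H x z; have := sin_phase_le H x z (ler0n R 2).
set s1 := sin (phase nu z / h) - _; set s2 := sin (2 * _) - _; rewrite -/n => b2.
set rho := (X in `|X| <= _) => hrho.
have := co_tay H x z; rewrite -/n -/l; set r0 := _ - _ - l => hr0.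
have ed : u' z - u' x = l + (h * e * s1) *: N x + (r0 - e ^+ 2 *: ((h * s2) *: X x) + rho).
  by rewrite /r0 /rho; apply: row3P; rewrite !mxE; ring.
have f2 := ler_pM (normr_ge0 _) (normr_ge0 _) b2 (bX x).
have rest : `|r0 - e ^+ 2 *: ((h * s2) *: X x) + rho| <= n * (L * n + 5 * c ^+ 2 * e ^+ 2).
  rewrite (le_trans (ler_normD _ _)) // (le_trans (lerD (ler_normB _ _) hrho)) //.
  rewrite (normrZ (e ^+ 2)) (normrZ _ (X x)) (ger0_norm (sqr_ge0 e)).
  rewrite (le_trans (lerD (lerD hr0 (ler_wpM2l (sqr_ge0 e) f2)) (lexx _))) //.
  have h42 : e ^+ 4 <= e ^+ 2 by rewrite ler_wiXn2l // ltW.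
  have : c * e ^+ 4 * n <= c ^+ 2 * e ^+ 2 * n.
    rewrite ler_wpM2r //; apply: ler_pM => //; first exact: (ltW c0').
    by rewrite ltW.
  clear; lra.
clearbody l rho r0; clear hr0 hrho f2.
have hE : `|dot l (u' z - u' x)| <= 3 * (2 * c * n * `|u' z - u' x|).
  by rewrite (le_trans (dot_norm _ _)) // ler_wpM2l // ler_wpM2r.
have hF : dot l (u' z - u' x) >= dot l l - 3 * (2 * c * n * (n * (L * n + 5 * c ^+ 2 * e ^+ 2))).
  move: rest ed; set y := r0 - _ + rho; clearbody y => rest ->.
  rewrite !dotDr dotZr lN mulr0 addr0.
  have h1 := dot_norm l y; have h2 := ler_pM (normr_ge0 _) (normr_ge0 _) hl rest.
  have h3 := le_trans h1 (ler_wpM2l (ler0n R 3) h2).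
  have := ler_norm (- dot l y); rewrite normrN.
  by clear -h3; lra.
have c60' : c ^+ 6 >= 1 by rewrite exprn_ege1.
case: (ltrgt0P n) => [n1|//|nz]; last first.
  by rewrite -/n nz mulr0.
- by rewrite ltNge n0.
have small1 : 5 * c ^+ 2 * e ^+ 2 * (60 * c ^+ 4) <= 1.
  have : c ^+ 6 * e ^+ 2 <= c ^+ 6 * e.
    by apply: ler_wpM2l; [exact: ltW|rewrite -[leRHS]expr1 ler_wiXn2l // ltW].
  have : 0 <= c ^+ 6 * e by rewrite mulr_ge0 // ltW.
  clear -he; lra.
set W := `|u' z - u' x| in hE *.
have hG : n ^+ 2 <= 3 * c ^+ 3 * (6 * c * n * W + 6 * c * n * (n * (L * n + 5 * c ^+ 2 * e ^+ 2))).
  apply: (le_trans hq); rewrite ler_wpM2l ?mulr_ge0 ?exprn_ge0 ?(ltW c0') //.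
  have := ler_norm (dot l (u' z - u' x)); clear -hE hF; lra.
have hI : n <= 18 * c ^+ 4 * W + 18 * c ^+ 4 * (n * (L * n + 5 * c ^+ 2 * e ^+ 2)).
  rewrite -(ler_pM2l n1); clear -hG; lra.
have hJ : n <= 45 * c ^+ 4 * W.
  have := ler_wpM2l n0 hn; have := ler_wpM2l n0 small1; clear -hI; lra.
have hK : n <= 1000 * c ^+ 6 * W.
  have W0 : 0 <= W by rewrite normr_ge0.
  have := ler_wpM2r W0 c46; have := mulr_ge0 (ltW c60) W0; clear -hJ; lra.
have hM : c0 * n <= W.
  have c610 : 0 < 1000 * c ^+ 6 by apply: mulr_gt0 => [|//]; rewrite ltr0n.
  rewrite -(ler_pM2l c610); have := ler_wpM2r n0 hc0; clear -hK; lra.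
apply: le_trans hM; rewrite -/n ler_wpM2r // gerBl.
by apply: mulr_ge0; [apply: mulr_ge0 (ler0n _ _) (ltW c60)|exact: ltW].
Qed.

(** Moving by [pi h] along the second axis takes the phase from 0 to [pi]: [cos] changes sign and
    [cos] of the double phase does not. So [q'] changes by about [- 2 e N], whose length is bounded
    below through [b >= 1 / c]. *)
Lemma corrugation_osc c e h L nu b u p q N X u' p' q'
    (H : corrugation c e h L nu b u p q N X u' p' q') : 1000 * c ^+ 6 * e <= 1 -> nu.2 = 1 ->
  exists z, 0 < `|z| /\ `|z| <= 4 * e ^+ 4 /\ e <= c ^+ 2 * `|q' z - q' 0|.
Proof.
have [c1 e0 e1 e4e cc] := corrugation_num H.
move=> he hnu; have h0 := co_h H; exists (0, pi * h).
have c0 : 0 < c by lra.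
have e40 : 0 < e ^+ 4 by rewrite exprn_gt0.
have ph0 : 0 < pi * h by rewrite mulr_gt0 // pi_gt0.
have p4 : pi <= 4 :> R by have := @pihalf_lt2 R; lra.
have nz : `|(0, pi * h) : P| = pi * h.
  by rewrite prod_normE /= normr0 gtr0_norm // max_r // ltW.
have hL : L * h <= e ^+ 4.
  rewrite -(co_hL H) -mulrA ler_peMl // mulr_ge0 // ?(ltW h0) //.
  by have := co_L H; lra.
have hh : h <= e ^+ 4 by apply: le_trans hL; rewrite ler_peMl ?(ltW h0) ?(co_L H).
have nz4 : pi * h <= 4 * e ^+ 4 by apply: ler_pM; rewrite ?pi_ge0 ?(ltW h0).
rewrite nz; split=> //; split=> //.
set z := (0, pi * h) : P.
have z0 : `|z - 0| = pi * h by rewrite subr0.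
have Lz k : 0 <= k -> k * L * (pi * h) <= 4 * (k * e ^+ 4).
  move=> k0; have -> : k * L * (pi * h) = pi * (k * (L * h)) by ring.
  apply: ler_pM; rewrite ?pi_ge0 ?ler_wpM2l // !mulr_ge0 // ?(ltW h0) //.
  by have := co_L H; lra.
have [lN lX lq] := co_lip H.
have N4 : `|N z - N 0| <= 4 * (c * e ^+ 4).
  by apply: (le_trans (lN _ _)); rewrite z0 Lz // ltW.
have X4 : `|X z - X 0| <= 4 * (c * e ^+ 4).
  by apply: (le_trans (lX _ _)); rewrite z0 Lz // ltW.
have q4 : `|q z - q 0| <= 4 * e ^+ 4.
  by have := Lz 1 ler01; rewrite !mul1r => h1; apply: le_trans h1; rewrite -z0.
have [_] := co_grad H z; have [_] := co_grad H 0.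
have -> : phase nu 0 / h = 0 by rewrite /phase /=; ring.
have -> : phase nu z / h = pi by rewrite /phase /= hnu; field; rewrite gt_eqF.
rewrite hnu !scale1r /profile mulr0 cos0 cospi mulr1.
have -> : cos (2 * pi) = 1 :> R by rewrite cos_double cospi; ring.
set r1 := (X in `|X| <= _) => hr1; set r2 := (X in `|X| <= _) => hr2.
have ed : (2 * e) *: N 0 = - (q' z - q' 0) + (q z - q 0) + (r2 - r1)
   - (e *: (N z - N 0)) - (2 * e ^+ 2) *: (X z - X 0).
  by rewrite /r1 /r2; apply: row3P; rewrite !mxE; ring.
have [_ _ oN _] := co_ortho H 0; have /andP[hb _] := co_b H 0.
have [bN _] := co_NX H.
have N0 : 2 <= 3 * c ^+ 2 * `|N 0|.
  have h1 := dot_norm (N 0) (N 0); have h2 := ler_norm (dot (N 0) (N 0)).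
  have h3 := ler_wpM2r (normr_ge0 (N 0)) (bN 0).
  have h4 : 2 * c^-1 <= 3 * (c * `|N 0|) by clear -h1 h2 h3 hb oN; lra.
  have := ler_wpM2l (ltW c0) h4; rewrite mulrCA divff ?gt_eqF // mulr1; clear; lra.
have up : 2 * e * `|N 0| <= `|q' z - q' 0| + 4 * e ^+ 4 + (c * e ^+ 4 + c * e ^+ 4)
   + e * (4 * (c * e ^+ 4)) + 2 * e ^+ 2 * (4 * (c * e ^+ 4)).
  have e2 : 0 <= 2 * e by rewrite mulr_ge0 // ltW.
  have e3 : 0 <= 2 * e ^+ 2 by rewrite mulr_ge0 // sqr_ge0.
  rewrite -{1}(ger0_norm e2) -normrZ ed.
  rewrite (le_trans (ler_normB _ _)) // lerD //; last by rewrite normrZ (ger0_norm e3) ler_wpM2l.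
  rewrite (le_trans (ler_normB _ _)) // lerD //; last first.
    by rewrite normrZ (gtr0_norm e0) ler_wpM2l // ltW.
  rewrite (le_trans (ler_normD _ _)) // lerD //; last first.
    by rewrite (le_trans (ler_normB _ _)) // lerD.
  by rewrite (le_trans (ler_normD _ _)) // normrN lerD.
have sm : 54 * (c ^+ 3 * e ^+ 4) <= e.
  have : c ^+ 3 * e ^+ 4 <= c ^+ 6 * (e * e).
    have -> : e ^+ 4 = e * e * e ^+ 2 by ring.
    apply: ler_pM; rewrite ?exprn_ge0 ?(ltW c0) ?ler_weXn2l //.
      by rewrite !mulr_ge0 ?sqr_ge0 // ltW.
    by rewrite ler_piMr ?mulr_ge0 ?(ltW e0) // exprn_ile1 // ltW.
  have : 0 <= c ^+ 6 * (e * e) by rewrite !mulr_ge0 ?exprn_ge0 // ltW.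
  have := ler_wpM2r (ltW e0) he; clear; lra.
have ce4 : 0 <= c * e ^+ 4 by rewrite mulr_ge0 // ltW.
have s1 : e * (4 * (c * e ^+ 4)) <= 4 * (c * e ^+ 4) by rewrite ler_piMl // mulr_ge0.
have s2 : 2 * e ^+ 2 * (4 * (c * e ^+ 4)) <= 8 * (c * e ^+ 4).
  have : e ^+ 2 * (c * e ^+ 4) <= c * e ^+ 4.
    by rewrite ler_piMl // exprn_ile1 // ltW.
  by clear; lra.
have s3 : e ^+ 4 <= c * e ^+ 4 by rewrite ler_peMl // ltW.
have {s1 s2 s3}up : 2 * e * `|N 0| <= `|q' z - q' 0| + 18 * (c * e ^+ 4).
  by clear -up s1 s2 s3; lra.
have := ler_wpM2l (sqr_ge0 c) up; have := ler_wpM2l (ltW e0) N0.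
clear -sm e0; lra.
Qed.

End Step.

(** * Composition of deformations, and one step with a single constant *)

Section Stage.
Variable R : realType.
Local Notation P := (R * R)%type.
Local Notation V := 'rV[R]_3.
Local Notation sqform := (sqform R).

Definition regular (K : R) (u p q : P -> V) := [/\ tay K u p q, lip K p & lip K q].

Lemma regular_le K K' u p q : K <= K' -> regular K u p q -> regular K' u p q.
Proof.
by move=> h [h1 h2 h3]; split; [apply: tay_le h1|apply: lip_le h2|apply: lip_le h3].
Qed.

(* [E] is the metric increment, and [C] the constant of the construction *)
Record deformation (C e : R) (E : P -> sqform) (u p q u' p' q' : P -> V) : Prop := Deformation {
  def_met : forall x, `|met p' q' x - met p q x - E x| <= C * e ^+ 4;
  def_grad : forall x, `|p' x - p x| <= C * e /\ `|q' x - q x| <= C * e;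
  def_lip : lip (C * e) (fun x => u' x - u x);
  def_bnd : forall x, `|u' x - u x| <= C * e ^+ 4;
  def_bil : forall c0, C * c0 <= 1 -> bil c0 u -> bil (c0 - C * e ^+ 4) u' }.

Lemma deformation_comp C e E E' u p q u' p' q' v pv qv : 0 <= C -> 0 <= e ->
  deformation C e E u p q u' p' q' -> deformation C e E' u' p' q' v pv qv ->
  deformation (2 * C) e (fun x => E x + E' x) u p q v pv qv.
Proof.
move=> C0 e0 h h'; have Ce : 0 <= C * e ^+ 4 by rewrite mulr_ge0 // exprn_ge0.
split.
- move=> x.
  have -> : met pv qv x - met p q x - (E x + E' x) =
    (met p' q' x - met p q x - E x) + (met pv qv x - met p' q' x - E' x).
    by rewrite opprD [RHS]addrACA [X in _ = X + _]addrC [X in _ = X + _]addrA subrK.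
  rewrite (le_trans (ler_normD _ _)) // (le_trans (lerD (def_met h x) (def_met h' x))) //.
  by clear; lra.
- move=> x; have [a1 a2] := def_grad h x; have [b1 b2] := def_grad h' x.
  have fin (w w' w2 : V) : `|w' - w| <= C * e -> `|w2 - w'| <= C * e -> `|w2 - w| <= 2 * C * e.
    move=> k1 k2; have -> : w2 - w = (w2 - w') + (w' - w) by rewrite addrA subrK.
    by rewrite (le_trans (ler_normD _ _)) // (le_trans (lerD k2 k1)) //; clear; lra.
  by split; [exact: fin a1 b1|exact: fin a2 b2].
- have ee y : u' y - u y + (v y - u' y) = v y - u y by rewrite addrC addrA subrK.
  apply: (@lip_le _ _ (C * e + C * e)); first by clear; lra.
  by move=> x z; have := lipD (def_lip h) (def_lip h') x z; rewrite !ee.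
- move=> x; have -> : v x - u x = (v x - u' x) + (u' x - u x) by rewrite addrA subrK.
  rewrite (le_trans (ler_normD _ _)) // (le_trans (lerD (def_bnd h' x) (def_bnd h x))) //.
  by clear; lra.
move=> c0 hc hb.
(* A negative constant makes the lower bound trivial; with it excluded, [2 * C * c0 <= 1] yields
   [C * c0 <= 1] for the first deformation. *)
have [c00|c00] := leP 0 c0; last first.
  move=> x z; rewrite (le_trans _ (normr_ge0 _)) // mulr_le0_ge0 //; clear -c00 Ce; lra.
have h1 : C * c0 <= 1 by clear -hc c00 C0; nra.
have := def_bil h' _ (def_bil h h1 hb).
have -> : c0 - 2 * C * e ^+ 4 = c0 - C * e ^+ 4 - C * e ^+ 4 by ring.
by apply; have := mulr_ge0 C0 Ce; clear -h1; lra.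
Qed.

Lemma deformation_le C C' e E u p q u' p' q' : 0 <= C -> 0 <= e -> C <= C' ->
  deformation C e E u p q u' p' q' -> deformation C' e E u p q u' p' q'.
Proof.
move=> C0 e0 CC h; have e4 : C * e ^+ 4 <= C' * e ^+ 4 by rewrite ler_wpM2r // exprn_ge0.
have e1 : C * e <= C' * e by rewrite ler_wpM2r.
split.
- by move=> x; rewrite (le_trans (def_met h x)).
- by move=> x; have [a b] := def_grad h x; split; [exact: le_trans a e1|exact: le_trans b e1].
- exact: lip_le (def_lip h).
- by move=> x; rewrite (le_trans (def_bnd h x)).
move=> c0 hc hb.
have [c00|c00] := leP 0 c0; last first.
  move=> x z; rewrite (le_trans _ (normr_ge0 _)) // mulr_le0_ge0 //.
  have : 0 <= C * e ^+ 4 by rewrite mulr_ge0 // exprn_ge0.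
  by clear -c00 e4; lra.
apply: (bil_le _ (def_bil h _ hb)); first by rewrite lerD2l lerN2.
by apply: le_trans hc; rewrite ler_wpM2r.
Qed.

Lemma deformation_ext C e E E' u p q u' p' q' : E =1 E' ->
  deformation C e E u p q u' p' q' -> deformation C e E' u p q u' p' q'.
Proof. by move=> h [h1 h2 h3 h4 h5]; split=> // x; rewrite -h. Qed.

Lemma nondeg_le (Lam Lam' : R) (p q : P -> V) : 0 < Lam -> Lam <= Lam' -> nondeg Lam p q -> nondeg Lam' p q.
Proof.
move=> L0 h [h1 h2 h3]; split; [exact: bnd_le h1|exact: bnd_le h2|move=> x].
by rewrite (le_trans _ (h3 x)) // lef_pV2 ?posrE // (lt_le_trans L0).
Qed.

(** A frame changed by one small corrugation is still nondegenerate at the cost of doubling [Lam],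
    so several steps can share their constants. *)
Lemma nondeg_perturb (Lam : R) : 1 <= Lam -> exists2 C, 1 <= C & forall (d : R) (p q p' q' : P -> V),
  0 <= d -> C * d <= 1 -> nondeg Lam p q ->
  (forall x, `|p' x - p x| <= d /\ `|q' x - q x| <= d) -> nondeg (2 * Lam) p' q'.
Proof.
move=> L1; have L0 : 0 < Lam by lra.
exists (1000 * Lam ^+ 4); first by have := exprn_ege1 4 L1; lra.
move=> d p q p' q' d0 hd [bp bq hD] hpq.
have p1 : 1 <= Lam ^+ 3 by rewrite exprn_ege1.
have d1 : Lam * d <= Lam ^+ 4 * d by rewrite ler_wpM2r // -[leLHS]expr1 ler_weXn2l.
have d3 : d <= Lam ^+ 4 * d by rewrite ler_peMl // exprn_ege1.
have dL : d <= Lam by clear -hd d1 d3 L1; lra.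
have bp' x : `|p' x| <= 2 * Lam.
  have [h _] := hpq x; have -> : p' x = p x + (p' x - p x) by rewrite addrC subrK.
  by rewrite (le_trans (ler_normD _ _)) // (le_trans (lerD (bp x) h)) //; clear -dL; lra.
have bq' x : `|q' x| <= 2 * Lam.
  have [_ h] := hpq x; have -> : q' x = q x + (q' x - q x) by rewrite addrC subrK.
  by rewrite (le_trans (ler_normD _ _)) // (le_trans (lerD (bq x) h)) //; clear -dL; lra.
split=> // x; have [h1 h2] := hpq x.
set m := cross (p x) (q x); set m' := cross (p' x) (q' x).
have mm : `|m' - m| <= 6 * Lam * d.
  have -> : m' - m = cross (p' x - p x) (q' x) + cross (p x) (q' x - q x).
    by rewrite crossBl crossBr addrA subrK.
  rewrite (le_trans (ler_normD _ _)) // (le_trans (lerD (cross_norm _ _) (cross_norm _ _))) //.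
  have k1 := ler_pM (normr_ge0 _) (normr_ge0 _) h1 (bq' x).
  have k2 := ler_pM (normr_ge0 _) (normr_ge0 _) (bp x) h2.
  have two : (0 : R) <= 2 by [].
  apply: (le_trans (lerD (ler_wpM2l two k1) (ler_wpM2l two k2))).
  by clear; lra.
have bm : `|m| <= 2 * (Lam * Lam).
  by rewrite (le_trans (cross_norm _ _)) // ler_wpM2l // ler_pM.
have bm' : `|m'| <= 2 * (2 * Lam * (2 * Lam)).
  by rewrite (le_trans (cross_norm _ _)) // ler_wpM2l // ler_pM.
have dd : `|dot m' m' - dot m m| <= 3 * (6 * Lam * d * (10 * (Lam * Lam))).
  have -> : dot m' m' - dot m m = dot (m' - m) (m' + m).
    by rewrite dotDl !dotDr !dotNl (dotC m m'); ring.
  rewrite (le_trans (dot_norm _ _)) // ler_wpM2l // ler_pM //.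
  by rewrite (le_trans (ler_normD _ _)) // (le_trans (lerD bm' bm)) //; clear; lra.
have hm := hD x; rewrite -/m in hm.
have : 2 * (2 * Lam)^-1 = Lam^-1 by field; rewrite gt_eqF.
have : 360 * (Lam * (Lam * Lam) * d) <= Lam^-1.
  rewrite -(ler_pM2l L0) (divff (lt0r_neq0 L0)).
  have : 0 <= Lam ^+ 4 * d by rewrite mulr_ge0 // exprn_ge0 // ltW.
  by clear -hd; lra.
have := ler_norm (- (dot m' m' - dot m m)); rewrite normrN.
by clear -dd hm; lra.
Qed.

Lemma convex_step (Lam : R) : 1 <= Lam -> exists2 C, 1 <= C &
  forall e L nu b u p q, 0 < e -> C * e <= 1 -> 1 <= L -> `|nu| <= Lam ->
    (forall x, Lam^-1 <= b x <= Lam) -> lip L b -> nondeg Lam p q -> regular L u p q ->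
  exists u' p' q', [/\ regular (C * L / e ^+ 4) u' p' q',
    deformation C e (fun x => (e ^+ 2 * b x) *: rank1 nu) u p q u' p' q' &
    nu.2 = 1 -> exists z, [/\ 0 < `|z|, `|z| <= C * e ^+ 4 & e <= C * `|q' z - q' 0|]].
Proof.
move=> L1; have [c [c' [c1 c1' H]]] := corrugation_exists L1.
have c6 : 1 <= c ^+ 6 by rewrite exprn_ege1.
(* The constant of [corrugation_bil] dominates those of the other estimates; [c'] accounts for the
   regularity. *)
pose C := 1000 * c ^+ 6 + c'.
have C1 : 1 <= C by rewrite /C; lra.
have Cc : 1000 * c ^+ 6 <= C by rewrite /C; lra.
have Cc' : c' <= C by rewrite /C; lra.
have pw k : (k <= 6)%N -> c ^+ k <= c ^+ 6 by move=> h; rewrite ler_weXn2l.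
clearbody C; exists C => // e L nu b u p q e0 Ce hL hnu hb lb nd [tu lp lq].
have e1 : e <= 1 by have := ler_wpM2r (ltW e0) C1; clear -Ce; lra.
have he : 0 < e <= 1 by rewrite e0.
have [h [N [X [u' [p' [q' [co [t1 t2 t3]]]]]]]] := H e L nu b u p q he hL hnu hb lb nd lp lq tu.
have ce : 1000 * c ^+ 6 * e <= 1 by apply: le_trans Ce; rewrite ler_wpM2r // ltW.
have e40 : 0 <= e ^+ 4 by rewrite exprn_ge0 // ltW.
have L0 : 0 <= L by clear -hL; lra.
have c60 : 0 <= c ^+ 6 by clear -c6; lra.
exists u', p', q'; split.
- apply: (@regular_le (c' * L / e ^+ 4)) => //.
  by rewrite ler_wpM2r ?invr_ge0 // ler_wpM2r.
- apply: (@deformation_le (1000 * c ^+ 6));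
    [exact: mulr_ge0 (ler0n _ _) c60|exact: ltW|exact: Cc|split].
  + move=> x; apply: (le_trans (corrugation_metric co x)); rewrite ler_wpM2r //.
    by have := pw 4%N isT; clear -c60; lra.
  + have h4 : 4 * c ^+ 2 * e <= 1000 * c ^+ 6 * e.
      by rewrite ler_wpM2r ?(ltW e0) //; have := pw 2%N isT; clear -c60; lra.
    move=> x; have [a1 a2] := corrugation_gradient co x.
    by split; [exact: le_trans a1 h4|exact: le_trans a2 h4].
  + apply: lip_le (corrugation_lip co).
    by rewrite ler_wpM2r ?(ltW e0) //; have := pw 2%N isT; clear -c60; lra.
  + move=> x; apply: (le_trans (corrugation_bnd co x)).
    by rewrite ler_peMl //; clear -c6; lra.
  + by move=> c0 hc hbu; exact: (corrugation_bil co ce hc hbu).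
move=> hn; have [z [z0 [z4 oz]]] := corrugation_osc co ce hn.
exists z; split=> //.
  by apply: (le_trans z4); rewrite ler_wpM2r //; clear -Cc c6; lra.
apply: (le_trans oz); rewrite ler_wpM2r //.
by have := pw 2%N isT; clear -Cc c60; lra.
Qed.

End Stage.

(** * A stage: three corrugations for one symmetric form *)

Section ThreeSteps.
Variable R : realType.
Local Notation P := (R * R)%type.
Local Notation V := 'rV[R]_3.
Local Notation sqform := (sqform R).

(** [dec_n3] normalises the last direction so that the oscillation produced by the last corrugation
    can be read off [q]. *)
Record decomposition (Lam : R) (n1 n2 n3 : P) (B1 B2 B3 : sqform -> R) : Prop :=
  Decomposition {
  dec_le : [/\ `|n1| <= Lam, `|n2| <= Lam & `|n3| <= Lam];
  dec_n3 : n3.2 = 1;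
  dec_sum : forall a, B1 a *: rank1 n1 + B2 a *: rank1 n2 + B3 a *: rank1 n3 = a;
  dec_lip : forall a a', [/\ `|B1 a - B1 a'| <= Lam * `|a - a'|,
     `|B2 a - B2 a'| <= Lam * `|a - a'| & `|B3 a - B3 a'| <= Lam * `|a - a'|] }.

(** The frames before the three steps are controlled by [Lam], [2 Lam] and [4 Lam], so the single
    step is used with [4 Lam]. Each step divides by [e^4] in the regularity, hence [e^12]. The
    oscillation reported is that of the last step, which no later step of the stage can cancel. *)
Lemma stage (Lam : R) n1 n2 n3 B1 B2 B3 : 1 <= Lam -> decomposition Lam n1 n2 n3 B1 B2 B3 ->
  exists2 C, 1 <= C & forall e L (h : P -> sqform) u p q, 0 < e -> C * e <= 1 -> 1 <= L ->
    (forall x, [/\ Lam^-1 <= B1 (h x) <= Lam, Lam^-1 <= B2 (h x) <= Lam &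
        Lam^-1 <= B3 (h x) <= Lam]) ->
    lip L h -> nondeg Lam p q -> regular L u p q ->
  exists u' p' q', [/\ regular (C * L / e ^+ 12) u' p' q',
    deformation C e (fun x => e ^+ 2 *: h x) u p q u' p' q' &
    exists z, [/\ 0 < `|z|, `|z| <= C * e ^+ 4 & e <= C * `|q' z - q' 0|]].
Proof.
move=> L1 [[hn1 hn2 hn3] hn Bsum Blip].
have L0 : 0 < Lam by lra.
have L2 : 1 <= 2 * Lam by lra.
have L4 : 1 <= 2 * (2 * Lam) by lra.
have [C1 C11 pert1] := nondeg_perturb L1; have [C2 C21 pert2] := nondeg_perturb L2.
have [C C0 H] := convex_step L4.
pose D := 4 * C + C1 * C + C2 * C + C ^+ 3 * Lam.
have CC1 : 0 <= C1 * C by apply: mulr_ge0; lra.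
have CC2 : 0 <= C2 * C by apply: mulr_ge0; lra.
have CC3 : 0 <= C ^+ 3 * Lam by apply: mulr_ge0; [apply: exprn_ge0|]; lra.
have D1 : 1 <= D by rewrite /D; lra.
have DC : 4 * C <= D by rewrite /D; lra.
have DC1 : C1 * C <= D by rewrite /D; lra.
have DC2 : C2 * C <= D by rewrite /D; lra.
have DC3 : C ^+ 3 * Lam <= D by rewrite /D; lra.
clearbody D; exists D => // e L h u p q e0 De hL hB lh nd ru.
have e0' := ltW e0.
have e40 : 0 < e ^+ 4 by rewrite exprn_gt0.
have L0' : 0 < L by lra.
have Ce : C * e <= 1 by have := ler_wpM2r e0' DC; have := mulr_ge0 (le_trans ler01 C0) e0'; lra.
have e1 : e <= 1 by have := ler_wpM2r e0' C0; clear -Ce; lra.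
have e41 : e ^+ 4 <= 1 by rewrite exprn_ile1.
have C1e : C1 * (C * e) <= 1 by rewrite mulrA (le_trans (ler_wpM2r e0' DC1)).
have C2e : C2 * (C * e) <= 1 by rewrite mulrA (le_trans (ler_wpM2r e0' DC2)).
have Ce0 : 0 <= C * e by rewrite mulr_ge0 // (le_trans ler01 C0).
have grow K : 0 < K -> K <= C * K / e ^+ 4.
  move=> K0; rewrite ler_pdivlMr // mulrC ler_pM ?(ltW e40) ?(ltW K0) //.
  exact: le_trans e41 C0.
pose L1' := Lam * L; have LL : L <= L1' by rewrite ler_peMl // ltW.
have L1'1 : 1 <= L1' by apply: le_trans hL LL.
pose K1 := C * L1' / e ^+ 4; have LK1 : L1' <= K1 by apply: grow; apply: lt_le_trans L1'1.
have K11 : 1 <= K1 by apply: le_trans L1'1 LK1.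
pose K2 := C * K1 / e ^+ 4; have LK2 : K1 <= K2 by apply: grow; apply: lt_le_trans K11.
have K21 : 1 <= K2 by apply: le_trans K11 LK2.
have Li : (2 * (2 * Lam))^-1 <= Lam^-1 by rewrite lef_pV2 ?posrE //; clear -L0; lra.
have itv b : Lam^-1 <= b <= Lam -> (2 * (2 * Lam))^-1 <= b <= 2 * (2 * Lam).
  by clear -Li L0; lra.
have lB : [/\ lip L1' (fun x => B1 (h x)), lip L1' (fun x => B2 (h x)) &
    lip L1' (fun x => B3 (h x))].
  by split=> x z; have [b1 b2 b3] := Blip (h z) (h x);
    [apply: (le_trans b1)|apply: (le_trans b2)|apply: (le_trans b3)];
    rewrite /L1' -mulrA ler_wpM2l ?(ltW L0).
have [lB1 lB2 lB3] := lB.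
have L24 : 2 * Lam <= 2 * (2 * Lam) by clear -L0; lra.
have LL4 : Lam <= 2 * (2 * Lam) by clear -L0; lra.
have [|u1 [p1 [q1 [r1 d1 _]]]] := H e L1' n1 (fun x => B1 (h x)) u p q e0 Ce L1'1
  (le_trans hn1 LL4) _ lB1 (nondeg_le L0 LL4 nd) (regular_le LL ru).
  by move=> x; have [b _ _] := hB x; exact: itv.
have nd1 := pert1 _ _ _ _ _ Ce0 C1e nd (def_grad d1).
have L20 : 0 < 2 * Lam by rewrite mulr_gt0.
have [|u2 [p2 [q2 [r2 d2 _]]]] := H e K1 n2 (fun x => B2 (h x)) u1 p1 q1 e0 Ce K11
  (le_trans hn2 LL4) _ (lip_le LK1 lB2) (nondeg_le L20 L24 nd1) r1.
  by move=> x; have [_ b _] := hB x; exact: itv.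
have nd2 := pert2 _ _ _ _ _ Ce0 C2e nd1 (def_grad d2).
have [|u3 [p3 [q3 [r3 d3 o3]]]] := H e K2 n3 (fun x => B3 (h x)) u2 p2 q2 e0 Ce K21
  (le_trans hn3 LL4) _ (lip_le (le_trans LK1 LK2) lB3) nd2 r2.
  by move=> x; have [_ _ b] := hB x; exact: itv.
have C00 : 0 <= C by exact: le_trans ler01 C0.
have C20 : 0 <= 2 * C by rewrite mulr_ge0.
have C2C : C <= 2 * C by clear -C00; lra.
have d12 := deformation_comp C00 e0' d1 d2.
have d123 := deformation_comp C20 e0' d12 (deformation_le C00 e0' C2C d3).
exists u3, p3, q3; split.
- apply: regular_le r3.
  have -> : C * K2 / e ^+ 4 = C ^+ 3 * Lam * L / e ^+ 12.
    by rewrite /K2 /K1 /L1'; field; rewrite gt_eqF.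
  by rewrite ler_wpM2r ?invr_ge0 ?exprn_ge0 // ler_wpM2r // ltW.
- apply: (@deformation_ext _ D) (deformation_le _ e0' _ d123) => [x||].
  + by rewrite -[in RHS](Bsum (h x)) !scalerDr !scalerA.
  + by rewrite mulr_ge0.
  + by move: DC; rewrite mulrA -natrM.
have [z [z0 z4 oz]] := o3 hn.
have DC' : C <= D by clear -DC C00; lra.
exists z; split=> //; first by apply: (le_trans z4); rewrite ler_wpM2r // ltW.
by apply: (le_trans oz); rewrite ler_wpM2r.
Qed.

End ThreeSteps.

(** * Positive decompositions and the tolerance around a pair of forms *)

Section Geometry.
Variable R : realType.
Local Notation P := (R * R)%type.
Local Notation V := 'rV[R]_3.
Local Notation sqform := (sqform R).

Definition disc (a : sqform) : R := a.1.1 * a.2 - a.1.2 ^+ 2.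

Definition posdef (a : sqform) := 0 < a.1.1 /\ 0 < disc a.

Lemma sqform_coord (a : sqform) : [/\ `|a.1.1| <= `|a|, `|a.1.2| <= `|a| & `|a.2| <= `|a|].
Proof. by rewrite !prod_normE !le_max !lexx !orbT. Qed.

Lemma decomposition_le (Lam Lam' : R) (n1 n2 n3 : P) (B1 B2 B3 : sqform -> R) : Lam <= Lam' ->
  decomposition Lam n1 n2 n3 B1 B2 B3 -> decomposition Lam' n1 n2 n3 B1 B2 B3.
Proof.
move=> h [[h1 h2 h3] hn hs hl]; split=> //; first by split; apply: le_trans h.
move=> a a'; have [l1 l2 l3] := hl a a'.
by split; [apply: (le_trans l1)|apply: (le_trans l2)|apply: (le_trans l3)]; rewrite ler_wpM2r.
Qed.

(** Completing the square writes [H] as [a] times the square of the covector [(1, t)] plus [a kappa]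
    times that of [(0, 1)]. The mean of the squares of [(1, t + k)] and [(1, t - k)] is the square
    of [(1, t)] plus [k^2] times that of [(0, 1)], so all three coefficients are positive at [H] as
    soon as [k^2 < kappa]. *)
Lemma posdef_decomposition (H : sqform) : posdef H ->
  exists (Lam : R) (n1 n2 n3 : P) (B1 B2 B3 : sqform -> R),
  [/\ 1 <= Lam, decomposition Lam n1 n2 n3 B1 B2 B3 & [/\ 0 < B1 H, 0 < B2 H & 0 < B3 H]].
Proof.
case: H => [[a b] d]; rewrite /posdef /disc /= => -[a0 hD].
have an : a != 0 by rewrite gt_eqF.
pose t := b / a; pose kappa := (d - b ^+ 2 / a) / a.
have k0 : 0 < kappa.
  rewrite divr_gt0 // subr_gt0 ltr_pdivrMr //; lra.
(* A positive number with [k^2 < kappa], found without a square root. *)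
pose k := kappa / (1 + kappa).
have kk : 0 < 1 + kappa by lra.
have kp : 0 < k by rewrite divr_gt0.
have kn : k != 0 by rewrite gt_eqF.
have k2 : k ^+ 2 < kappa.
  rewrite /k expr_div_n ltr_pdivrMr ?exprn_gt0 //.
  have : 0 < kappa * (1 + kappa + kappa ^+ 2) by rewrite mulr_gt0 // !addr_gt0 // exprn_gt0.
  lra.
pose B1 (f : sqform) := (f.1.1 + (f.1.2 - t * f.1.1) / k) / 2.
pose B2 (f : sqform) := (f.1.1 - (f.1.2 - t * f.1.1) / k) / 2.
pose B3 (f : sqform) := f.2 - B1 f * (t + k) ^+ 2 - B2 f * (t - k) ^+ 2.
pose c1 := 1 + (1 + `|t|) / k.
have c10 : 0 <= (1 + `|t|) / k by rewrite divr_ge0 ?addr_ge0 // ltW.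
have bnd1 (f : sqform) : `|f.1.1| <= `|f| -> `|f.1.2| <= `|f| -> `|(f.1.2 - t * f.1.1) / k| <= (1 + `|t|) / k * `|f|.
  move=> h1 h2; rewrite normrM normfV (gtr0_norm kp) [leRHS]mulrAC ler_wpM2r ?invr_ge0 ?(ltW kp) //.
  rewrite (le_trans (ler_normB _ _)) // mulrDl mul1r lerD // normrM ler_wpM2l //.
have bB1 (f : sqform) : `|B1 f| <= c1 * `|f|.
  have [h1 h2 _] := sqform_coord f; have := bnd1 f h1 h2; set y := (_ - _) / k => h.
  rewrite /B1 normrM (ger0_norm (_ : 0 <= 2^-1)) ?invr_ge0 // -/y.
  have := le_trans (ler_normD f.1.1 y) (lerD h1 h); have := normr_ge0 (f.1.1 + y).
  rewrite /c1; clear; lra.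
have bB2 (f : sqform) : `|B2 f| <= c1 * `|f|.
  have [h1 h2 _] := sqform_coord f; have := bnd1 f h1 h2; set y := (_ - _) / k => h.
  rewrite /B2 normrM (ger0_norm (_ : 0 <= 2^-1)) ?invr_ge0 // -/y.
  have := le_trans (ler_normB f.1.1 y) (lerD h1 h); have := normr_ge0 (f.1.1 - y).
  rewrite /c1; clear; lra.
pose c3 := 1 + c1 * (t + k) ^+ 2 + c1 * (t - k) ^+ 2.
have bB3 (f : sqform) : `|B3 f| <= c3 * `|f|.
  have [_ _ h3] := sqform_coord f.
  have m1 := ler_wpM2r (sqr_ge0 (t + k)) (bB1 f).
  have m2 := ler_wpM2r (sqr_ge0 (t - k)) (bB2 f).
  rewrite /B3 (le_trans (ler_normB _ _)) // (le_trans (lerD (ler_normB _ _) (lexx _))) //.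
  rewrite (normrM (B1 f)) (normrM (B2 f)) (ger0_norm (sqr_ge0 (t + k))) (ger0_norm (sqr_ge0 (t - k))).
  by apply: (le_trans (lerD (lerD h3 m1) m2)); rewrite /c3; clear; lra.
have c1p : 1 <= c1 by rewrite /c1; lra.
have c3p : 1 <= c3.
  have := mulr_ge0 (le_trans ler01 c1p) (sqr_ge0 (t + k)).
  have := mulr_ge0 (le_trans ler01 c1p) (sqr_ge0 (t - k)); rewrite /c3; clear; lra.
pose Lam := c1 + c3 + (1 + `|t| + k).
exists Lam, (1, t + k), (1, t - k), (0, 1), B1, B2, B3.
have t0 : 0 <= `|t| by [].
have Lc1 : c1 <= Lam by rewrite /Lam; lra.
have Lc3 : c3 <= Lam by rewrite /Lam; lra.
have Lt : 1 + `|t| + k <= Lam by rewrite /Lam; lra.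
split; first by rewrite /Lam; lra.
- split.
  + have kL : `|t| + k <= Lam by clear -Lt; lra.
    have tk : `|t + k| <= Lam by rewrite (le_trans (ler_normD _ _)) // (gtr0_norm kp).
    have tk' : `|t - k| <= Lam by rewrite (le_trans (ler_normB _ _)) // (gtr0_norm kp).
    have Lam1 : 1 <= Lam by clear -Lt t0 kp; lra.
    by split; apply: pair_norm_le => //=; rewrite ?normr1 ?normr0 ?(le_trans ler01).
  + by [].
  + case=> -[x y] w; pose f : sqform := (x, y, w).
    congr (_, _, _).
    * change (B1 f * (1 * 1) + B2 f * (1 * 1) + B3 f * (0 * 0) = x).
      by rewrite /B1 /B2 /=; field.
    * change (B1 f * (1 * (t + k)) + B2 f * (1 * (t - k)) + B3 f * (0 * 1) = y).
      by rewrite /B1 /B2 /=; field.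
    * change (B1 f * ((t + k) * (t + k)) + B2 f * ((t - k) * (t - k)) + B3 f * (1 * 1) = w).
      by rewrite /B3 /=; ring.
  + move=> f f'.
    have -> : B1 f - B1 f' = B1 (f - f') by rewrite /B1 /=; field.
    have -> : B2 f - B2 f' = B2 (f - f') by rewrite /B2 /=; field.
    have -> : B3 f - B3 f' = B3 (f - f') by rewrite /B3 /B1 /B2 /=; field.
    split; [apply: (le_trans (bB1 _))|apply: (le_trans (bB2 _))|apply: (le_trans (bB3 _))];
    by rewrite ler_wpM2r.
have tb : b - t * a = 0 by rewrite /t mulfVK // subrr.
have hB1 : B1 (a, b, d) = a / 2 by rewrite /B1 /= tb mul0r addr0.
have hB2 : B2 (a, b, d) = a / 2 by rewrite /B2 /= tb mul0r subr0.
rewrite /B3 hB1 hB2 /=; split; [lra|lra|].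
have -> : d - a / 2 * (t + k) ^+ 2 - a / 2 * (t - k) ^+ 2 = a * (kappa - k ^+ 2).
  by rewrite /t /kappa; field.
by rewrite mulr_gt0 // subr_gt0.
Qed.

(** The determinant of the sum has the mixed term [s (a d' + a' d - 2 b b')], nonnegative by the
    arithmetic-geometric inequality since [b^2 b'^2] is at most [a d a' d']. *)
Lemma disc_add (G H : sqform) (s : R) : posdef G -> posdef H -> 0 <= s ->
  disc G <= disc (G + s *: H).
Proof.
case: G H => [[a b] d] [[a' b'] d']; rewrite /posdef /disc /= => -[a0 D0] [a0' D0'] s0.
change (a * d - b ^+ 2 <= (a + s * a') * (d + s * d') - (b + s * b') ^+ 2).
have d0 : 0 < d by rewrite -(pmulr_rgt0 _ a0); have := sqr_ge0 b; lra.
have d0' : 0 < d' by rewrite -(pmulr_rgt0 _ a0'); have := sqr_ge0 b'; lra.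
have h1 : b ^+ 2 * b' ^+ 2 <= a * d * (a' * d').
  by apply: ler_pM; rewrite ?sqr_ge0 //; lra.
have m1 : 0 < a * d' by rewrite mulr_gt0.
have m2 : 0 < a' * d by rewrite mulr_gt0.
have h2 : `|2 * b * b'| <= a * d' + a' * d.
  rewrite -ler_sqr ?nnegrE //; last lra.
  rewrite real_normK ?num_real //; have := sqr_ge0 (a * d' - a' * d); clear -h1; lra.
have h3 : 0 <= s * (a * d' + a' * d - 2 * b * b').
  by rewrite mulr_ge0 // subr_ge0 (le_trans (ler_norm _)).
have h4 : 0 <= s ^+ 2 * (a' * d' - b' ^+ 2) by rewrite mulr_ge0 ?sqr_ge0 // ltW.
by clear -h3 h4; lra.
Qed.

Lemma disc_near (B r : R) (M N : sqform) : 0 <= r <= 1 -> `|M| <= B -> `|N - M| <= r ->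
  disc M - 4 * (B + 1) * r <= disc N.
Proof.
move=> /andP[r0 r1] hM hN.
have [m1 m2 m3] := sqform_coord M; have [d1 d2 d3] := sqform_coord (N - M).
have B0 : 0 <= B by apply: le_trans hM.
move: (le_trans m1 hM) (le_trans m2 hM) (le_trans m3 hM).
move: (le_trans d1 hN) (le_trans d2 hN) (le_trans d3 hN).
clear -r0 r1 hM hN B0; case: M N hM hN => [[a b] d] [[a' b'] d'] /=; rewrite /disc /= => _ _ h1 h2 h3 k1 k2 k3.
have -> : a' * d' - b' ^+ 2 = (a * d - b ^+ 2) +
   (a * (d' - d) + (a' - a) * d + (a' - a) * (d' - d) - 2 * (b * (b' - b)) - (b' - b) * (b' - b)).
  by ring.
have pm (x y X Y : R) : `|x| <= X -> `|y| <= Y -> - (X * Y) <= x * y /\ x * y <= X * Y.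
  move=> hx hy; have := ler_pM (normr_ge0 _) (normr_ge0 _) hx hy.
  by rewrite -normrM ler_norml => /andP.
have [p1 _] := pm _ _ _ _ k1 h3; have [p2 _] := pm _ _ _ _ h1 k3.
have [p3 _] := pm _ _ _ _ h1 h3; have [_ p4] := pm _ _ _ _ k2 h2.
have [_ p5] := pm _ _ _ _ h2 h2.
have : r * r <= r by rewrite ler_piMr.
lra.
Qed.

(** [sigma] meets two demands: near [H] the three coefficients keep half of their smallest value at
    [H], and metrics within [sigma] of the segment from [G] to [G + H] keep half of the discriminant
    of [G]. The latter bounds the Gram determinant of every intermediate map. *)
Lemma geometry (G H : sqform) : posdef G -> posdef H ->
  exists (Lam sigma : R) (n1 n2 n3 : P) (B1 B2 B3 : sqform -> R),
  [/\ 1 <= Lam, 0 < sigma <= 1, decomposition Lam n1 n2 n3 B1 B2 B3,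
      forall a, `|a - H| <= sigma -> [/\ Lam^-1 <= B1 a <= Lam, Lam^-1 <= B2 a <= Lam &
        Lam^-1 <= B3 a <= Lam] &
      forall p q : P -> V, (forall x, exists2 s, 0 <= s <= 1 &
        `|met p q x - (G + s *: H)| <= sigma) -> nondeg Lam p q].
Proof.
move=> pG pH; have [Lam1 [n1 [n2 [n3 [B1 [B2 [B3 [L1 dec [b1 b2 b3]]]]]]]]] :=
  posdef_decomposition pH.
have [_ D0] := pG.
pose B := `|G| + `|H|; have B0 : 0 <= B by rewrite addr_ge0.
pose beta := Num.min (B1 H) (Num.min (B2 H) (B3 H)).
have beta0 : 0 < beta by rewrite !lt_min b1 b2 b3.
pose M := B1 H + B2 H + B3 H + Lam1.
pose sigma := Num.min 1 (Num.min (beta / (2 * Lam1)) (disc G / (8 * (B + 1)))).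
have s0 : 0 < sigma.
  by rewrite !lt_min ltr01 /= !divr_gt0 ?mulr_gt0 //; lra.
have s1 : sigma <= 1 by rewrite ge_min lexx.
have s2 : Lam1 * sigma <= beta / 2.
  have : sigma <= beta / (2 * Lam1) by rewrite !ge_min lexx orbT.
  rewrite ler_pdivlMr; last by lra.
  by clear; lra.
have s3 : 4 * (B + 1) * sigma <= disc G / 2.
  have : sigma <= disc G / (8 * (B + 1)) by rewrite !ge_min lexx !orbT.
  rewrite ler_pdivlMr; last by lra.
  by clear; lra.
have i1 : 0 < 2 / beta by rewrite divr_gt0.
have i2 : 0 < 2 / disc G by rewrite divr_gt0.
pose Lam := Lam1 + M + 2 / beta + 2 / disc G + B + 1.
have LM : M <= Lam /\ Lam1 <= Lam by rewrite /Lam /M; split; lra.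
have Li1 : Lam^-1 <= beta / 2.
  rewrite -[leRHS]invrK lef_pV2 ?posrE ?invr_gt0 ?divr_gt0 //; last by rewrite /Lam /M; lra.
  by rewrite invf_div /Lam /M; lra.
have Li2 : Lam^-1 <= disc G / 2.
  rewrite -[leRHS]invrK lef_pV2 ?posrE ?invr_gt0 ?divr_gt0 //; last by rewrite /Lam /M; lra.
  by rewrite invf_div /Lam /M; lra.
have LB : B + 1 <= Lam by rewrite /Lam /M; lra.
have L1' : 1 <= Lam by rewrite /Lam /M; lra.
exists Lam, sigma, n1, n2, n3, B1, B2, B3; split=> //.
- by rewrite s0.
- by apply: decomposition_le dec; case: LM.
- move=> a ha; have [l1 l2 l3] := dec_lip dec a H.
  have ls : Lam1 * `|a - H| <= beta / 2 by apply: le_trans s2; rewrite ler_wpM2l //; lra.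
  have bb1 : beta <= B1 H by rewrite ge_min lexx.
  have bb2 : beta <= B2 H by rewrite !ge_min lexx orbT.
  have bb3 : beta <= B3 H by rewrite !ge_min lexx !orbT.
  move: (le_trans l1 ls) (le_trans l2 ls) (le_trans l3 ls); rewrite !ler_norml.
  case: LM; rewrite /M; clear -Li1 bb1 bb2 bb3 b1 b2 b3 L1 beta0 => k1 k2 k3 k4 k5.
  by split; lra.
move=> p q hpq.
have hx x : [/\ dot (p x) (p x) <= Lam, dot (q x) (q x) <= Lam &
    Lam^-1 <= dot (cross (p x) (q x)) (cross (p x) (q x))].
  have [s /andP[s00 s01] hs] := hpq x; set N := G + s *: H in hs.
  have bN : `|N| <= B.
    rewrite (le_trans (ler_normD _ _)) // lerD2l normrZ ger0_norm //.
    by rewrite ler_piMl.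
  have bm : `|met p q x| <= Lam.
    have -> : met p q x = N + (met p q x - N) by rewrite addrC subrK.
    by rewrite (le_trans (ler_normD _ _)) // (le_trans (lerD bN hs)) //; lra.
  have [c1 _ c3] := sqform_coord (met p q x).
  split; first exact: le_trans (ler_norm _) (le_trans c1 bm).
    exact: le_trans (ler_norm _) (le_trans c3 bm).
  have s01' : 0 <= sigma <= 1 by rewrite ltW.
  have k1 := disc_near s01' bN hs; have := disc_add pG pH s00; rewrite -/N => k2.
  rewrite dot_cross_cross -/(disc (met p q x)).
  by clear -s3 Li2 k1 k2; lra.
have sq (w : V) : dot w w <= Lam -> `|w| <= Lam.
  move=> h; rewrite -ler_sqr ?nnegrE //; last by lra.
  apply: (le_trans (norm_dot w)); apply: (le_trans h).
  by rewrite -[leLHS]expr1 ler_weXn2l.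
by split=> x; have [h1 h2 h3] := hx x => //; apply: sq.
Qed.

End Geometry.

(** * From a short map to a nearly isometric one, and the squaring round *)

Section Iteration.
Variable R : realType.
Local Notation P := (R * R)%type.
Local Notation V := 'rV[R]_3.
Local Notation sqform := (sqform R).

(** What the iteration needs from a pair [G], [H]; directions and coefficients are hidden from here
    on. *)
Record setting (Lam sigma C : R) (G H : sqform) : Prop := Setting {
  set_L : 1 <= Lam;
  set_s : 0 < sigma <= 1;
  set_C : 1 <= C;
  set_nd : forall p q : P -> V, (forall x, exists2 s, 0 <= s <= 1 &
    `|met p q x - (G + s *: H)| <= sigma) -> nondeg Lam p q;
  set_stage : forall e L (h : P -> sqform) u p q, 0 < e -> C * e <= 1 -> 1 <= L ->
    (forall x, `|h x - H| <= sigma) -> lip L h -> nondeg Lam p q -> regular L u p q ->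
    exists u' p' q', [/\ regular (C * L / e ^+ 12) u' p' q',
      deformation C e (fun x => e ^+ 2 *: h x) u p q u' p' q' &
      exists z, [/\ 0 < `|z|, `|z| <= C * e ^+ 4 & e <= C * `|q' z - q' 0|]] }.

Lemma setting_exists G H : posdef G -> posdef H -> exists Lam sigma C, setting Lam sigma C G H.
Proof.
move=> pG pH.
have [Lam [sigma [n1 [n2 [n3 [B1 [B2 [B3 [L1 s1 dec hB hnd]]]]]]]]] := geometry pG pH.
have [C C1 hC] := stage L1 dec.
exists Lam, sigma, C; split=> // e L h u p q e0 Ce L0 hh lh nd ru.
by apply: hC => // x; apply: hB.
Qed.

Lemma met_lip (B K : R) (p q : P -> V) : 0 <= K -> bnd B p -> bnd B q -> lip K p -> lip K q ->
  lip (6 * B * K) (met p q).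
Proof.
move=> K0 bp bq lp lq x z.
have fin (f g : P -> V) : bnd B f -> bnd B g -> lip K f -> lip K g ->
    `|dot (f z) (g z) - dot (f x) (g x)| <= 6 * B * K * `|z - x|.
  move=> bf bg lf lg.
  have -> : dot (f z) (g z) - dot (f x) (g x) = dot (f z - f x) (g z) + dot (f x) (g z - g x).
    by rewrite dotDl dotNl dotDr dotNr addrA subrK.
  have three : (0 : R) <= 3 by [].
  have k1 := le_trans (dot_norm _ _) (ler_wpM2l three
    (ler_pM (normr_ge0 _) (normr_ge0 _) (lf x z) (bg z))).
  have k2 := le_trans (dot_norm _ _) (ler_wpM2l three
    (ler_pM (normr_ge0 _) (normr_ge0 _) (bf x) (lg x z))).
  rewrite (le_trans (ler_normD _ _)) // (le_trans (lerD k1 k2)) //.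
  by clear; lra.
by apply: sqform_norm_le; apply: fin.
Qed.

Lemma sqformP (a b : sqform) : a.1.1 = b.1.1 -> a.1.2 = b.1.2 -> a.2 = b.2 -> a = b.
Proof. by case: a b => [[a1 a2] a3] [[b1 b2] b3] /= -> -> ->. Qed.

(** A stage works at small amplitude while the defect has order one. The defect is therefore added
    in [n^2] equal portions [e^2 h] with [e = 1 / n]; each leaves an error [C e^4], altogether
    [C e^2]. Aiming at [tau - e0^2 H] instead of [tau] leaves the positive definite defect from
    which [iterate] starts. *)
Lemma initial_loop Lam sigma C G H (S : setting Lam sigma C G H) K u p q (tau : P -> sqform) c
    e0 eps :
  1 <= K -> regular K u p q -> (forall x, `|met p q x - G| <= sigma / 8) ->
  (forall x, `|tau x - (G + H)| <= sigma / 8) -> lip K tau -> 0 < e0 ->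
  e0 ^+ 2 * `|H| <= sigma / 8 -> C * c <= 1 -> bil c u -> 0 < eps ->
  exists K' u' p' q', [/\ regular K' u' p' q',
    forall x, `|met p' q' x - (tau x - e0 ^+ 2 *: H)| <= eps,
    forall x, `|u' x - u x| <= eps & bil (c - eps) u'].
Proof.
move=> K1 ru hG hT lT e00 heH hCc hb eps0.
have C1 := set_C S; have C0 : 0 <= C := le_trans ler01 C1; have L1 := set_L S; have /andP[s0 s1] := set_s S.
have [tu lp lq] := ru; have K0 : 0 <= K by lra.
have nd : nondeg Lam p q.
  apply: (set_nd S) => x; exists 0; first by rewrite lexx ler01.
  rewrite scale0r addr0 (le_trans (hG x)) //; lra.
have [bp bq _] := nd.
pose h x := tau x - met p q x - e0 ^+ 2 *: H.
have hH x : `|h x - H| <= 3 * (sigma / 8).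
  have -> : h x - H = (tau x - (G + H)) - (met p q x - G) - e0 ^+ 2 *: H.
    rewrite /h; move: (tau x) (met p q x) (e0 ^+ 2 *: H) => t m w.
    by apply: sqformP => /=; ring.
  rewrite (le_trans (ler_normB _ _)) // (le_trans (lerD (ler_normB _ _) (lexx _))) //.
  rewrite (normrZ (e0 ^+ 2)) (ger0_norm (sqr_ge0 _)) (le_trans (lerD (lerD (hT x) (hG x)) heH)) //.
  by clear; lra.
have lh : lip (K + 6 * Lam * K) h.
  apply: (@lip_le _ _ (K + 6 * Lam * K + 0)); first by rewrite addr0.
  apply: lipD; last by apply: lip_cst.
  by apply: lipD => //; apply: lipN; apply: met_lip.
pose Lh := K + 6 * Lam * K.
have Lh1 : K <= Lh by rewrite /Lh lerDl mulr_ge0 //; lra.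
(* The three terms give [C e <= 1], [C e^2 <= eps] and [C e^2 <= sigma / 8]. *)
pose n := (Num.Def.archi_bound (C + C / eps + 8 * C / sigma)).
have Ce0 : 0 < C / eps by rewrite divr_gt0 //; lra.
have Cs0 : 0 < 8 * C / sigma by rewrite divr_gt0 //; lra.
have : C + C / eps + 8 * C / sigma < n%:R.
  by apply: archi_boundP; lra.
set N := n%:R => hN; have N0 : 0 < N by lra.
pose e := N^-1; have e0' : 0 < e by rewrite invr_gt0.
have Ne : N * e = 1 by rewrite divff // gt_eqF.
have Ce : C * e <= 1 by rewrite -Ne ler_wpM2r ?(ltW e0') //; clear -hN Ce0 Cs0; lra.
have e1 : e <= 1 by have := ler_wpM2r (ltW e0') C1; clear -Ce; lra.
have e2e : e ^+ 2 <= e by rewrite -[leRHS]expr1 ler_wiXn2l // ltW.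
have Ceps : C * e ^+ 2 <= eps.
  apply: (@le_trans _ _ (C * e)); first by rewrite ler_wpM2l.
  have : C / eps <= N by clear -hN Ce0 Cs0 C1; lra.
  rewrite ler_pdivrMr // => h1; have := ler_wpM2r (ltW e0') h1.
  by rewrite mulrAC Ne mul1r.
have Csig : C * e ^+ 2 <= sigma / 8.
  apply: (@le_trans _ _ (C * e)); first by rewrite ler_wpM2l.
  have : 8 * C / sigma <= N by clear -hN Ce0 Cs0 C1; lra.
  rewrite ler_pdivrMr // => h1; have := ler_wpM2r (ltW e0') h1.
  by rewrite [X in _ <= X]mulrAC Ne mul1r; clear; lra.
have NN : (n * n)%:R * e ^+ 2 = 1 by rewrite natrM -/N expr2 mulrACA Ne mulr1.
pose k j : R := (j%:R : R) * (C * e ^+ 4).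
have e40 : 0 < e ^+ 4 by rewrite exprn_gt0.
have Ce4 : 0 <= C * e ^+ 4 by rewrite mulr_ge0 // ltW.
have kj j : (j <= n * n)%N -> 0 <= j%:R * e ^+ 2 <= 1 /\ 0 <= k j <= C * e ^+ 2.
  move=> jn; have a1 : 0 <= j%:R * e ^+ 2 <= 1.
    by rewrite mulr_ge0 ?sqr_ge0 //= -[leRHS]NN ler_wpM2r ?sqr_ge0 // ler_nat.
  split=> //; have -> : k j = (j%:R * e ^+ 2) * (C * e ^+ 2) by rewrite /k; ring.
  have : 0 <= C * e ^+ 2 by rewrite mulr_ge0 ?sqr_ge0.
  by move: a1; set a := _ * _; set b := C * _; clear; nra.
have ind j : (j <= n * n)%N -> exists K' u' p' q', [/\ Lh <= K', regular K' u' p' q',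
    forall x, `|met p' q' x - met p q x - (j%:R * e ^+ 2) *: h x| <= k j,
    forall x, `|u' x - u x| <= k j & bil (c - k j) u'].
  elim: j => [|j IH] jn.
    exists Lh, u, p, q; split=> //.
    - exact: regular_le ru.
    - by move=> x; rewrite subrr mul0r scale0r subrr normr0 /k mul0r.
    - by move=> x; rewrite subrr normr0 /k mul0r.
    - by rewrite /k mul0r subr0.
  have [K' [u' [p' [q' [LK ru' hm hu hb']]]]] := IH (ltnW jn).
  have [a1 a2] := kj j (ltnW jn).
  (* After [j] portions the metric is close to [G + (j e^2) H], a point of the segment on which
     [set_nd] applies. *)
  have nd' : nondeg Lam p' q'.
    apply: (set_nd S) => x; exists (j%:R * e ^+ 2) => //.
    set a := _ * _ in a1 hm *.
    have -> : met p' q' x - (G + a *: H) = (met p' q' x - met p q x - a *: h x) +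
       (met p q x - G) + a *: (h x - H).
      rewrite (scalerBr a (h x) H); move: (a *: h x) (a *: H) (met p q x) (met p' q' x) => w w' m m'.
      by apply: sqformP => /=; ring.
    rewrite (le_trans (ler_normD _ _)) // (le_trans (lerD (ler_normD _ _) (lexx _))) //.
    rewrite (le_trans (lerD (lerD (hm x) (hG x)) (lexx _))) // (normrZ a) (ger0_norm (_ : 0 <= a)); last by case/andP: a1.
    have : a * `|h x - H| <= 3 * (sigma / 8).
      by apply: le_trans (hH x); rewrite ler_piMl //; case/andP: a1.
    by clear -a2 Csig s0; lra.
  have hH' x : `|h x - H| <= sigma by apply: (le_trans (hH x)); clear -s0; lra.
  have K'1 : 1 <= K' := le_trans (le_trans K1 Lh1) LK.
  have [u2 [p2 [q2 [r2 d2 _]]]] := set_stage S e0' Ce K'1 hH' (lip_le LK lh) nd' ru'.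
  have kS : k j.+1 = k j + C * e ^+ 4 by rewrite /k -natr1; ring.
  exists (Num.max Lh (C * K' / e ^+ 12)), u2, p2, q2; split.
  - by rewrite le_max lexx.
  - by apply: regular_le r2; rewrite le_max lexx orbT.
  - move=> x; have -> : met p2 q2 x - met p q x - (j.+1%:R * e ^+ 2) *: h x =
      (met p' q' x - met p q x - (j%:R * e ^+ 2) *: h x)
      + (met p2 q2 x - met p' q' x - e ^+ 2 *: h x).
      rewrite -natr1 mulrDl mul1r scalerDl; move: (_ *: h x) (e ^+ 2 *: h x) => w w'.
      move: (met p2 q2 x) (met p' q' x) (met p q x) => m m' m''.
      by apply: sqformP => /=; ring.
    by rewrite (le_trans (ler_normD _ _)) // kS lerD //; exact: (def_met d2 x).
  - move=> x; have -> : u2 x - u x = (u' x - u x) + (u2 x - u' x) by rewrite [RHS]addrC addrA subrK.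
    by rewrite (le_trans (ler_normD _ _)) // kS lerD // (def_bnd d2).
  - have -> : c - k j.+1 = c - k j - C * e ^+ 4 by rewrite kS; ring.
    apply: (def_bil d2) => //; apply: (le_trans _ hCc); rewrite ler_wpM2l //.
    by clear -a2; lra.
have [K' [u' [p' [q' [LK ru' hm hu hb']]]]] := ind _ (leqnn _).
have [_ /andP[k0 k1]] := kj _ (leqnn _).
have keps : k (n * n)%N <= eps by apply: le_trans k1 Ceps.
exists K', u', p', q'; split=> //.
- move=> x; have := hm x; rewrite NN scale1r => hx; apply: (le_trans _ keps); apply: (le_trans _ hx).
  rewrite /h; move: (tau x) (met p' q' x) (met p q x) (e0 ^+ 2 *: H) => t m m' w.
  by rewrite le_eqVlt; apply/orP; left; apply/eqP; congr (`|_|); apply: sqformP => /=; ring.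
- by move=> x; apply: le_trans (hu x) keps.
by apply: bil_le hb'; clear -keps; lra.
Qed.

(** The defect is kept close to a small multiple of the fixed form [H], so the same decomposition
    has positive coefficients in every round. The exponent 15 is the least integer [k] with
    [k + 14 < 2 k], the condition under which a round reproduces the bound. *)
Definition nearly_isometric (D sigma Ks : R) (H : sqform) (tau : P -> sqform) (s : R) (u p q : P -> V) :=
  regular (Ks / s ^+ 15) u p q /\
  forall x, `|met p q x - (tau x - (s / D) ^+ 2 *: H)| <= sigma / 8 * (s / D) ^+ 2.

(** With [e = s / D], a stage adds [e^2 h], where [e^2 h] is the defect minus the one wanted next.
    Its error [C e^4] is within [sigma / 8 * (s^2 / D)^2] because [D = 8 C / sigma]. Dividing by
    [e^2] and the three steps turn [Ks / s^15] into a constant times [s] times [Ks / s^30], and that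
    factor is at most 1 when [M s <= 1]. *)
Lemma iterate Lam sigma C G H (S : setting Lam sigma C G H) :
  let D := 8 * C / sigma in exists2 M, 1 <= M &
  forall tau Ks s u p q, 1 <= Ks -> lip Ks tau ->
    (forall x, `|tau x - (G + H)| <= sigma / 8) -> 0 < s -> M * s <= 1 ->
    nearly_isometric D sigma Ks H tau s u p q ->
  exists u' p' q', [/\ nearly_isometric D sigma Ks H tau (s ^+ 2) u' p' q',
    (forall x, `|p' x - p x| <= C * s /\ `|q' x - q x| <= C * s),
    lip (C * s) (fun x => u' x - u x) /\ (forall x, `|u' x - u x| <= C * s),
    (forall c, C * c <= 1 -> bil c u -> bil (c - C * s) u')
    & exists z, [/\ 0 < `|z|, `|z| <= C * s ^+ 4 & s <= C * D * `|q' z - q' 0|]].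
Proof.
move=> D; have C1 := set_C S; have C0 : 0 <= C := le_trans ler01 C1; have L1 := set_L S; have /andP[s0 s1] := set_s S.
have D1 : 1 <= D by rewrite /D ler_pdivlMr //; lra.
have DD : C <= sigma / 8 * D ^+ 2.
  have -> : sigma / 8 * D ^+ 2 = C * D by rewrite /D; field; rewrite gt_eqF.
  by rewrite ler_peMr //; lra.
have D0 : 0 < D by lra.
clearbody D.
(* The terms serve in turn to have [s <= 1], to absorb the regularity factor, to get
   [s * |H| <= sigma / 8], and to get [C s <= 1]. *)
pose M := 1 + 7 * C * Lam * D ^+ 14 + 8 * `|H| / sigma + C.
have m1 : 0 <= 7 * C * Lam * D ^+ 14.
  by apply: mulr_ge0; [apply: mulr_ge0; lra|apply: exprn_ge0; lra].
have m2 : 0 <= 8 * `|H| / sigma by apply: divr_ge0; [apply: mulr_ge0|lra].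
exists M; first by rewrite /M; lra.
move=> tau Ks s u p q K1 lT hT sp Ms [ru hm].
have Ms1 : s <= 1 by apply: (le_trans _ Ms); rewrite ler_peMl ?(ltW sp) // /M; lra.
have Ms2 : 7 * C * Lam * D ^+ 14 * s <= 1.
  by apply: (le_trans _ Ms); rewrite ler_wpM2r ?(ltW sp) // /M; lra.
have Ms3 : s * `|H| <= sigma / 8.
  have : 8 * `|H| / sigma * s <= 1.
    by apply: (le_trans _ Ms); rewrite ler_wpM2r ?(ltW sp) // /M; lra.
  have -> : 8 * `|H| / sigma * s = (8 * `|H| * s) / sigma by rewrite mulrAC.
  by rewrite ler_pdivrMr //; clear; lra.
have Ms4 : C * s <= 1 by apply: (le_trans _ Ms); rewrite ler_wpM2r ?(ltW sp) // /M; lra.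
clearbody M.
pose e := s / D; have e0 : 0 < e by rewrite divr_gt0.
have es : e <= s by rewrite ler_pdivrMr // ler_peMr // ltW.
have e2s : e ^+ 2 <= s.
  apply: (le_trans _ es); rewrite -[leRHS]expr1 ler_wiXn2l ?(ltW e0) //; exact: le_trans es Ms1.
have s2s : s ^+ 2 <= s by rewrite -[leRHS]expr1 ler_wiXn2l // ltW.
have e20 : 0 < e ^+ 2 by rewrite exprn_gt0.
have Ce : C * e <= 1 by apply: (le_trans _ Ms4); rewrite ler_wpM2l.
rewrite -/e in hm.
have e21 : e ^+ 2 <= 1 by apply: le_trans e2s Ms1.
have eH : e ^+ 2 * `|H| <= sigma / 8 by apply: (le_trans _ Ms3); rewrite ler_wpM2r.
have nd : nondeg Lam p q.
  apply: (set_nd S) => x; exists 1; first by rewrite ler01 lexx.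
  have -> : met p q x - (G + 1 *: H) = (met p q x - (tau x - e ^+ 2 *: H))
     + (tau x - (G + H)) - e ^+ 2 *: H.
    rewrite scale1r; move: (tau x) (met p q x) (e ^+ 2 *: H) => t m w.
    by apply: sqformP => /=; ring.
  rewrite (le_trans (ler_normB _ _)) // (le_trans (lerD (ler_normD _ _) (lexx _))) //.
  rewrite (le_trans (lerD (lerD (hm x) (hT x)) (lexx _))) // (normrZ (e ^+ 2)) (ger0_norm (sqr_ge0 e)).
  have : sigma / 8 * e ^+ 2 <= sigma / 8 by rewrite ler_piMr // divr_ge0 // ltW.
  by clear -eH s0; lra.
have [bp bq _] := nd; have [tu lp lq] := ru.
pose K := Ks / s ^+ 15.
have s15 : 0 < s ^+ 15 by rewrite exprn_gt0.
have KsK : Ks <= K.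
  by rewrite /K ler_pdivlMr // ler_piMr ?exprn_ile1 // ?(ltW sp) // (le_trans ler01).
have K11 : 1 <= K by apply: le_trans K1 KsK.
have K0 : 0 <= K := le_trans ler01 K11.
pose h x := (e ^+ 2)^-1 *: (tau x - (s ^+ 2 / D) ^+ 2 *: H - met p q x).
have eh x : e ^+ 2 *: h x = tau x - (s ^+ 2 / D) ^+ 2 *: H - met p q x.
  by rewrite /h scalerA divff ?scale1r // gt_eqF.
have se : (s ^+ 2 / D) ^+ 2 = s ^+ 2 * e ^+ 2 by rewrite /e; field; rewrite gt_eqF.
have hH x : `|h x - H| <= sigma.
  have -> : h x - H = (e ^+ 2)^-1 *: (- (met p q x - (tau x - e ^+ 2 *: H))) - s ^+ 2 *: H.
    have e2n : e ^+ 2 != 0 by rewrite gt_eqF.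
    apply: (scalerI e2n); rewrite !scalerBr eh scalerA divff // scale1r se scalerA (mulrC (s ^+ 2)).
    move: (e ^+ 2 *: H) ((e ^+ 2 * _) *: H) (met p q x) (tau x) => a b m t.
    by apply: sqformP => /=; ring.
  rewrite (le_trans (ler_normB _ _)) // (normrZ (s ^+ 2)) (normrZ (e ^+ 2)^-1) normrN (ger0_norm (sqr_ge0 s)).
  rewrite gtr0_norm ?invr_gt0 //.
  have h1 : (e ^+ 2)^-1 * `|met p q x - (tau x - e ^+ 2 *: H)| <= sigma / 8.
    by rewrite mulrC ler_pdivrMr.
  have h2 : s ^+ 2 * `|H| <= sigma / 8 by apply: (le_trans _ Ms3); rewrite ler_wpM2r.
  by clear -h1 h2 s0; lra.
have lh : lip (7 * Lam * K / e ^+ 2) h.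
  have : lip (K + 0 + 6 * Lam * K) (fun x => tau x - (s ^+ 2 / D) ^+ 2 *: H - met p q x).
    apply: lipD; last by apply: lipN; apply: met_lip.
    by apply: lipD; [exact: lip_le lT|exact: lip_cst].
  move/(lipZ (e ^+ 2)^-1); apply: lip_le; rewrite gtr0_norm ?invr_gt0 // mulrC.
  rewrite ler_wpM2r ?invr_ge0 ?(ltW e20) //.
  have : 1 * K <= Lam * K by rewrite ler_wpM2r.
  by clear; lra.
have KL : K <= 7 * Lam * K / e ^+ 2.
  rewrite ler_pdivlMr //.
  have : K * e ^+ 2 <= K by rewrite ler_piMr.
  have : 1 * K <= Lam * K by rewrite ler_wpM2r.
  by clear -K0; lra.
have [u' [p' [q' [r' d' [z [z0 z4 oz]]]]]] :=
  set_stage S e0 Ce (le_trans K11 KL) hH lh nd (regular_le KL ru).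
have Ces : C * e <= C * s by rewrite ler_wpM2l.
have es4 : e ^+ 4 <= s ^+ 4.
  by rewrite ler_pXn2r ?nnegrE ?(ltW e0) ?(ltW sp).
have s4s : s ^+ 4 <= s by rewrite -[leRHS]expr1 ler_wiXn2l // ltW.
have Ces4 : C * e ^+ 4 <= C * s by rewrite ler_wpM2l ?(le_trans es4).
exists u', p', q'; split.
- split.
    apply: regular_le r'; rewrite -exprM -/K.
    have -> : C * (7 * Lam * K / e ^+ 2) / e ^+ 12 = (7 * C * Lam * D ^+ 14 * s) * (Ks / s ^+ 30).
      rewrite /K /e; field; rewrite !gt_eqF //.
    by rewrite ler_piMl // divr_ge0 ?exprn_ge0 ?(ltW sp) // (le_trans ler01).
  move=> x; have := def_met d' x; rewrite eh se => hx.
  have -> : met p' q' x - (tau x - (s ^+ 2 * e ^+ 2) *: H) =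
    met p' q' x - met p q x - (tau x - (s ^+ 2 * e ^+ 2) *: H - met p q x).
    move: (_ *: H) (met p' q' x) (met p q x) (tau x) => w m m' t.
    by apply: sqformP => /=; ring.
  apply: (le_trans hx).
  have -> : sigma / 8 * (s ^+ 2 * e ^+ 2) = (sigma / 8 * D ^+ 2) * e ^+ 4.
    by rewrite /e; field; rewrite gt_eqF.
  by rewrite ler_wpM2r // exprn_ge0 // ltW.
- by move=> x; have [g1 g2] := def_grad d' x; split; [exact: le_trans g1 Ces|exact: le_trans g2 Ces].
- split; first exact: lip_le (def_lip d').
  by move=> x; apply: le_trans (def_bnd d' x) Ces4.
- move=> c hc hb; apply: bil_le (def_bil d' hc hb).
  by rewrite lerD2l lerN2.
exists z; split=> //.
  by apply: (le_trans z4); rewrite ler_wpM2l.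
have -> : s = D * e by rewrite /e; field; rewrite gt_eqF.
by rewrite (mulrC C) -mulrA ler_wpM2l // ltW.
Qed.

End Iteration.

(** * Limits with explicit tails, and rates squared at each step *)

Section Limit.
Variable R : realType.
Local Notation P := (R * R)%type.
Local Notation V := 'rV[R]_3.
Local Notation sqform := (sqform R).

(** The intervals with centre [a n] and radius [r n] are nested, and the supremum of their left ends
    lies in all of them. The distance to the limit thus comes with its bound. *)
Lemma telescoping_limit (a r : nat -> R) : (forall n, 0 <= r n) ->
  (forall n, `|a n.+1 - a n| <= r n - r n.+1) -> exists l, forall n, `|l - a n| <= r n.
Proof.
move=> r0 h.
have lo n m : (n <= m)%N -> a n - r n <= a m - r m.
  move/subnK => <-; elim: (m - n)%N => [|k IH]; first by rewrite add0n.
  apply: (le_trans IH); rewrite addSn; have := h (k + n)%N; rewrite ler_norml; lra.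
have hi n m : (n <= m)%N -> a m + r m <= a n + r n.
  move/subnK => <-; elim: (m - n)%N => [|k IH]; first by rewrite add0n.
  apply: (le_trans _ IH); rewrite addSn; have := h (k + n)%N; rewrite ler_norml; lra.
have lohi n m : a n - r n <= a m + r m.
  have := lo _ _ (leq_maxl n m); have := hi _ _ (leq_maxr n m); have := r0 (maxn n m); lra.
pose E := [set y | exists n, y = a n - r n].
have E0 : E !=set0 by exists (a 0%N - r 0%N), 0%N.
have ubE m : ubound E (a m + r m) by move=> _ [n ->].
exists (sup E) => n; rewrite ler_norml.
have h1 : a n - r n <= sup E.
  by apply: ub_le_sup; [exists (a 0%N + r 0%N); exact: ubE|exists n].
have h2 : sup E <= a n + r n by apply: ge_sup.
lra.
Qed.

Lemma telescoping_limit_row (a : nat -> V) (r : nat -> R) : (forall n, 0 <= r n) ->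
  (forall n, `|a n.+1 - a n| <= r n - r n.+1) -> exists l, forall n, `|l - a n| <= r n.
Proof.
move=> r0 h.
have H (k : 'I_3) : exists l, forall n, `|l - a n 0 k| <= r n.
  apply: telescoping_limit => // n; apply: le_trans (h n).
  by have := norm_coord (a n.+1 - a n) k; rewrite !mxE.
have [l hl] := choice H; exists (\row_k l k) => n.
by apply: norm_leP => // k; rewrite !mxE.
Qed.

Lemma sequential_choice (T : Type) (A : nat -> T -> Prop) (B : nat -> T -> T -> Prop) t0 :
  A 0%N t0 -> (forall n t, A n t -> exists2 t', A n.+1 t' & B n t t') ->
  exists2 f : nat -> T, f 0%N = t0 & forall n, A n (f n) /\ B n (f n) (f n.+1).
Proof.
move=> h0 h.
(* [choice] is applied to pairs of an index and a state; [t0] is a dummy value where the invariant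
   fails. *)
have H (nt : nat * T) : exists t', A nt.1 nt.2 -> A nt.1.+1 t' /\ B nt.1 nt.2 t'.
  have [a|na] := pselect (A nt.1 nt.2); last by exists t0.
  by have [t' h1 h2] := h _ _ a; exists t'.
have [F hF] := choice H.
pose f := fix f n := if n is m.+1 then F (m, f m) else t0.
have Af n : A n (f n) by elim: n => [//|n IH]; exact: (proj1 (hF (n, f n) IH)).
exists f => // n; split=> //; exact: (proj2 (hF (n, f n) (Af n))).
Qed.

Section Rates.
Variable s0 : R.

(** Squared at each index, as in [iterate]. *)
Definition rate n : R := s0 ^+ (2 ^ n).

Lemma rateS n : rate n.+1 = rate n ^+ 2.
Proof. by rewrite /rate expnSr exprM. Qed.

Lemma rate_itv n : 0 < s0 <= 1/2 -> 0 < rate n <= 1/2.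
Proof.
move=> /andP[h1 h2]; rewrite exprn_gt0 //=.
elim: n => [|n IH]; first by rewrite /rate expr1.
rewrite rateS; have : 0 < rate n by rewrite exprn_gt0.
move: IH; set r := rate n; clear; nra.
Qed.

Lemma rate_half n : 0 < s0 <= 1/2 -> rate n.+1 <= rate n / 2.
Proof. by move=> /(rate_itv n); rewrite rateS; set r := rate n; clear; nra. Qed.

Lemma rate_small d : 0 < s0 <= 1/2 -> 0 < d -> exists n, rate n < d.
Proof.
move=> hs d0.
have h n : rate n * n%:R <= 1.
  elim: n => [|n IH]; first by rewrite mulr0.
  case: n IH => [|n] IH; first by rewrite mulr1; have := rate_itv 1 hs; clear; lra.
  have r'h := rate_half n.+1 hs; have /andP[rp _] := rate_itv n.+1 hs.
  have -> : n.+2%:R = n.+1%:R + 1 :> R by rewrite natr1.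
  have : 1 <= n.+1%:R :> R by rewrite ler1n.
  move: IH r'h rp; set r := rate n.+1; set r' := rate _; set m := _%:R => IH r'h rp m1.
  have m0 : 0 <= m + 1 by lra.
  have := ler_wpM2r m0 r'h; have : 0 <= r * (m - 1) by apply: mulr_ge0; lra.
  by clear -IH; lra.
pose n := Num.Def.archi_bound (d^-1).
have hn : d^-1 < n%:R by apply: archi_boundP; rewrite invr_ge0 ltW.
exists n; rewrite ltNge; apply/negP => hd.
have n0 : 0 < n%:R :> R by rewrite (lt_trans _ hn) // invr_gt0.
have := ler_wpM2r (ltW n0) hd; have := ltr_pM2r d0 d^-1 n%:R; rewrite hn mulVf ?gt_eqF //.
by move: (h n); rewrite mulrC; clear; lra.
Qed.

Lemma le_rate (a b k : R) : 0 < s0 <= 1/2 -> (forall n, a <= b + k * rate n) -> a <= b.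
Proof.
move=> hs h; rewrite leNgt; apply/negP => ba.
have k1 : 0 < `|k| + 1 by rewrite ltr_wpDl.
have [n hn] : exists n, rate n < (a - b) / (`|k| + 1).
  by apply: rate_small => //; rewrite divr_gt0 // subr_gt0.
have := h n; have /andP[r0 _] := rate_itv n hs.
rewrite ltr_pdivlMr // in hn.
have := ler_norm k => kk; have := ler_wpM2r (ltW r0) kk.
by move: hn r0; set r := rate n; clear; lra.
Qed.

Lemma eq_rate (a : V) k : 0 < s0 <= 1/2 -> (forall n, `|a| <= k * rate n) -> a = 0.
Proof.
move=> hs h; apply/eqP; rewrite -normr_eq0 eq_le normr_ge0 andbT.
by apply: (le_rate (k := k) hs) => n; rewrite add0r.
Qed.

End Rates.

Lemma powR_root (s d : R) (n : nat) : 0 <= s -> (0 < n)%N -> s ^+ n <= d -> s <= d `^ (n%:R^-1).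
Proof.
move=> h0 hn h; have d0 : 0 <= d by apply: le_trans h; rewrite exprn_ge0.
have -> : s = (s ^+ n) `^ (n%:R^-1).
  by rewrite -powR_mulrn // -powRrM divff ?powRr1 // pnatr_eq0 -lt0n.
by apply: ge0_ler_powR => //; rewrite ?invr_ge0 ?nnegrE ?exprn_ge0.
Qed.

(* [y] has gradient [(p, q)], in a form that makes it a uniform limit of      *)
(* quadratic estimates; [rough] prevents [q] from being differentiable at 0.  *)
Record rough_immersion (alpha : R) (tau : P -> sqform) (y p q : P -> V) : Prop := Rough {
  rough_met : forall x, met p q x = tau x;
  rough_tay : forall k, 0 < k -> exists K, forall x z,
    `|y z - y x - lin p q x (z - x)| <= k * `|z - x| + K * `|z - x| ^+ 2;
  rough_holder : exists K, forall x z, `|p z - p x| <= K * `|z - x| `^ alpha /\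
    `|q z - q x| <= K * `|z - x| `^ alpha;
  rough_bil : exists2 c, 0 < c & bil c y;
  rough_osc : forall M, 1 <= M -> exists z, [/\ 0 < `|z|, M * `|z| <= 1 &
    M * `|z| <= `|q z - q 0|] }.

End Limit.

(** * The limit of the iteration *)

Section LimitImmersion.
Variable R : realType.
Local Notation P := (R * R)%type.
Local Notation V := 'rV[R]_3.
Local Notation sqform := (sqform R).

Lemma limit_immersion (s0 A B C c Ks : R) (tau : P -> sqform) (u p q : nat -> P -> V) :
  0 < s0 <= 1 / 2 -> 0 <= A -> 0 <= B -> 0 <= C -> 0 < c -> 0 <= Ks ->
  let s := rate s0 in
  (forall n, regular (Ks / s n ^+ 15) (u n) (p n) (q n)) ->
  (forall n x, `|met (p n) (q n) x - tau x| <= A * s n) ->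
  (forall n x, `|p n.+1 x - p n x| <= C * s n /\ `|q n.+1 x - q n x| <= C * s n) ->
  (forall n, lip (C * s n) (fun x => u n.+1 x - u n x)) ->
  (forall n x, `|u n.+1 x - u n x| <= C * s n) ->
  (forall n, bil c (u n)) ->
  (forall n, exists z, [/\ 0 < `|z|, `|z| <= C * s n ^+ 4 &
     s n <= A * `|q n.+1 z - q n.+1 0|]) ->
  (forall x, `|tau x| <= B) ->
  exists y P Q, rough_immersion 32^-1 tau y P Q /\
    forall n x, `|y x - u n x| <= 2 * C * s n.
Proof.
move=> hs A0 B0 C0 c0 Ks0 s hr hm hpq hlu hu hb ho hT.
have sp n : 0 < s n by have /andP[] := rate_itv n hs.
have s1 n : s n <= 1 / 2 by have /andP[] := rate_itv n hs.
(* The rate at least halves, so the corrections [C s k] with [k >= n] add up to at most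
   [2 C s n]. *)
pose r n := 2 * C * s n.
have r0 n : 0 <= r n by rewrite !mulr_ge0 // ltW.
have rS n : C * s n <= r n - r n.+1.
  have := rate_half n hs; rewrite -/(s n) -/(s n.+1) => h.
  by have := ler_wpM2l C0 h; rewrite /r; clear; lra.
have Hu x : exists l, forall n, `|l - u n x| <= r n.
  by apply: telescoping_limit_row => // n; apply: le_trans (hu n x) (rS n).
have Hp x : exists l, forall n, `|l - p n x| <= r n.
  by apply: telescoping_limit_row => // n; apply: le_trans (proj1 (hpq n x)) (rS n).
have Hq x : exists l, forall n, `|l - q n x| <= r n.
  by apply: telescoping_limit_row => // n; apply: le_trans (proj2 (hpq n x)) (rS n).
have [y hy] := choice Hu; have [P hP] := choice Hp; have [Q hQ] := choice Hq.
clear Hu Hp Hq; exists y, P, Q; split; last by move=> n x; apply: hy.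
(* Increments converge with an error proportional to [|z - x|], which uniform convergence of the
   values alone would not give. The limit of the increments is then identified with the increment of
   [y]. *)
have hyl n x z : `|(y z - y x) - (u n z - u n x)| <= r n * `|z - x|.
  have d0 : 0 <= `|z - x| by [].
  have [|l hl] := @telescoping_limit_row R (fun n => u n z - u n x) (fun n => r n * `|z - x|)
     (fun n => mulr_ge0 (r0 n) d0).
    move=> k; have -> : u k.+1 z - u k.+1 x - (u k z - u k x) =
      (u k.+1 z - u k z) - (u k.+1 x - u k x) by apply: row3P; rewrite !mxE; ring.
    by apply: (le_trans (hlu k x z)); rewrite -mulrBl ler_wpM2r.
  suff -> : y z - y x = l by exact: hl.
  apply/eqP; rewrite -subr_eq0; apply/eqP.
  apply: (eq_rate (k := 2 * C * (2 + `|z - x|)) hs) => k.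
  have -> : y z - y x - l = (y z - u k z) - (y x - u k x) - (l - (u k z - u k x)).
    by apply: row3P; rewrite !mxE; ring.
  rewrite (le_trans (ler_normB _ _)) // (le_trans (lerD (ler_normB _ _) (hl k))) //.
  rewrite (le_trans (lerD (lerD (hy z k) (hy x k)) (lexx _))) // -/(s k) /r.
  by clear; lra.
have metPQ x : met P Q x = tau x.
  have dotlim (f g : nat -> R * R -> V) (F E : R * R -> V) : (forall n, `|F x - f n x| <= r n) ->
      (forall n, `|E x - g n x| <= r n) ->
      exists2 k, 0 <= k & forall n, `|dot (F x) (E x) - dot (f n x) (g n x)| <= k * s n.
    move=> hf hg; pose b := `|F x| + `|E x| + 2 * C.
    exists (3 * (2 * (b * (2 * C)))).
      by apply: mulr_ge0 => //; apply: mulr_ge0 => //; apply: mulr_ge0; rewrite ?addr_ge0 ?mulr_ge0.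
    move=> n; have -> : dot (F x) (E x) - dot (f n x) (g n x) =
      dot (F x - f n x) (E x) + dot (f n x) (E x - g n x).
      by rewrite dotDl dotNl dotDr dotNr addrA subrK.
    have fb : `|f n x| <= b.
      have -> : f n x = F x - (F x - f n x) by rewrite opprB addrC subrK.
      rewrite (le_trans (ler_normB _ _)) // (le_trans (lerD (lexx _) (hf n))) //.
      rewrite /b /r -addrA lerD2l ler_wpDl // ler_piMr ?mulr_ge0 //.
      by have := s1 n; clear; lra.
    have Eb : `|E x| <= b by rewrite /b addrAC lerDr addr_ge0 // mulr_ge0.
    have three : (0 : R) <= 3 by [].
    have k1 := le_trans (dot_norm _ _) (ler_wpM2l three
      (ler_pM (normr_ge0 _) (normr_ge0 _) (hf n) Eb)).
    have k2 := le_trans (dot_norm _ _) (ler_wpM2l three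
      (ler_pM (normr_ge0 _) (normr_ge0 _) fb (hg n))).
    rewrite (le_trans (ler_normD _ _)) // (le_trans (lerD k1 k2)) // /r.
    by clear; lra.
  have [k1 k10 h1] := dotlim p p P P (hP x) (hP x).
  have [k2 k20 h2] := dotlim p q P Q (hP x) (hQ x).
  have [k3 k30 h3] := dotlim q q Q Q (hQ x) (hQ x).
  have mm n : `|met P Q x - met (p n) (q n) x| <= (k1 + k2 + k3) * s n.
    have e1 : k1 * s n <= (k1 + k2 + k3) * s n by rewrite ler_wpM2r ?(ltW (sp n)) //; clear -k20 k30; lra.
    have e2 : k2 * s n <= (k1 + k2 + k3) * s n by rewrite ler_wpM2r ?(ltW (sp n)) //; clear -k10 k30; lra.
    have e3 : k3 * s n <= (k1 + k2 + k3) * s n by rewrite ler_wpM2r ?(ltW (sp n)) //; clear -k10 k20; lra.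
    by apply: sqform_norm_le; [exact: le_trans (h1 n) e1|exact: le_trans (h2 n) e2|
      exact: le_trans (h3 n) e3].
  apply/eqP; rewrite -subr_eq0 -normr_eq0 eq_le normr_ge0 andbT.
  apply: (le_rate (k := k1 + k2 + k3 + A) hs) => n.
  have -> : met P Q x - tau x = (met P Q x - met (p n) (q n) x) + (met (p n) (q n) x - tau x).
    by rewrite addrA subrK.
  rewrite add0r (le_trans (ler_normD _ _)) // (le_trans (lerD (mm n) (hm n x))) //.
  by rewrite -/(s n); clear; lra.
have bPQ x : `|P x| <= B + 1 /\ `|Q x| <= B + 1.
  have [c1 _ c3] := sqform_coord (met P Q x); rewrite metPQ in c1 c3.
  have sq (w : V) : dot w w <= B -> `|w| <= B + 1.
    move=> h; rewrite -ler_sqr ?nnegrE ?addr_ge0 //.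
    by apply: (le_trans (norm_dot w)); apply: (le_trans h); clear -B0; nra.
  split; apply: sq; apply: (le_trans (ler_norm _)).
    by have := le_trans c1 (hT x); rewrite -metPQ.
  by have := le_trans c3 (hT x); rewrite -metPQ.
split=> //.
(* [n] is taken so large that the increments ([r n]) and the linear part ([2 r n]) together cost at
   most [k]; the regularity constant of stage [n] becomes [K]. *)
- move=> k k0; have [n hn] : exists n, s n < k / (6 * C + 1).
    by apply: rate_small => //; rewrite divr_gt0 //; clear -C0; lra.
  exists (Ks / s n ^+ 15) => x z.
  have [tu _ _] := hr n.
  have -> : y z - y x - lin P Q x (z - x) = ((y z - y x) - (u n z - u n x)) +
    (u n z - u n x - lin (p n) (q n) x (z - x)) -
    lin (fun x => P x - p n x) (fun x => Q x - q n x) x (z - x).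
    by rewrite /lin; apply: row3P; rewrite !mxE; ring.
  rewrite (le_trans (ler_normB _ _)) // (le_trans (lerD (ler_normD _ _) (lexx _))) //.
  have l1 := @lin_le R _ (r n) (fun x => P x - p n x) (fun x => Q x - q n x) x (z - x) (hP x n) (hQ x n).
  rewrite (le_trans (lerD (lerD (hyl n x z) (tu x z)) l1)) //.
  have kk : 3 * r n <= k.
    rewrite ltr_pdivlMr in hn; last by clear -C0; lra.
    by have := sp n; rewrite /r; clear -hn; lra.
  have := ler_wpM2r (normr_ge0 (z - x)) kk; clear; lra.
- pose K := 4 * C + Ks + 2 * (B + 1) / s0.
  have s00 : 0 < s0 by have /andP[] := hs.
  have K0 : 0 <= 2 * (B + 1) / s0 by rewrite divr_ge0 ?mulr_ge0 ?addr_ge0 // ltW.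
  have hold (f : nat -> R * R -> V) (F : R * R -> V) : (forall x n, `|F x - f n x| <= r n) ->
      (forall n, lip (Ks / s n ^+ 15) (f n)) -> (forall x, `|F x| <= B + 1) ->
      forall x z, `|F z - F x| <= K * `|z - x| `^ 32^-1.
    move=> hf lf bF x z; set d := `|z - x|.
    have [d0|d0] := leP d 0.
      have -> : z = x by apply/eqP; rewrite -subr_eq0 -normr_le0.
      by rewrite subrr normr0 mulr_ge0 ?powR_ge0 // /K; clear -C0 Ks0 K0; lra.
    (* Distances above [s0^16] are not resolved by any round: there the boundedness of the gradient
       suffices. *)
    have [dbig|dsmall] := ltP (s0 ^+ 16) d.
      have h1 : s0 <= d `^ 32^-1.
        apply: powR_root => //; first exact: ltW.
        apply: (le_trans _ (ltW dbig)); rewrite ler_wiXn2l //; first exact: ltW.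
        by have /andP[_] := hs; clear; lra.
      have h2 : `|F z - F x| <= 2 * (B + 1).
        rewrite (le_trans (ler_normB _ _)) // (le_trans (lerD (bF z) (bF x))) //; clear; lra.
      apply: (le_trans h2).
      have -> : 2 * (B + 1) = 2 * (B + 1) / s0 * s0 by rewrite mulfVK // gt_eqF.
      by apply: ler_pM => //; rewrite /K; [exact: ltW|clear -C0 Ks0; lra].
    (* The least such [n] has [s_(n+1)^16 < d <= s_n^16]. The upper bound gives
       [Ks s_n^-15 d <= Ks s_n]; the lower one, which reads [s_n^32 < d], gives
       [s_n <= d^(1/32)]. *)
    have ex : exists n, s n.+1 ^+ 16 < d.
      have [n hn] := rate_small hs d0; exists n; apply: (le_lt_trans _ hn).
      apply: (@le_trans _ _ (s n.+1)).
        by rewrite -[leRHS]expr1 ler_wiXn2l ?(ltW (sp _)) //; have := s1 n.+1; clear; lra.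
      have := rate_half n hs; have := sp n; rewrite -/(s n) -/(s n.+1); clear; lra.
    have [n hn nmin] := ex_minnP ex.
    have dn : d <= s n ^+ 16.
      case: n nmin hn => [_ _|n nmin _]; first by rewrite /s /rate expr1.
      by rewrite leNgt; apply/negP => /nmin; rewrite ltnn.
    have h1 : s n <= d `^ 32^-1.
      apply: powR_root => //; first exact: ltW.
      by apply: (le_trans _ (ltW hn)); rewrite /s rateS -exprM.
    have h2 : `|F z - F x| <= (4 * C + Ks) * s n.
      have -> : F z - F x = (F z - f n z) - (F x - f n x) + (f n z - f n x).
        by apply: row3P; rewrite !mxE; ring.
      rewrite (le_trans (ler_normD _ _)) // (le_trans (lerD (ler_normB _ _) (lf n x z))) //.
      rewrite (le_trans (lerD (lerD (hf z n) (hf x n)) (lexx _))) // -/d.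
      have : Ks / s n ^+ 15 * d <= Ks * s n.
        have sn0 : s n != 0 by rewrite gt_eqF.
        have -> : Ks * s n = Ks / s n ^+ 15 * s n ^+ 16 by field.
        by rewrite ler_wpM2l // divr_ge0 // exprn_ge0 // ltW.
      by rewrite /r; clear; lra.
    apply: (le_trans h2); apply: ler_pM => //; first by clear -C0 Ks0; lra.
      exact: ltW.
    by rewrite /K; clear -K0; lra.
  exists K => x z; split.
    by apply: (hold p P) => // [n|x']; [have [] := hr n|have [] := bPQ x'].
  by apply: (hold q Q) => // [n|x']; [have [] := hr n|have [] := bPQ x'].
- exists c => // x z; apply: (le_rate (k := 4 * C) hs) => n.
  apply: (le_trans (hb n x z)).
  have -> : u n z - u n x = (y z - y x) - ((y z - u n z) - (y x - u n x)).
    by apply: row3P; rewrite !mxE; ring.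
  rewrite (le_trans (ler_normB _ _)) // lerD2l (le_trans (ler_normB _ _)) //.
  by rewrite (le_trans (lerD (hy z n) (hy x n))) // /r -/(s n); clear; lra.
(* Round [n] moves [q] by order [s_n] over a distance of order [s_n^4], and all later rounds change
   [q] by at most [2 C s_n^2]. The summands of [b] make the later changes and [M |z|] negligible. *)
move=> M M1; pose b := 1 + 8 * C * A + 2 * A * M * C + M * C.
have M0 : 0 <= M by clear -M1; lra.
have b1 : 0 <= 8 * C * A by rewrite !mulr_ge0.
have b2 : 0 <= 2 * A * M * C by rewrite !mulr_ge0.
have b3 : 0 <= M * C by rewrite mulr_ge0.
have [n hn] : exists n, s n < b^-1.
  by apply: rate_small => //; rewrite invr_gt0 /b; clear -b1 b2 b3; lra.
have bp : 0 < b by rewrite /b; clear -b1 b2 b3; lra.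
have {}hn : b * s n <= 1.
  by have := ltW hn; rewrite -(ler_pM2l bp) divff // gt_eqF.
have [z [z0 z4 oz]] := ho n; exists z; split=> //.
  have : M * `|z| <= M * (C * s n ^+ 4) by rewrite ler_wpM2l.
  have s4 : s n ^+ 4 <= s n.
    by rewrite -[leRHS]expr1 ler_wiXn2l ?(ltW (sp _)) //; have := s1 n; clear; lra.
  have := ler_wpM2l b3 s4; have := ler_wpM2r (ltW (sp n)) (_ : M * C <= b).
  by move=> /(_ ltac:(rewrite /b; clear -b1 b2; lra)); clear -hn; lra.
have q1 := hQ z n.+1; have q2 := hQ 0 n.+1.
have rr : r n.+1 = 2 * C * s n ^+ 2 by rewrite /r /s rateS.
have up : `|q n.+1 z - q n.+1 0| <= `|Q z - Q 0| + 4 * C * s n ^+ 2.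
  have -> : q n.+1 z - q n.+1 0 = (Q z - Q 0) - ((Q z - q n.+1 z) - (Q 0 - q n.+1 0)).
    by apply: row3P; rewrite !mxE; ring.
  rewrite (le_trans (ler_normB _ _)) // lerD2l (le_trans (ler_normB _ _)) //.
  by rewrite (le_trans (lerD q1 q2)) // rr; clear; lra.
have h1 : s n <= A * `|Q z - Q 0| + 4 * C * A * s n ^+ 2.
  by apply: (le_trans oz); have := ler_wpM2l A0 up; clear; lra.
have sn := sp n; have sn1 := s1 n.
have h2 : 8 * C * A * s n <= 1.
  by apply: (le_trans _ hn); rewrite ler_wpM2r ?(ltW sn) // /b; clear -b2 b3; lra.
have h3 : 2 * A * M * C * s n <= 1.
  by apply: (le_trans _ hn); rewrite ler_wpM2r ?(ltW sn) // /b; clear -b1 b3; lra.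
have h4 : s n <= 2 * A * `|Q z - Q 0|.
  by have := ler_wpM2r (ltW sn) h2; clear -h1; lra.
have A1 : 0 < A.
  rewrite lt_neqAle A0 andbT eq_sym; apply/negP => /eqP A00.
  by move: h4; rewrite A00 mulr0 mul0r leNgt sn.
rewrite -(ler_pM2l (_ : 0 < 2 * A)); last by rewrite mulr_gt0.
apply: (le_trans _ h4).
have h5 : 2 * A * (M * `|z|) <= 2 * A * (M * (C * s n ^+ 4)).
  by rewrite ler_wpM2l ?mulr_ge0 // ler_wpM2l.
apply: (le_trans h5).
have s4 : s n ^+ 4 <= s n ^+ 2.
  by rewrite ler_wiXn2l ?(ltW sn) //; clear -sn1; lra.
have := ler_wpM2l b2 s4; have := ler_wpM2r (ltW sn) h3.
by clear; lra.
Qed.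

End LimitImmersion.

(** * Isometric maps near a map whose metric is almost constant *)

Section ConvexIntegration.
Variable R : realType.
Local Notation P := (R * R)%type.
Local Notation V := 'rV[R]_3.
Local Notation sqform := (sqform R).

Theorem convex_integration (G H : sqform) : posdef G -> posdef H ->
  exists2 sigma : R, 0 < sigma &
  forall K (u p q : P -> V) tau c eps, 1 <= K -> regular K u p q ->
    (forall x, `|met p q x - G| <= sigma) -> (forall x, `|tau x - (G + H)| <= sigma) ->
    lip K tau -> 0 < c -> bil c u -> 0 < eps ->
  exists y y1 y2, rough_immersion 32^-1 tau y y1 y2 /\ forall x, `|y x - u x| <= eps.
Proof.
move=> pG pH; have [Lam [sigma [C S]]] := setting_exists pG pH.
have C1 := set_C S; have L1 := set_L S; have /andP[s0 s1] := set_s S.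
exists (sigma / 8); first by rewrite divr_gt0.
move=> K u p q tau c eps K1 ru hG hT lT c0 hb eps0.
have [M M1 hit] := iterate S; set D := 8 * C / sigma in hit.
have D1 : 1 <= D by rewrite /D ler_pdivlMr //; lra.
have D0 : 0 < D by lra.
clearbody D.
have C0 : 0 < C by lra.
(* The deformations preserve lower bounds only for constants at most [1 / C]. *)
pose c' := Num.min c C^-1.
have c'0 : 0 < c' by rewrite lt_min c0 invr_gt0.
have Cc' : C * c' <= 1.
  have : c' <= C^-1 by rewrite ge_min lexx orbT.
  by rewrite -(ler_pM2l C0) divff // gt_eqF.
have hb' : bil c' u by apply: bil_le hb; rewrite ge_min lexx.
(* The starting rate is [t = 1 / b]. The summands give in turn [M t <= 1], [t <= 1 / 2],
   [t |H| <= sigma / 8], and a total drift [2 C t] within [c' / 4] and within [eps / 2]. *)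
pose b := M + 2 + 8 * `|H| / sigma + 8 * C / c' + 4 * C / eps.
have b1 : 0 <= 8 * `|H| / sigma by rewrite divr_ge0 ?mulr_ge0 // ltW.
have b2 : 0 <= 8 * C / c' by rewrite divr_ge0 ?mulr_ge0 // ltW.
have b3 : 0 <= 4 * C / eps by rewrite divr_ge0 ?mulr_ge0 // ltW.
have b0 : 2 <= b by rewrite /b; clear -b1 b2 b3 M1; lra.
pose t := b^-1; have bp : 0 < b by clear -b0; lra.
have t0 : 0 < t by rewrite invr_gt0.
have bt k : k <= b -> k * t <= 1.
  by move=> kb; rewrite -[leRHS](mulfV (lt0r_neq0 bp)) ler_wpM2r // ltW.
have Mt : M * t <= 1 by apply: bt; rewrite /b; clear -b1 b2 b3; lra.
have t2 : 2 * t <= 1 by apply: bt.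
have tH : t * `|H| <= sigma / 8.
  have : 8 * `|H| / sigma * t <= 1 by apply: bt; rewrite /b; clear -b2 b3 M1; lra.
  rewrite mulrAC ler_pdivrMr //; clear; lra.
have tc : 2 * C * t <= c' / 4.
  have : 8 * C / c' * t <= 1 by apply: bt; rewrite /b; clear -b1 b3 M1; lra.
  rewrite mulrAC ler_pdivrMr //; clear; lra.
have te : 2 * C * t <= eps / 2.
  have : 4 * C / eps * t <= 1 by apply: bt; rewrite /b; clear -b1 b2 M1; lra.
  rewrite mulrAC ler_pdivrMr //; clear; lra.
have t1 : t <= 1 by clear -t2 t0; lra.
have ht : 0 < t <= 1 / 2 by rewrite t0 /=; clear -t2; lra.
clearbody t; clear bt b1 b2 b3 b0 bp; clear b.
pose e0 := t / D; have e00 : 0 < e0 by rewrite divr_gt0.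
have e0t : e0 <= t by rewrite ler_pdivrMr // ler_peMr // ltW.
have e2t : e0 ^+ 2 <= t.
  apply: (le_trans _ e0t); rewrite -[leRHS]expr1 ler_wiXn2l ?(ltW e00) //.
  exact: le_trans e0t t1.
have e0H : e0 ^+ 2 * `|H| <= sigma / 8 by apply: (le_trans _ tH); rewrite ler_wpM2r.
pose eps1 := Num.min (sigma / 8 * e0 ^+ 2) (Num.min (eps / 2) (c' / 4)).
have e10 : 0 < eps1 by rewrite !lt_min !divr_gt0 // mulr_gt0 ?exprn_gt0 // divr_gt0.
have ea : eps1 <= sigma / 8 * e0 ^+ 2 by rewrite ge_min lexx.
have eb : eps1 <= eps / 2 by rewrite !ge_min lexx orbT.
have ec : eps1 <= c' / 4 by rewrite !ge_min lexx !orbT.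
clearbody eps1.
have [K' [v [v1 [v2 [rv hv dv bv]]]]] := initial_loop S K1 ru hG hT lT e00 e0H Cc' hb' e10.
(* [Ks] bounds the Lipschitz constant of [tau], and makes the output of [initial_loop] satisfy the
   regularity bound at [s = t]. *)
pose Ks := Num.max K (K' * t ^+ 15).
have Ks1 : 1 <= Ks by rewrite le_max K1.
have KKs : K <= Ks by rewrite le_max lexx.
have t15 : 0 < t ^+ 15 by rewrite exprn_gt0.
have K'K : K' <= Ks / t ^+ 15 by rewrite ler_pdivlMr // le_max lexx orbT.
have lTs := lip_le KKs lT.
pose s := rate t.
have sp n : 0 < s n by have /andP[] := rate_itv n ht.
have st n : s n <= t.
  elim: n => [|n IH]; first by rewrite /s /rate expr1.
  apply: (le_trans _ IH); have := rate_half n ht; have := sp n; rewrite -/(s n) -/(s n.+1).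
  by clear; lra.
(* Each round loses [C s_n], at most [2 C (s_n - s_(n+1))] since the rate halves. The losses
   telescope, and half of [c'] remains. *)
pose cc n := c' - eps1 - 2 * C * (t - s n).
pose App n (f : (P -> V) * (P -> V) * (P -> V)) :=
  nearly_isometric D sigma Ks H tau (s n) f.1.1 f.1.2 f.2 /\ bil (cc n) f.1.1.
pose Rel n (f f' : (P -> V) * (P -> V) * (P -> V)) :=
  [/\ (forall x, `|f'.1.2 x - f.1.2 x| <= C * s n /\ `|f'.2 x - f.2 x| <= C * s n),
    lip (C * s n) (fun x => f'.1.1 x - f.1.1 x),
    (forall x, `|f'.1.1 x - f.1.1 x| <= C * s n) &
    exists z, [/\ 0 < `|z|, `|z| <= C * s n ^+ 4 & s n <= C * D * `|f'.2 z - f'.2 0|]].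
have A0 : App 0%N (v, v1, v2).
  have s00 : s 0%N = t by rewrite /s /rate expr1.
  split; last by rewrite /cc s00 subrr mulr0 subr0.
  rewrite s00; split; first exact: regular_le rv.
  by move=> x; apply: le_trans (hv x) ea.
have AS n f : App n f -> exists2 f', App n.+1 f' & Rel n f f'.
  move=> [af bf].
  have Ms : M * s n <= 1 by apply: (le_trans _ Mt); rewrite ler_wpM2l // (le_trans ler01).
  have [w [w1 [w2 [aw hw [lw dw] bw ow]]]] := hit _ _ _ _ _ _ Ks1 lTs hT (sp n) Ms af.
  exists (w, w1, w2); last by split.
  split; first by rewrite /s rateS.
  have Cc : C * cc n <= 1.
    apply: (le_trans _ Cc'); rewrite ler_wpM2l ?(ltW C0) // /cc.
    have : 0 <= C * (t - s n) by rewrite mulr_ge0 ?(ltW C0) // subr_ge0.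
    by clear -e10; lra.
  apply: bil_le (bw _ Cc bf); rewrite /cc.
  have := ler_wpM2l (ltW C0) (rate_half n ht); rewrite -/(s n) -/(s n.+1).
  by clear; lra.
have [f f0 hf] := sequential_choice A0 AS.
have cc2 n : c' / 2 <= cc n.
  rewrite /cc; have := mulr_ge0 (ltW C0) (ltW (sp n)); clear -ec tc; lra.
pose B := `|G| + `|H| + 1.
have B0 : 0 <= B by rewrite !addr_ge0.
have hB x : `|tau x| <= B.
  have -> : tau x = (G + H) + (tau x - (G + H)) by rewrite addrC subrK.
  rewrite (le_trans (ler_normD _ _)) // lerD ?ler_normD // (le_trans (hT x)) //.
  by clear -s0 s1; lra.
have Ks0 : 0 <= Ks by exact: le_trans ler01 Ks1.
pose A := C * D + `|H| + 1.
have CD0 : 0 <= C * D by rewrite mulr_ge0 // ltW.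
have [||||||||||y [y1 [y2 [hy dy]]]] := @limit_immersion R t A B C (c' / 2) Ks tau
   (fun n => (f n).1.1) (fun n => (f n).1.2) (fun n => (f n).2) ht _ B0 (ltW C0) _ Ks0.
- by rewrite /A addr_ge0 // addr_ge0.
- by rewrite divr_gt0.
- by move=> n; have [[[]]] := hf n.
- move=> n x; have [[[_ hn] _] _] := hf n.
  have := hn x; set m := met _ _ x => hx.
  have -> : m - tau x = (m - (tau x - (s n / D) ^+ 2 *: H)) - (s n / D) ^+ 2 *: H.
    by clear; move: m (tau x) (_ *: H) => m' t' w; apply: sqformP => /=; ring.
  rewrite (le_trans (ler_normB _ _)) // (le_trans (lerD hx (lexx _))) //.
  rewrite (normrZ ((s n / D) ^+ 2)) (ger0_norm (sqr_ge0 _)) [X in _ + X]mulrC -mulrDl.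
  have sd : s n / D <= s n by rewrite ler_pdivrMr // ler_peMr // ltW.
  have sd0 : 0 <= s n / D by rewrite divr_ge0 // ltW.
  have sd2 : (s n / D) ^+ 2 <= s n.
    apply: (le_trans _ sd); rewrite -[leRHS]expr1 ler_wiXn2l //.
    exact: le_trans sd (le_trans (st n) t1).
  apply: ler_pM => //; rewrite ?sqr_ge0 ?addr_ge0 //; first by clear -s0; lra.
  by rewrite /A; clear -CD0 s1; lra.
- by move=> n x; have [_ []] := hf n.
- by move=> n; have [_ []] := hf n.
- by move=> n x; have [_ []] := hf n.
- by move=> n; have [[_ hn] _] := hf n; apply: bil_le hn.
- move=> n; have [_ [_ _ _ [z [z0 z4 oz]]]] := hf n; exists z; split=> //.
  by apply: (le_trans oz); rewrite ler_wpM2r // /A; have := normr_ge0 H; clear; lra.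
- exact: hB.
exists y, y1, y2; split=> // x; have := dy 0%N x; rewrite f0 /= => h.
have -> : y x - u x = (y x - v x) + (v x - u x) by rewrite addrA subrK.
rewrite (le_trans (ler_normD _ _)) // (le_trans (lerD h (dv x))) //.
by rewrite /rate expr1; clear -te eb; lra.
Qed.

End ConvexIntegration.

(** * Second differences of analytic functions *)

Section Analytic.
Variable R : realType.
Local Notation P := (R * R)%type.

Lemma pow_bound (x : R) n : `|x| <= 1 / 4 -> `|x ^+ n| <= 2^-1 ^+ n.
Proof.
by move=> hx; rewrite normrX lerXn2r ?nnegrE ?invr_ge0 //; lra.
Qed.

(** On radius 1/4 the factor [n] of the derivative of a power is absorbed by weakening the ratio 1/4
    to 1/2. *)
Lemma pow_diff (x y : R) n : `|x| <= 1 / 4 -> `|y| <= 1 / 4 ->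
  `|y ^+ n - x ^+ n| <= 4 * 2^-1 ^+ n * `|y - x|.
Proof.
move=> hx hy; elim: n => [|n IH].
  by rewrite !expr0 subrr normr0; apply: mulr_ge0 => //; lra.
have -> : y ^+ n.+1 - x ^+ n.+1 = y * (y ^+ n - x ^+ n) + (y - x) * x ^+ n by rewrite !exprS; ring.
have h1 := ler_pM (normr_ge0 _) (normr_ge0 _) hy IH.
have h2 := ler_wpM2l (normr_ge0 (y - x)) (pow_bound n hx).
rewrite -normrM in h1; rewrite -normrM in h2.
rewrite (le_trans (ler_normD _ _)) // (le_trans (lerD h1 h2)) // exprS.
by rewrite le_eqVlt; apply/orP; left; apply/eqP; field.
Qed.

(** The second difference in the directions [a] and [b]. A bound by [|a| |b|] replaces a bound on
    second derivatives and passes to pointwise limits. *)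
Definition mixed (f : P -> R) (x a b : P) := f (x + a + b) - f (x + a) - f (x + b) + f x.

Lemma mixedM (f g : P -> R) x a b : mixed (fun y => f y * g y) x a b =
  mixed f x a b * g (x + a + b) + (f (x + a) - f x) * (g (x + a + b) - g (x + a))
  + (f (x + b) - f x) * (g (x + a + b) - g (x + b)) + f x * mixed g x a b.
Proof. by rewrite /mixed; ring. Qed.

(* covers [x.1] and [x.2] at once *)
Definition affine_coordinate (X : P -> R) :=
  forall x a, X (x + a) - X x = X a /\ `|X a| <= `|a|.

Lemma mixed_pow X n x a b : affine_coordinate X ->
  `|X x| <= 1 / 4 -> `|X (x + a)| <= 1 / 4 -> `|X (x + b)| <= 1 / 4 ->
  `|X (x + a + b)| <= 1 / 4 ->
  `|mixed (fun y => X y ^+ n) x a b| <= 32 * 2^-1 ^+ n * (`|a| * `|b|).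
Proof.
move=> hX h00 h10 h01 h11; elim: n => [|n IH].
  rewrite /mixed !expr0 subrr sub0r addNr normr0.
  by apply: mulr_ge0; [lra|exact: mulr_ge0].
have -> : mixed (fun y => X y ^+ n.+1) x a b = mixed (fun y => X y ^+ n * X y) x a b.
  by rewrite /mixed !exprSr.
rewrite mixedM.
have [ea na] := hX x a; have [eb nb] := hX x b; have [eb' _] := hX (x + a) b.
have ea' : X (x + a + b) - X (x + b) = X a by rewrite addrAC; have [] := hX (x + b) a.
have -> : mixed X x a b = 0 by rewrite /mixed addrAC; move: ea' ea; lra.
rewrite mulr0 addr0 eb' ea'.
have h1 := ler_pM (normr_ge0 _) (normr_ge0 _) IH h11.
have k1 := pow_diff n h00 h10; rewrite ea in k1; have k2 := pow_diff n h00 h01; rewrite eb in k2.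
have p0 : 0 <= 4 * 2^-1 ^+ n :> R by apply: mulr_ge0 => //; apply: exprn_ge0; lra.
have h2 := ler_pM (normr_ge0 _) (normr_ge0 _) (le_trans k1 (ler_wpM2l p0 na)) nb.
have h3 := ler_pM (normr_ge0 _) (normr_ge0 _) (le_trans k2 (ler_wpM2l p0 nb)) na.
rewrite -normrM in h1; rewrite -normrM in h2; rewrite -normrM in h3.
rewrite (le_trans (ler_normD _ _)) // (le_trans (lerD (ler_normD _ _) h3)) //.
rewrite (le_trans (lerD (lerD h1 h2) (lexx _))) // exprS.
by rewrite le_eqVlt; apply/orP; left; apply/eqP; field.
Qed.

Lemma coord1_affine : affine_coordinate (fun y => y.1).
Proof. by move=> x a; split; [rewrite /=; ring|exact: norm1_le]. Qed.

Lemma coord2_affine : affine_coordinate (fun y => y.2).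
Proof. by move=> x a; split; [rewrite /=; ring|exact: norm2_le]. Qed.

Lemma coord_quarter (y : P) : `|y| <= 1 / 4 -> `|y.1| <= 1 / 4 /\ `|y.2| <= 1 / 4.
Proof. by move=> h; split; [exact: le_trans (norm1_le _) h|exact: le_trans (norm2_le _) h]. Qed.

Lemma mixed_monomial j k x a b :
  `|x| <= 1 / 4 -> `|x + a| <= 1 / 4 -> `|x + b| <= 1 / 4 -> `|x + a + b| <= 1 / 4 ->
  `|mixed (fun y => y.1 ^+ j * y.2 ^+ k) x a b| <= 96 * (2^-1 ^+ j * 2^-1 ^+ k) * (`|a| * `|b|).
Proof.
move=> /coord_quarter[x1 x2] /coord_quarter[xa1 xa2] /coord_quarter[xb1 xb2] /coord_quarter[xc1 xc2].
rewrite mixedM.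
have m1 := mixed_pow j coord1_affine x1 xa1 xb1 xc1.
have m2 := mixed_pow k coord2_affine x2 xa2 xb2 xc2.
have h1 := ler_pM (normr_ge0 _) (normr_ge0 _) m1 (pow_bound k xc2).
have h4 := ler_pM (normr_ge0 _) (normr_ge0 _) (pow_bound j x1) m2.
have p0 n : 0 <= 4 * 2^-1 ^+ n :> R by apply: mulr_ge0 => //; apply: exprn_ge0; lra.
have df (X : P -> R) n y h : affine_coordinate X -> `|X y| <= 1 / 4 -> `|X (y + h)| <= 1 / 4 ->
    `|X (y + h) ^+ n - X y ^+ n| <= 4 * 2^-1 ^+ n * `|h|.
  move=> hX k1 k2; have [e1 e2] := hX y h.
  by apply: (le_trans (pow_diff n k1 k2)); rewrite e1 ler_wpM2l.
have h2 := ler_pM (normr_ge0 _) (normr_ge0 _) (df _ j x a coord1_affine x1 xa1)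
   (df _ k (x + a) b coord2_affine xa2 xc2).
have xc2' : `|(x + b + a).2| <= 1 / 4 by rewrite addrAC.
have h3 := ler_pM (normr_ge0 _) (normr_ge0 _) (df _ j x b coord1_affine x1 xb1)
   (df _ k (x + b) a coord2_affine xb2 xc2').
rewrite (addrAC x b a) in h3.
rewrite -normrM in h1; rewrite -normrM in h2; rewrite -normrM in h3; rewrite -normrM in h4.
rewrite (le_trans (ler_normD _ _)) // (le_trans (lerD (ler_normD _ _) h4)) //.
rewrite (le_trans (lerD (lerD (ler_normD _ _) h3) (lexx _))) //.
rewrite (le_trans (lerD (lerD (lerD h1 h2) (lexx _)) (lexx _))) //.
by rewrite le_eqVlt; apply/orP; left; apply/eqP; ring.
Qed.

Lemma geometric_sum n : \sum_(i < n) 2^-1 ^+ i <= 2 :> R.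
Proof.
have -> : \sum_(i < n) 2^-1 ^+ i = 2 - 2 * 2^-1 ^+ n :> R.
  elim: n => [|n IH]; first by rewrite big_ord0 expr0; ring.
  by rewrite big_ord_recr /= IH exprS; field.
by rewrite gerBl mulr_ge0 // exprn_ge0 // invr_ge0.
Qed.

Lemma cubical_sum_le (n : nat) (F : 'I_n -> 'I_n -> 'I_n -> R) (M : R) : 0 <= M ->
  (forall i j k, `|F i j k| <= M * (2^-1 ^+ i * (2^-1 ^+ j * 2^-1 ^+ k))) ->
  `|\sum_(i < n) \sum_(j < n) \sum_(k < n) F i j k| <= 8 * M.
Proof.
move=> M0 h.
have p0 i : 0 <= 2^-1 ^+ i :> R by apply: exprn_ge0; lra.
have g := geometric_sum n.
have s1 (a : R) : 0 <= a -> \sum_(k < n) a * 2^-1 ^+ k <= a * 2 by move=> a0; rewrite -mulr_sumr ler_wpM2l.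
rewrite (le_trans (ler_norm_sum _ _ _)) //.
apply: (@le_trans _ _ (\sum_(i < n) (M * 4) * 2^-1 ^+ i)); last first.
  by apply: (le_trans (s1 _ _)); [exact: mulr_ge0|lra].
apply: ler_sum => i _; rewrite (le_trans (ler_norm_sum _ _ _)) //.
apply: (@le_trans _ _ (\sum_(j < n) (M * 2^-1 ^+ i * 2) * 2^-1 ^+ j)); last first.
  apply: (le_trans (s1 _ _)); first by rewrite !mulr_ge0.
  by rewrite le_eqVlt; apply/orP; left; apply/eqP; ring.
apply: ler_sum => j _; rewrite (le_trans (ler_norm_sum _ _ _)) //.
apply: (@le_trans _ _ (\sum_(k < n) (M * 2^-1 ^+ i * 2^-1 ^+ j) * 2^-1 ^+ k)); last first.
  apply: (le_trans (s1 _ _)); first by rewrite !mulr_ge0.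
  by rewrite le_eqVlt; apply/orP; left; apply/eqP; ring.
by apply: ler_sum => k _; apply: (le_trans (h i j k)); rewrite !mulrA.
Qed.

Lemma cvg_norm_le (w : nat -> R) (l B : R) : w @ \oo --> l -> (forall n, `|w n| <= B) -> `|l| <= B.
Proof.
move=> wl hB; apply: (ler_cvg_to (cvg_norm wl) (cvg_cst B)).
by near=> n; exact: hB.
Unshelve. all: by end_near. Qed.

(** Scaling by [rho] makes the coefficients bounded by [M]. At a quarter of the radius the estimates
    of the monomials decay geometrically, so the partial sums satisfy bounds independent of their
    length, and so does the limit; the series is not differentiated. *)
Lemma analytic_estimates (T : R) (U : set P) (g : R -> P -> R) t0 : analytic_on T U g ->
  0 <= t0 <= T -> U 0 -> exists rho C : R, [/\ 0 < rho, 0 <= C,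
    forall t x a b, 0 <= t <= T -> `|t - t0| < rho -> `|x| < rho -> `|x + a| < rho ->
      `|x + b| < rho -> `|x + a + b| < rho -> `|mixed (g t) x a b| <= C * (`|a| * `|b|) &
    forall t t' x, 0 <= t <= T -> 0 <= t' <= T -> `|t - t0| < rho -> `|t' - t0| < rho ->
      `|x| < rho -> `|g t' x - g t x| <= C * `|t' - t|].
Proof.
move=> an ht0 U0; have [c [rho [M [rho0 hc cv]]]] := an t0 0 ht0 U0.
have M0 : 0 <= M by apply: le_trans (hc 0 0 0)%N; rewrite mulr_ge0 // exprn_ge0 // ltW.
have rn : rho != 0 by rewrite gt_eqF.
pose d i j k := c i j k * rho ^+ (i + j + k).
pose Sum n (s : R) (z : P) := \sum_(i < n) \sum_(j < n) \sum_(k < n)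
  d i j k * (s ^+ i * (z.1 ^+ j * z.2 ^+ k)).
have cv' t x : 0 <= t <= T -> `|t - t0| < rho / 4 -> `|x| < rho / 4 ->
    (fun n => Sum n ((t - t0) / rho) (rho^-1 *: x)) @ \oo --> g t x.
  move=> ht hs hx; have r4 : rho / 4 <= rho by clear -rho0; lra.
  have hs' := lt_le_trans hs r4.
  have hx1 := le_lt_trans (norm1_le x) (lt_le_trans hx r4).
  have hx2 := le_lt_trans (norm2_le x) (lt_le_trans hx r4).
  have := cv (t - t0) x; rewrite add0r addrC subrK => /(_ ht hs' hx1 hx2).
  have -> : (fun n => Sum n ((t - t0) / rho) (rho^-1 *: x)) = (fun n => \sum_(i < n) \sum_(j < n)
      \sum_(k < n) c i j k * (t - t0) ^+ i * x.1 ^+ j * x.2 ^+ k); last by [].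
  apply/funext => n; rewrite /Sum.
  apply: eq_bigr => i _; apply: eq_bigr => j _; apply: eq_bigr => k _.
  rewrite /d /= /GRing.scale /= !exprD !exprMn !exprVn.
  by field; rewrite !expf_neq0.
have sc (x : P) : `|rho^-1 *: x| = `|x| / rho by rewrite pairZ_norm ?invr_ge0 ?(ltW rho0) // mulrC.
have q4 (a : R) : a < rho / 4 -> a / rho <= 1 / 4.
  by move=> h; rewrite ler_pdivrMr //; clear -h; lra.
(* 8 comes from three geometric sums, [96 / rho^2] from second differences in space, [4 / rho] from
   differences in time. *)
pose C := 8 * (M * (96 / rho ^+ 2 + 4 / rho)).
have c1 : 0 <= 96 / rho ^+ 2 by rewrite divr_ge0 // exprn_ge0 // ltW.
have c2 : 0 <= 4 / rho by rewrite divr_ge0 // ltW.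
exists (rho / 4), C; split; first by rewrite divr_gt0.
- by apply: mulr_ge0 => //; apply: mulr_ge0 => //; exact: addr_ge0.
- move=> t x a b ht hs hx hxa hxb hxc.
  set s := (t - t0) / rho; pose X := rho^-1 *: x; pose A := rho^-1 *: a; pose B := rho^-1 *: b.
  have lim : (fun n => mixed (Sum n s) X A B) @ \oo --> mixed (g t) x a b.
    have e1 : X + A = rho^-1 *: (x + a) by rewrite scalerDr.
    have e2 : X + B = rho^-1 *: (x + b) by rewrite scalerDr.
    have e3 : X + A + B = rho^-1 *: (x + a + b) by rewrite !scalerDr.
    rewrite /mixed e3 e2 e1; apply: cvgD; last exact: cv'.
    by apply: cvgB; [apply: cvgB|]; exact: cv'.
  have s4 : `|s| <= 1 / 4 by rewrite normrM normfV (gtr0_norm rho0) q4.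
  have AB : `|A| * `|B| = (`|a| * `|b|) / rho ^+ 2 by rewrite !sc; field.
  apply: (@le_trans _ _ (8 * (M * (96 * (`|A| * `|B|))))); last first.
    rewrite AB /C; have := mulr_ge0 (mulr_ge0 M0 c2) (mulr_ge0 (normr_ge0 a) (normr_ge0 b)).
    by set y := `|a| * `|b|; clear; lra.
  apply: (cvg_norm_le lim) => n.
  have -> : mixed (Sum n s) X A B = \sum_(i < n) \sum_(j < n) \sum_(k < n)
     d i j k * (s ^+ i * mixed (fun y => y.1 ^+ j * y.2 ^+ k) X A B).
    rewrite /mixed /Sum -!sumrB -big_split /=; apply: eq_bigr => i _.
    rewrite -!sumrB -big_split /=; apply: eq_bigr => j _.
    rewrite -!sumrB -big_split /=; apply: eq_bigr => k _; ring.
  apply: cubical_sum_le; first by rewrite !mulr_ge0.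
  move=> i j k.
  have X4 : `|X| <= 1 / 4 by rewrite sc q4.
  have XA4 : `|X + A| <= 1 / 4 by rewrite -scalerDr sc q4.
  have XB4 : `|X + B| <= 1 / 4 by rewrite -scalerDr sc q4.
  have XC4 : `|X + A + B| <= 1 / 4 by rewrite -!scalerDr sc q4.
  have h1 := mixed_monomial j k X4 XA4 XB4 XC4.
  have h2 := ler_pM (normr_ge0 _) (normr_ge0 _) (pow_bound i s4) h1.
  have h3 := ler_pM (normr_ge0 _) (mulr_ge0 (normr_ge0 _) (normr_ge0 _)) (_ : `|d i j k| <= M) h2.
  rewrite -!normrM in h3; apply: (le_trans (h3 _)).
    by rewrite normrM (ger0_norm (_ : 0 <= rho ^+ _)) ?exprn_ge0 // ltW.
  by rewrite le_eqVlt; apply/orP; left; apply/eqP; ring.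
move=> t t' x ht ht' hs hs' hx.
set s := (t - t0) / rho; set s' := (t' - t0) / rho; pose X := rho^-1 *: x.
have lim : (fun n => Sum n s' X - Sum n s X) @ \oo --> g t' x - g t x.
  by apply: cvgB; exact: cv'.
have s4 : `|s| <= 1 / 4 by rewrite normrM normfV (gtr0_norm rho0) q4.
have s4' : `|s'| <= 1 / 4 by rewrite normrM normfV (gtr0_norm rho0) q4.
have ss : `|s' - s| = `|t' - t| / rho.
  by rewrite -mulrBl normrM normfV (gtr0_norm rho0); congr (`|_| / _); ring.
apply: (@le_trans _ _ (8 * (M * (4 * `|s' - s|)))); last first.
  rewrite ss /C; have := mulr_ge0 (mulr_ge0 M0 c1) (normr_ge0 (t' - t)).
  by set y := `|t' - t|; clear; lra.
apply: (cvg_norm_le lim) => n.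
have -> : Sum n s' X - Sum n s X = \sum_(i < n) \sum_(j < n) \sum_(k < n)
   d i j k * ((s' ^+ i - s ^+ i) * (X.1 ^+ j * X.2 ^+ k)).
  rewrite /Sum -sumrB; apply: eq_bigr => i _.
  rewrite -sumrB; apply: eq_bigr => j _.
  rewrite -sumrB; apply: eq_bigr => k _; ring.
apply: cubical_sum_le; first by rewrite !mulr_ge0.
move=> i j k.
have /coord_quarter[x1 x2] : `|X| <= 1 / 4 by rewrite sc q4.
have h1 := ler_pM (normr_ge0 _) (normr_ge0 _) (pow_bound j x1) (pow_bound k x2).
have h2 := ler_pM (normr_ge0 _) (mulr_ge0 (normr_ge0 _) (normr_ge0 _)) (pow_diff i s4 s4') h1.
have h3 := ler_pM (normr_ge0 _) (mulr_ge0 (normr_ge0 _) (mulr_ge0 (normr_ge0 _) (normr_ge0 _)))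
  (_ : `|d i j k| <= M) h2.
rewrite -!normrM in h3; apply: (le_trans (h3 _)).
  by rewrite normrM (ger0_norm (_ : 0 <= rho ^+ _)) ?exprn_ge0 // ltW.
by rewrite le_eqVlt; apply/orP; left; apply/eqP; ring.
Qed.

End Analytic.

(** * From second differences to a Lipschitz gradient *)

Section LocalGradient.
Variable R : realType.
Local Notation P := (R * R)%type.
Local Notation V := 'rV[R]_3.

Lemma differentiable_lin (W : normedModType R) (F : P -> W) x h : differentiable F x ->
  'D_h F x = lin (pd 0 F) (pd 1 F) x h.
Proof.
move=> dF; rewrite /lin /pd !deriveE //.
have {1}-> : h = h.1 *: axis R 0 + h.2 *: axis R 1.
  case: h => h1 h2; rewrite /axis /=; congr (_, _).
    by change (h1 = h1 * 1 + h2 * 0); ring.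
  by change (h2 = h1 * 0 + h2 * 1); ring.
by rewrite linearD !linearZ.
Qed.

Lemma directional_limit (W : normedModType R) (F : P -> W) x h eps : differentiable F x -> 0 < eps ->
  exists2 d, 0 < d & forall t, 0 < t < d ->
    `|F (x + t *: h) - F x - t *: lin (pd 0 F) (pd 1 F) x h| <= eps * t.
Proof.
move=> dF e0.
have dFh : derivable F x h by exact: diff_derivable.
have := dFh; rewrite /derivable => /cvgrPdist_le /(_ _ e0).
rewrite -/(derive F x h) (differentiable_lin h dF) near_withinE => /nbhs_ballP[d /= d0 H].
exists d => // t /andP[t0 td].
have bt : ball (0 : R) d t by rewrite /ball /= sub0r normrN gtr0_norm.
have tn : t != 0 by rewrite gt_eqF.
have := H t bt tn; rewrite /= => h1.
have -> : F (x + t *: h) - F x - t *: lin (pd 0 F) (pd 1 F) x h =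
  - (t *: (lin (pd 0 F) (pd 1 F) x h - t^-1 *: (F (t *: h + x) - F x))).
  by rewrite scalerBr scalerA divff // scale1r opprB (addrC (t *: h)).
by rewrite normrN normrZ gtr0_norm // mulrC ler_wpM2r // ltW.
Qed.

Lemma half_pow_small (d : R) : 0 < d -> exists n, 2^-1 ^+ n < d.
Proof.
move=> d0; pose n := Num.Def.archi_bound (d^-1).
have hn : d^-1 < n%:R by apply: archi_boundP; rewrite invr_ge0 ltW.
exists n; rewrite exprVn invf_plt ?posrE ?exprn_gt0 //; apply: (lt_le_trans hn).
by rewrite -natrX ler_nat ltnW // ltn_expl.
Qed.

(** For the gradient, the second difference in the directions [z - x] and [t h] is divided by [t],
    and [t] tends to 0. For the remainder [E k] at [x + k h], the quantity [E (2 k) - 2 E k] is a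
    second difference; halving [k] from 1 reduces [E 1] to the scale where differentiability makes
    [E k] small compared with [k], at the cost of a geometric sum. *)
Lemma local_gradient (F : P -> V) rho C : 0 < rho -> 0 <= C ->
  (forall x, `|x| < rho -> differentiable F x) ->
  (forall x a b, `|x| < rho -> `|x + a| < rho -> `|x + b| < rho -> `|x + a + b| < rho ->
    `|F (x + a + b) - F (x + a) - F (x + b) + F x| <= C * (`|a| * `|b|)) ->
  forall x z, `|x| < rho / 4 -> `|z| < rho / 4 ->
  [/\ `|pd 0 F z - pd 0 F x| <= C * `|z - x|, `|pd 1 F z - pd 1 F x| <= C * `|z - x| &
    `|F z - F x - lin (pd 0 F) (pd 1 F) x (z - x)| <= C * `|z - x| ^+ 2].
Proof.
move=> r0 C0 dF hF x z hx hz.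
have r4 : rho / 4 <= rho by lra.
have dx := dF _ (lt_le_trans hx r4); have dz := dF _ (lt_le_trans hz r4).
have hd : `|z - x| < rho / 2.
  by apply: (le_lt_trans (ler_normB _ _)); move: hx hz; clear; lra.
have grad (h : P) : `|h| <= 1 ->
    `|lin (pd 0 F) (pd 1 F) z h - lin (pd 0 F) (pd 1 F) x h| <= C * `|z - x|.
  move=> h1; apply/ler_addgt0Pr => e e0.
  have e2 : 0 < e / 2 by rewrite divr_gt0.
  have [d1 d10 H1] := directional_limit h dx e2.
  have [d2 d20 H2] := directional_limit h dz e2.
  pose t := Num.min (Num.min d1 d2) (rho / 2) / 2.
  have t0 : 0 < t by rewrite divr_gt0 // !lt_min d10 d20 divr_gt0.
  have m1 : Num.min (Num.min d1 d2) (rho / 2) <= d1 by rewrite !ge_min lexx.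
  have m2 : Num.min (Num.min d1 d2) (rho / 2) <= d2 by rewrite !ge_min lexx orbT.
  have m3 : Num.min (Num.min d1 d2) (rho / 2) <= rho / 2 by rewrite !ge_min lexx !orbT.
  have t1 : t < d1 by move: t0 m1; rewrite /t; clear; lra.
  have t2 : t < d2 by move: t0 m2; rewrite /t; clear; lra.
  have t3 : t <= rho / 4 by move: m3; rewrite /t; clear; lra.
  clearbody t.
  have th : `|t *: h| <= t by rewrite pairZ_norm ?(ltW t0) // ler_piMr // ltW.
  have inb (y : P) : `|y| < rho / 4 -> `|y + t *: h| < rho.
    by move=> hy; apply: (le_lt_trans (ler_normD _ _)); move: th t3 hy r0; clear; lra.
  have xz : x + (z - x) = z by rewrite addrC subrK.
  have := hF x (z - x) (t *: h) (lt_le_trans hx r4); rewrite xz.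
  move=> /(_ (lt_le_trans hz r4) (inb _ hx) (inb _ hz)) h4.
  have h5 := H1 t; rewrite t0 t1 in h5; have {}h5 := h5 isT.
  have h6 := H2 t; rewrite t0 t2 in h6; have {}h6 := h6 isT.
  rewrite -(ler_pM2r t0) -{1}(gtr0_norm t0) mulrC -normrZ.
  set lz := lin _ _ z h in h6 *; set lx := lin _ _ x h in h5 *; clearbody lz lx.
  have -> : t *: (lz - lx) = (F (z + t *: h) - F z - F (x + t *: h) + F x)
    - (F (z + t *: h) - F z - t *: lz) + (F (x + t *: h) - F x - t *: lx).
    by apply: row3P; rewrite !mxE; ring.
  rewrite (le_trans (ler_normD _ _)) // (le_trans (lerD (ler_normB _ _) h5)) //.
  rewrite (le_trans (lerD (lerD h4 h6) (lexx _))) //.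
  have := ler_wpM2l (mulr_ge0 C0 (normr_ge0 (z - x))) th.
  by clear; lra.
have ax (i : 'I_2) : `|axis R i| <= 1.
  by rewrite /axis; case: ifP => _; apply: pair_norm_le; rewrite /= ?normr1 ?normr0.
have lin0 y : lin (pd 0 F) (pd 1 F) y (axis R 0) = pd 0 F y.
  by rewrite /lin /axis /= scale1r scale0r addr0.
have lin1 y : lin (pd 0 F) (pd 1 F) y (axis R 1) = pd 1 F y.
  by rewrite /lin /axis /= scale1r scale0r add0r.
split; [by rewrite -!lin0; apply: grad|by rewrite -!lin1; apply: grad|].
apply/ler_addgt0Pr => e e0; set h := z - x.
have [d d0 H] := directional_limit h dx e0.
have [n hn] := half_pow_small d0.
set l := lin _ _ x h in H *.
pose E t := F (x + t *: h) - F x - t *: l.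
have E1 : F z - F x - l = E 1 by rewrite /E !scale1r /h (addrC x) subrK.
pose k0 m : R := 2^-1 ^+ m.
have k0p m : 0 < k0 m by rewrite exprn_gt0 // invr_gt0.
have k01 m : k0 m <= 1 by rewrite exprn_ile1 // ?invr_ge0 //; lra.
have kS m : k0 m = 2 * k0 m.+1 by rewrite /k0 exprS; field.
have inb m : `|x + k0 m *: h| < rho.
  apply: (le_lt_trans (ler_normD _ _)); rewrite pairZ_norm ?(ltW (k0p m)) //.
  have := ler_wpM2r (normr_ge0 h) (k01 m); move: hx hd; rewrite -/h; clear -r0; lra.
have dbl m : `|E (k0 m)| <= 2 * `|E (k0 m.+1)| + C * (k0 m.+1 ^+ 2 * `|h| ^+ 2).
  have xx : x + k0 m.+1 *: h + k0 m.+1 *: h = x + k0 m *: h.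
    by rewrite -addrA -scalerDl; congr (_ + _ *: _); rewrite (kS m); ring.
  have := hF x (k0 m.+1 *: h) (k0 m.+1 *: h) (lt_le_trans hx r4) (inb _) (inb _).
  rewrite xx => /(_ (inb _)) h1.
  have -> : E (k0 m) = 2 *: E (k0 m.+1) +
    (F (x + k0 m *: h) - F (x + k0 m.+1 *: h) - F (x + k0 m.+1 *: h) + F x).
    rewrite /E {2}(kS m).
    move: (F (x + k0 m *: h)) (F (x + k0 m.+1 *: h)) (F x) (k0 m.+1) => f1 f2 f3 k.
    generalize l => l'; clear.
    by apply: row3P; rewrite !mxE; ring.
  rewrite (le_trans (ler_normD _ _)) // normrZ ger0_norm // lerD2l.
  apply: (le_trans h1); rewrite pairZ_norm ?(ltW (k0p _)) //.
  by rewrite le_eqVlt; apply/orP; left; apply/eqP; ring.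
have it m : k0 m * `|E 1| <= `|E (k0 m)| + k0 m * (C * `|h| ^+ 2 * ((1 - k0 m) / 2)).
  elim: m => [|m IH]; first by rewrite /k0 expr0 subrr; lra.
  have := dbl m; move: IH; rewrite (kS m); set k := k0 m.+1.
  by clear; lra.
have kd : 0 < k0 n < d by rewrite k0p.
have := it n; have := H _ kd; rewrite -/(E (k0 n)) E1 => h1 h2.
rewrite -(ler_pM2l (k0p n)).
have : 0 <= k0 n * (C * `|h| ^+ 2 * ((1 + k0 n) / 2)).
  apply: mulr_ge0; first exact: ltW.
  by apply: mulr_ge0; [rewrite mulr_ge0 // sqr_ge0|have := k0p n; clear; lra].
by move: h1 h2; clear; lra.
Qed.

End LocalGradient.

(** * Extension of a local map to the plane *)

Section Extension.
Variable R : realType.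
Local Notation P := (R * R)%type.
Local Notation V := 'rV[R]_3.

Definition pos_part (s : R) : R := Num.max s 0.

Lemma pos_partP s : (0 <= s /\ pos_part s = s) \/ (s <= 0 /\ pos_part s = 0).
Proof.
by rewrite /pos_part; case: (leP 0 s) => h; [left|right; split => //; exact: ltW].
Qed.

Lemma pos_part_lip s t : `|pos_part t - pos_part s| <= `|t - s|.
Proof.
have := ler_norm (t - s); have := ler_norm (- (t - s)); rewrite normrN.
by case: (pos_partP s) => -[hs ->]; case: (pos_partP t) => -[ht ->]; rewrite ler_norml; lra.
Qed.

Lemma pos_part_tay s t :
  `|pos_part t ^+ 2 - pos_part s ^+ 2 - 2 * pos_part s * (t - s)| <= `|t - s| ^+ 2.
Proof.
rewrite real_normK ?num_real //.
have k1 := sqr_ge0 s; have k2 := sqr_ge0 t; have k3 := sqr_ge0 (t - s).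
have kp : 0 <= s -> t <= 0 -> 0 <= s * - t by move=> *; rewrite mulr_ge0 // oppr_ge0.
have kn : s <= 0 -> 0 <= t -> 0 <= t * - s by move=> *; rewrite mulr_ge0 // oppr_ge0.
by case: (pos_partP s) => -[hs ->]; case: (pos_partP t) => -[ht ->];
   try have := kp hs ht; try have := kn hs ht; rewrite ler_norml; lra.
Qed.

(* [truncate r] is the identity on [-r, r], constant outside [-3 r, 3 r] and  *)
(* of class C^{1,1}.                                                           *)
Definition truncate r s : R :=
  s - (pos_part (s - r) ^+ 2 - pos_part (s - 3 * r) ^+ 2
       - pos_part (- s - r) ^+ 2 + pos_part (- s - 3 * r) ^+ 2) / (4 * r).

(** The slope of [truncate r]: 1 on [-r, r], then decreasing linearly to 0 at distance [3 r]. *)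
Definition dtruncate r s : R :=
  1 - (pos_part (s - r) - pos_part (s - 3 * r)
       + pos_part (- s - r) - pos_part (- s - 3 * r)) / (2 * r).

Lemma truncate_id r s : 0 < r -> `|s| <= r -> truncate r s = s.
Proof.
move=> r0; rewrite ler_norml /truncate => hs.
have z t : t <= 0 -> pos_part t = 0 by move=> t0; rewrite /pos_part max_r.
by rewrite !z; [ring|lra..].
Qed.

Lemma truncate_cases r s : 0 < r -> `|truncate r s| <= 2 * r /\ 0 <= dtruncate r s <= 1.
Proof.
move=> r0; have rn : r != 0 by rewrite gt_eqF.
have i4 : 0 < 4 * r by lra.
have key N M : 4 * r * truncate r s = N -> 2 * r * dtruncate r s = M ->
    `|N| <= 8 * r ^+ 2 -> 0 <= M <= 2 * r -> `|truncate r s| <= 2 * r /\ 0 <= dtruncate r s <= 1.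
  move=> hN hM bN /andP[M0 M1]; split.
    rewrite -(ler_pM2l i4) -{1}(gtr0_norm i4) -normrM hN; apply: (le_trans bN).
    by rewrite le_eqVlt; apply/orP; left; apply/eqP; ring.
  have i2 : 0 < 2 * r by lra.
  by apply/andP; split; rewrite -(ler_pM2l i2) hM ?mulr0 ?mulr1.
have e1 : 4 * r * truncate r s = 4 * r * s - (pos_part (s - r) ^+ 2 - pos_part (s - 3 * r) ^+ 2
       - pos_part (- s - r) ^+ 2 + pos_part (- s - 3 * r) ^+ 2) by rewrite /truncate; field.
have e2 : 2 * r * dtruncate r s = 2 * r - (pos_part (s - r) - pos_part (s - 3 * r)
       + pos_part (- s - r) - pos_part (- s - 3 * r)) by rewrite /dtruncate; field.
apply: (key _ _ e1 e2); [rewrite ler_norml|]; clear key e1 e2 rn i4;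
by case: (pos_partP (s - r)) => -[h1 ->]; case: (pos_partP (s - 3 * r)) => -[h2 ->];
   case: (pos_partP (- s - r)) => -[h3 ->]; case: (pos_partP (- s - 3 * r)) => -[h4 ->];
   apply/andP; split; try lra; nra.
Qed.

Lemma truncate_tay r s t : 0 < r ->
  `|truncate r t - truncate r s - dtruncate r s * (t - s)| <= r^-1 * `|t - s| ^+ 2.
Proof.
move=> r0; have rn : r != 0 by rewrite gt_eqF.
have t1 := pos_part_tay (s - r) (t - r).
have t2 := pos_part_tay (s - 3 * r) (t - 3 * r).
have t3 := pos_part_tay (- s - r) (- t - r).
have t4 := pos_part_tay (- s - 3 * r) (- t - 3 * r).
have d1 : t - r - (s - r) = t - s by ring.
have d2 : t - 3 * r - (s - 3 * r) = t - s by ring.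
have d3 : - t - r - (- s - r) = - (t - s) by ring.
have d4 : - t - 3 * r - (- s - 3 * r) = - (t - s) by ring.
rewrite d1 in t1; rewrite d2 in t2; rewrite d3 normrN in t3; rewrite d4 normrN in t4.
rewrite -(ler_pM2l (_ : 0 < 4 * r)); last by lra.
have r40 : 0 <= 4 * r by lra.
rewrite -{1}(ger0_norm r40) -normrM.
have -> : 4 * r * (r^-1 * `|t - s| ^+ 2) = 4 * `|t - s| ^+ 2 by field.
have -> : 4 * r * (truncate r t - truncate r s - dtruncate r s * (t - s)) =
   - (pos_part (t - r) ^+ 2 - pos_part (s - r) ^+ 2 - 2 * pos_part (s - r) * (t - s))
   + (pos_part (t - 3 * r) ^+ 2 - pos_part (s - 3 * r) ^+ 2 - 2 * pos_part (s - 3 * r) * (t - s))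
   + (pos_part (- t - r) ^+ 2 - pos_part (- s - r) ^+ 2 - 2 * pos_part (- s - r) * (- (t - s)))
   - (pos_part (- t - 3 * r) ^+ 2 - pos_part (- s - 3 * r) ^+ 2
      - 2 * pos_part (- s - 3 * r) * (- (t - s))) by rewrite /truncate /dtruncate; field.
rewrite (le_trans (ler_normB _ _)) // (le_trans (lerD (ler_normD _ _) t4)) //.
rewrite (le_trans (lerD (lerD (ler_normD _ _) t3) (lexx _))) // normrN.
by apply: (le_trans (lerD (lerD (lerD t1 t2) (lexx _)) (lexx _))); clear; lra.
Qed.

Lemma dtruncate_lip r s t : 0 < r -> `|dtruncate r t - dtruncate r s| <= 2 * r^-1 * `|t - s|.
Proof.
move=> r0; have rn : r != 0 by rewrite gt_eqF.
have t1 := pos_part_lip (s - r) (t - r).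
have t2 := pos_part_lip (s - 3 * r) (t - 3 * r).
have t3 := pos_part_lip (- s - r) (- t - r).
have t4 := pos_part_lip (- s - 3 * r) (- t - 3 * r).
have d1 : t - r - (s - r) = t - s by ring.
have d2 : t - 3 * r - (s - 3 * r) = t - s by ring.
have d3 : - t - r - (- s - r) = - (t - s) by ring.
have d4 : - t - 3 * r - (- s - 3 * r) = - (t - s) by ring.
rewrite d1 in t1; rewrite d2 in t2; rewrite d3 normrN in t3; rewrite d4 normrN in t4.
rewrite -(ler_pM2l (_ : 0 < 2 * r)); last by lra.
have r20 : 0 <= 2 * r by lra.
rewrite -{1}(ger0_norm r20) -normrM.
have -> : 2 * r * (2 * r^-1 * `|t - s|) = 4 * `|t - s| by field.
have -> : 2 * r * (dtruncate r t - dtruncate r s) =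
   - (pos_part (t - r) - pos_part (s - r)) + (pos_part (t - 3 * r) - pos_part (s - 3 * r))
   - (pos_part (- t - r) - pos_part (- s - r))
   + (pos_part (- t - 3 * r) - pos_part (- s - 3 * r)) by rewrite /dtruncate; field.
rewrite (le_trans (ler_normD _ _)) // (le_trans (lerD (ler_normB _ _) t4)) //.
rewrite (le_trans (lerD (lerD (ler_normD _ _) t3) (lexx _))) // normrN.
by apply: (le_trans (lerD (lerD (lerD t1 t2) (lexx _)) (lexx _))); clear; lra.
Qed.

Lemma truncate_lip r s t : 0 < r -> `|truncate r t - truncate r s| <= 4 * `|t - s|.
Proof.
move=> r0; have [b1 /andP[d0 d1]] := truncate_cases s r0; have [b2 _] := truncate_cases t r0.
case: (leP `|t - s| r) => h.
  have := truncate_tay s t r0; set E := _ - _ - _ => hE.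
  have -> : truncate r t - truncate r s = E + dtruncate r s * (t - s) by rewrite /E; ring.
  rewrite (le_trans (ler_normD _ _)) // normrM (ger0_norm d0).
  have h1 : r^-1 * `|t - s| ^+ 2 <= `|t - s|.
    by rewrite mulrC ler_pdivrMr // expr2 ler_wpM2l.
  have := ler_wpM2r (normr_ge0 (t - s)) d1; have := normr_ge0 (t - s).
  by move: (le_trans hE h1); clear; lra.
rewrite (le_trans (ler_normB _ _)) // (le_trans (lerD b2 b1)) //; clear -h; lra.
Qed.

Definition truncate2 r (x : P) : P := (truncate r x.1, truncate r x.2).

Lemma truncate2_le r x : 0 < r -> `|truncate2 r x| <= 2 * r.
Proof.
move=> r0; apply: pair_norm_le; first by case: (truncate_cases x.1 r0).
by case: (truncate_cases x.2 r0).
Qed.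

Lemma truncate2_id r x : 0 < r -> `|x| <= r -> truncate2 r x = x.
Proof.
move=> r0 hx; rewrite /truncate2 (truncate_id r0 (le_trans (norm1_le x) hx)).
by rewrite (truncate_id r0 (le_trans (norm2_le x) hx)); case: x hx.
Qed.

Lemma truncate2_lip r x z : 0 < r -> `|truncate2 r z - truncate2 r x| <= 4 * `|z - x|.
Proof.
move=> r0; apply: pair_norm_le => /=; apply: (le_trans (truncate_lip _ _ r0)); rewrite ler_wpM2l //.
  exact: norm1_le (z - x).
exact: norm2_le (z - x).
Qed.

(** Composing with the truncation [phi] alone would kill the gradient far away, so the linear part
    at 0 is added on [x - phi x]. The first partial derivative is then [p 0] plus a slope in [0, 1]
    times [p (phi x) - p 0], hence stays within [2 C r] of [p 0]; likewise the second. *)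
Lemma extension (F p q : P -> V) rho C r : 0 <= C -> 0 < r -> 2 * r < rho ->
  (forall x z, `|x| < rho -> `|z| < rho -> [/\ `|p z - p x| <= C * `|z - x|,
     `|q z - q x| <= C * `|z - x| & `|F z - F x - lin p q x (z - x)| <= C * `|z - x| ^+ 2]) ->
  exists u p' q', [/\ regular (20 * C) u p' q', forall x, `|x| <= r -> u x = F x,
    forall x, `|p' x - p 0| <= 2 * C * r /\ `|q' x - q 0| <= 2 * C * r &
    forall x z, `|u z - u x - lin p q 0 (z - x)| <= 32 * C * r * `|z - x|].
Proof.
move=> C0 r0 r2 h; pose phi := truncate2 r.
have phib x : `|phi x| <= 2 * r by exact: truncate2_le.
have phir x : `|phi x| < rho by apply: le_lt_trans (phib x) r2.
have zr : `|0 : P| < rho by rewrite normr0; lra.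
pose g1 y := p y - p 0; pose g2 y := q y - q 0.
have g1b x : `|g1 (phi x)| <= 2 * C * r.
  have [k1 _ _] := h _ _ zr (phir x); apply: (le_trans k1); rewrite subr0.
  by have := ler_wpM2l C0 (phib x); clear; lra.
have g2b x : `|g2 (phi x)| <= 2 * C * r.
  have [_ k2 _] := h _ _ zr (phir x); apply: (le_trans k2); rewrite subr0.
  by have := ler_wpM2l C0 (phib x); clear; lra.
have rn : r != 0 by rewrite gt_eqF.
have rp : 0 <= r^-1 by rewrite invr_ge0 ltW.
have Cr : 0 <= 2 * C * r by rewrite !mulr_ge0 // ltW.
have main x z : `|F (phi z) - F (phi x) - lin p q (phi x) (phi z - phi x)| <= 16 * C * `|z - x| ^+ 2.
  have [_ _ k3] := h _ _ (phir x) (phir z); apply: (le_trans k3).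
  have := truncate2_lip x z r0; rewrite -/(phi z) -/(phi x) => k4.
  have : `|phi z - phi x| ^+ 2 <= (4 * `|z - x|) ^+ 2 by rewrite lerXn2r ?nnegrE ?mulr_ge0.
  by move/(ler_wpM2l C0); rewrite exprMn; clear; lra.
have dl x z i : `|i| <= `|z - x| -> 2 * r^-1 * i <= 2 * r^-1 * `|z - x|.
  by move=> k; rewrite ler_wpM2l ?mulr_ge0 // (le_trans (ler_norm _)).
have lipg (s : P -> R) (f g : P -> V) : (forall x z, `|dtruncate r (s z) - dtruncate r (s x)|
      <= 2 * r^-1 * `|z - x|) -> (forall x, `|g (phi x)| <= 2 * C * r) ->
     (forall x z, `|g (phi z) - g (phi x)| <= C * `|phi z - phi x|) ->
     lip (20 * C) (fun x => f 0 + dtruncate r (s x) *: g (phi x)).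
  move=> hs hg hl x z.
  have -> : f 0 + dtruncate r (s z) *: g (phi z) - (f 0 + dtruncate r (s x) *: g (phi x)) =
    dtruncate r (s z) *: (g (phi z) - g (phi x)) +
    (dtruncate r (s z) - dtruncate r (s x)) *: g (phi x).
    by apply: row3P; rewrite !mxE; ring.
  rewrite (le_trans (ler_normD _ _)) // !normrZ.
  have [_ /andP[a0 a1]] := truncate_cases (s z) r0.
  have k1 : `|g (phi z) - g (phi x)| <= 4 * C * `|z - x|.
    apply: (le_trans (hl x z)); have := ler_wpM2l C0 (truncate2_lip x z r0).
    by rewrite -/(phi z) -/(phi x); clear; lra.
  have k2 : `|dtruncate r (s z)| <= 1 by rewrite ger0_norm.
  have k3 := ler_pM (normr_ge0 _) (normr_ge0 _) k2 k1.
  have k4 := ler_pM (normr_ge0 _) (normr_ge0 _) (hs x z) (hg x).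
  apply: (le_trans (lerD k3 k4)).
  have -> : 2 * r^-1 * `|z - x| * (2 * C * r) = 4 * C * `|z - x| by field.
  by have := mulr_ge0 C0 (normr_ge0 (z - x)); clear; lra.
exists (fun x => F (phi x) + lin p q 0 (x - phi x)),
  (fun x => p 0 + dtruncate r x.1 *: g1 (phi x)), (fun x => q 0 + dtruncate r x.2 *: g2 (phi x)).
split.
- split; last first.
  + apply: (lipg (fun x => x.2)) => // x z.
      by apply: (le_trans (dtruncate_lip _ _ r0)); rewrite dl // normr_id; exact: norm2_le (z - x).
    have [_ k2 _] := h _ _ (phir x) (phir z); rewrite /g2 opprB addrA subrK; exact: k2.
  + apply: (lipg (fun x => x.1)) => // x z.
      by apply: (le_trans (dtruncate_lip _ _ r0)); rewrite dl // normr_id; exact: norm1_le (z - x).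
    have [k1 _ _] := h _ _ (phir x) (phir z); rewrite /g1 opprB addrA subrK; exact: k1.
  move=> x z.
  pose e1 := truncate r z.1 - truncate r x.1 - dtruncate r x.1 * (z.1 - x.1).
  pose e2 := truncate r z.2 - truncate r x.2 - dtruncate r x.2 * (z.2 - x.2).
  set E := (X in `|X| <= _).
  have -> : E = (F (phi z) - F (phi x) - lin p q (phi x) (phi z - phi x)) +
    (e1 *: g1 (phi x) + e2 *: g2 (phi x)).
    rewrite /E /e1 /e2 /g1 /g2 /lin /=; move: (F (phi z)) (F (phi x)) (p (phi x)) (q (phi x)).
    move: (dtruncate _ _) (dtruncate _ _) (truncate r z.1) (truncate r z.2) (truncate r x.1) (truncate r x.2).
    by clear; move=> *; apply: row3P; rewrite !mxE; ring.
  have q1 : `|e1| <= r^-1 * `|z - x| ^+ 2.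
    apply: (le_trans (truncate_tay _ _ r0)); rewrite ler_wpM2l // lerXn2r ?nnegrE //.
    exact: norm1_le (z - x).
  have q2 : `|e2| <= r^-1 * `|z - x| ^+ 2.
    apply: (le_trans (truncate_tay _ _ r0)); rewrite ler_wpM2l // lerXn2r ?nnegrE //.
    exact: norm2_le (z - x).
  have k1 := ler_pM (normr_ge0 _) (normr_ge0 _) q1 (g1b x).
  have k2 := ler_pM (normr_ge0 _) (normr_ge0 _) q2 (g2b x).
  rewrite -normrZ in k1; rewrite -normrZ in k2.
  rewrite (le_trans (ler_normD _ _)) // (le_trans (lerD (main x z) (ler_normD _ _))) //.
  apply: (le_trans (lerD (lexx _) (lerD k1 k2))).
  have -> : r^-1 * `|z - x| ^+ 2 * (2 * C * r) = 2 * C * `|z - x| ^+ 2 by field.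
  by clear; lra.
- by move=> x hx; rewrite /phi truncate2_id // subrr /lin /= !scale0r !addr0.
- have fin (s : R) (f g : V) : `|g| <= 2 * C * r -> `|f + dtruncate r s *: g - f| <= 2 * C * r.
    move=> hg; rewrite addrAC subrr add0r normrZ; have [_ /andP[a0 a1]] := truncate_cases s r0.
    by rewrite ger0_norm // (le_trans _ hg) // ler_piMl.
  by move=> x; split; apply: fin.
move=> x z; set E := (X in `|X| <= _).
have -> : E = (F (phi z) - F (phi x) - lin p q (phi x) (phi z - phi x)) +
    lin g1 g2 (phi x) (phi z - phi x).
  rewrite /E /g1 /g2 /lin /=; move: (F (phi z)) (F (phi x)) (p (phi x)) (q (phi x)).
  move: (truncate r z.1) (truncate r z.2) (truncate r x.1) (truncate r x.2).
  by clear; move=> *; apply: row3P; rewrite !mxE; ring.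
have [_ _ k3] := h _ _ (phir x) (phir z).
have k4 := truncate2_lip x z r0; rewrite -/(phi z) -/(phi x) in k4.
have k5 : `|phi z - phi x| <= 4 * r.
  by rewrite (le_trans (ler_normB _ _)) // (le_trans (lerD (phib z) (phib x))) //; clear; lra.
have k6 : `|lin g1 g2 (phi x) (phi z - phi x)| <= 2 * (2 * C * r) * `|phi z - phi x|.
  exact: lin_le.
rewrite (le_trans (ler_normD _ _)) // (le_trans (lerD k3 k6)) //.
have k7 := ler_pM (normr_ge0 _) (normr_ge0 _) k5 k4.
have Crr : 0 <= C * r by rewrite mulr_ge0 // ltW.
by have := ler_wpM2l C0 k7; have := ler_wpM2l Crr k4; clear; lra.
Qed.

End Extension.

(** * Lipschitz continuity of the target metric near the origin *)

Section Target.
Variable R : realType.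
Local Notation P := (R * R)%type.
Local Notation mu := (@lebesgue_measure R).

Section Primitive.
Variables (f : R -> R) (d M : R).
Hypothesis fc : forall s, - d <= s <= d -> {for s, continuous f}.
Hypothesis fM : forall s, - d <= s <= d -> 0 <= f s <= M.

Let I (a b : R) := Rintegral mu `[a, b] f.

Let f_integrable a b : - d <= a -> b <= d -> mu.-integrable `[a, b] (EFin \o f).
Proof.
move=> ha hb; apply: continuous_compact_integrable; first exact: segment_compact.
apply: continuous_in_subspaceT => s; rewrite inE /= in_itv /= => /andP[h1 h2]; apply: fc.
by rewrite (le_trans ha h1) (le_trans h2 hb).
Qed.

Let I_bounds a b : - d <= a -> a <= b -> b <= d -> 0 <= I a b <= M * (b - a).
Proof.
move=> ha ab hb; have hs s : `[a, b]%classic s -> - d <= s <= d.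
  by rewrite /= in_itv /= => /andP[h1 h2]; rewrite (le_trans ha h1) (le_trans h2 hb).
have mc : mu.-integrable `[a, b] (EFin \o cst M).
  apply: continuous_compact_integrable; first exact: segment_compact.
  by apply: continuous_subspaceT => s; exact: cvg_cst.
rewrite /I Rintegral_ge0 /=; last by move=> s /hs /fM /andP[].
have -> : M * (b - a) = Rintegral mu `[a, b] (cst M).
  have -> : Rintegral mu `[a, b] (cst M) = M * fine (lebesgue_measure `[a, b]%classic).
    exact: Rintegral_cst.
  rewrite lebesgue_measure_itv /= lte_fin.
  case: (ltP a b) => h; first by [].
  have -> : b = a by apply/eqP; rewrite eq_le ab h.
  by rewrite subrr.
apply: le_Rintegral => //; first exact: f_integrable.
by move=> s /hs /fM /andP[].
Qed.

Let I_add a x b : - d <= a -> a <= x -> x <= b -> b <= d -> I a b = I a x + I x b.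
Proof.
move=> ha ax xb hb.
have := @Rintegral_itvB R f (BLeft a) (BRight b) x (f_integrable ha hb).
rewrite !bnd_simp => /(_ ax xb) h.
have e : Rintegral mu `]x, b] f = I x b.
  rewrite /I -Rintegral_itv_obnd_cbnd //.
  apply: integrableS (f_integrable ha hb) => // s; rewrite /= !in_itv /= => /andP[h1 ->].
  by rewrite (le_trans ax (ltW h1)).
by rewrite -e -h /I addrC subrK.
Qed.

Lemma oint_lip s t : `|s| <= d -> `|t| <= d -> `|oint f 0 t - oint f 0 s| <= M * `|t - s|.
Proof.
have main a b : - d <= a -> a <= b -> b <= d -> `|oint f 0 b - oint f 0 a| <= M * `|b - a|.
  move=> ha ab hb; have d0 : - d <= 0 <= d by move: ha ab hb; lra.
  have /andP[d1 d2] := d0.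
  suff -> : oint f 0 b - oint f 0 a = I a b.
    have /andP[i1 i2] := I_bounds ha ab hb.
    by rewrite ger0_norm // ger0_norm // subr_ge0.
  have I0 : I 0 0 = 0 by rewrite /I set_itv1 Rintegral_set1.
  rewrite /oint -/(I 0 b) -/(I 0 a) -/(I b 0) -/(I a 0).
  case: leP => h1; case: leP => h2.
  - by rewrite (@I_add 0 a b) //; ring.
  - by rewrite (@I_add a 0 b) //; [ring|exact: ltW].
  - by exfalso; move: h1 h2 ab; lra.
  - by rewrite (@I_add a b 0) //; [ring|exact: ltW].
move=> hs ht; move: (hs) (ht); rewrite (ler_norml s) (ler_norml t) => /andP[s1 s2] /andP[t1 t2].
case: (leP s t) => st; first exact: main.
by rewrite distrC (distrC t) main // ltW.
Qed.

End Primitive.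

(** On this interval [cos] is at least 1/2, and [tan b - tan a = sin (b - a) / (cos a cos b)]. *)
Lemma tan_lip (a b : R) : `|a| <= 1 / 2 -> `|b| <= 1 / 2 ->
  `|tan b - tan a| <= 4 * `|b - a| /\ `|tan a| <= 2.
Proof.
have hc (x : R) : `|x| <= 1 / 2 -> 1 / 2 <= cos x.
  by move=> hx; have := cos_lip 0 x; rewrite cos0 subr0 ler_norml; move: hx; lra.
move=> /[dup] ha /hc ca /hc cb.
have a0 : cos a != 0 by rewrite gt_eqF //; lra.
have b0 : cos b != 0 by rewrite gt_eqF //; lra.
have inv (x : R) : 1 / 2 <= x -> `|x^-1| <= 2.
  move=> hx; rewrite gtr0_norm ?invr_gt0; last by lra.
  by rewrite -[leRHS]invrK lef_pV2 ?posrE ?invr_gt0 //; lra.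
split.
  have -> : tan b - tan a = sin (b - a) * (cos b)^-1 * (cos a)^-1.
    by rewrite sinB /tan; field; rewrite a0.
  have h1 : `|sin (b - a)| <= `|b - a| by have := sin_lip 0 (b - a); rewrite sin0 !subr0.
  have h2 := ler_pM (normr_ge0 _) (normr_ge0 _) h1 (inv _ cb).
  have h3 := ler_pM (mulr_ge0 (normr_ge0 _) (normr_ge0 _)) (normr_ge0 _) h2 (inv _ ca).
  by rewrite !normrM; apply: (le_trans h3); lra.
rewrite /tan normrM; have := ler_pM (normr_ge0 _) (normr_ge0 _) (sin_max a) (inv _ ca).
by rewrite mul1r.
Qed.

Lemma fprime_sqr_lip (A delta : R) (ubar : R -> R) : 1 < A -> shear_profile A delta ubar ->
  0 < delta -> exists rho L : R, [/\ 0 < rho, 0 <= L & forall s t, `|s| <= rho -> `|t| <= rho ->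
    `|fprime A ubar t ^+ 2 - fprime A ubar s ^+ 2| <= L * `|t - s|].
Proof.
move=> A1 sh d0; pose f s := ubar s ^+ 2; pose d := delta / 2.
have dd : - d <= d by rewrite /d; lra.
have fc s : - d <= s <= d -> {for s, continuous f}.
  move=> hs; have hs' : `|s| < delta by rewrite ltr_norml; rewrite /d in hs; lra.
  have [h _] := sh s hs'; have := h 0%N; rewrite derive1n0 => /derivable1_diffP /differentiable_continuous uc.
  exact: (continuousM uc uc).
have [c _ hc] : exists2 c, c \in `[- d, d] & forall t, t \in `[- d, d] -> f t <= f c.
  apply: EVT_max => //; apply: continuous_in_subspaceT => s; rewrite inE /= in_itv /=; exact: fc.
pose M := f c; have M0 : 0 <= M by exact: sqr_ge0.
have fM s : - d <= s <= d -> 0 <= f s <= M.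
  by move=> hs; rewrite sqr_ge0 /= hc // in_itv.
have A0 : 0 < A by lra.
have AM : 0 <= A * M by rewrite mulr_ge0 // ltW.
(* Keeps the argument of the tangent within the interval of [tan_lip]. *)
pose rho := Num.min d (1 / 2 / (A * M + 1)).
have rho0 : 0 < rho by rewrite lt_min !divr_gt0 //; lra.
have rhod : rho <= d by rewrite ge_min lexx.
have rhoM : (A * M) * rho <= 1 / 2.
  have : rho <= 1 / 2 / (A * M + 1) by rewrite ge_min lexx orbT.
  by rewrite ler_pdivlMr; [lra|lra].
exists rho, (16 * A ^+ 3 * M); split=> //.
  by apply: mulr_ge0 => //; apply: mulr_ge0 => //; rewrite exprn_ge0 // ltW.
move=> s t hs ht; pose J s := - A * oint f 0 s.
have Jlip x y : `|x| <= rho -> `|y| <= rho -> `|J y - J x| <= A * M * `|y - x|.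
  move=> hx hy; have -> : J y - J x = - (A * (oint f 0 y - oint f 0 x)) by rewrite /J; ring.
  have -> : A * M * `|y - x| = A * (M * `|y - x|) by ring.
  rewrite normrN normrM (gtr0_norm A0) ler_wpM2l ?(ltW A0) //.
  by apply: (oint_lip fc fM); [exact: le_trans hx rhod|exact: le_trans hy rhod].
have J0 : J 0 = 0.
  by rewrite /J /oint lexx set_itv1 Rintegral_set1 mulr0.
have Jb x : `|x| <= rho -> `|J x| <= 1 / 2.
  move=> hx; have r0 : `|0 : R| <= rho by rewrite normr0 ltW.
  have := Jlip 0 x r0 hx; rewrite J0 !subr0 => h.
  by apply: (le_trans h); apply: (le_trans _ rhoM); rewrite ler_wpM2l.
have [t1 b1] := tan_lip (Jb s hs) (Jb t ht); have [_ b2] := tan_lip (Jb t ht) (Jb s hs).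
have e x : fprime A ubar x = A * tan (J x) by [].
rewrite !e; have -> : (A * tan (J t)) ^+ 2 - (A * tan (J s)) ^+ 2 =
  A ^+ 2 * ((tan (J t) - tan (J s)) * (tan (J t) + tan (J s))) by ring.
rewrite normrM (ger0_norm (sqr_ge0 A)) normrM.
have {e} h1 : `|tan (J t) + tan (J s)| <= 4 by rewrite (le_trans (ler_normD _ _)) //; clear -b1 b2; lra.
have h2 := ler_pM (normr_ge0 _) (normr_ge0 _) (le_trans t1 (ler_wpM2l (ler0n R 4) (Jlip _ _ hs ht))) h1.
by apply: (le_trans (ler_wpM2l (sqr_ge0 A) h2)); clear; lra.
Qed.

End Target.

(** * Isometric approximations at all times close to a given one *)

Section NearTime.
Variable R : realType.
Local Notation P := (R * R)%type.
Local Notation V := 'rV[R]_3.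
Local Notation sqform := (sqform R).

Definition gform (A : R) (ubar : R -> R) (x : P) : sqform :=
  (A ^+ 2, 0, fprime A ubar x.2 ^+ 2 + A ^+ 2).

Definition qform (a : sqform) (s t : R) : R := s ^+ 2 * a.1.1 + 2 * s * t * a.1.2 + t ^+ 2 * a.2.

(** At the vector [(- a.1.2, a.1.1)] the form takes the value [a.1.1 * disc a]. *)
Lemma posdef_qform (a : sqform) : (forall s t, (s, t) != 0 -> 0 < qform a s t) -> posdef a.
Proof.
move=> h; have E0 : 0 < a.1.1.
  have := h 1 0; rewrite /qform expr0n /= expr1n mul1r mulr0 !mul0r !addr0; apply.
  by apply/eqP => -[] /eqP; rewrite oner_eq0.
split=> //; have : 0 < qform a (- a.1.2) a.1.1.
  by apply: h; apply/eqP => -[_ e]; rewrite e ltxx in E0.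
have -> : qform a (- a.1.2) a.1.1 = a.1.1 * disc a by rewrite /qform /disc; ring.
by rewrite pmulr_rgt0.
Qed.

Lemma sum2 (W : nmodType) (F : 'I_2 -> W) : \sum_(i < 2) F i = F 0 + F 1.
Proof.
rewrite !big_ord_recr big_ord0 /= add0r.
by congr (F _ + F _); apply/val_inj.
Qed.

Lemma mx_qform (M : 'M[R]_2) (xi : 'rV[R]_2) : M 0 1 = M 1 0 ->
  (xi *m M *m xi^T) 0 0 = qform (M 0 0, M 0 1, M 1 1) (xi 0 0) (xi 0 1).
Proof. by move=> h; rewrite mxE sum2 !mxE !sum2 /qform /= -h; ring. Qed.

Lemma metric_met (y : P -> V) x :
  (metric y x 0 0, metric y x 0 1, metric y x 1 1) = met (pd 0 y) (pd 1 y) x.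
Proof. by rewrite /metric !mxE. Qed.

Lemma gstar_gform (A : R) ubar x :
  (gstar A ubar x 0 0, gstar A ubar x 0 1, gstar A ubar x 1 1) = gform A ubar x.
Proof. by rewrite /gstar !mxE. Qed.

Lemma pair_row (s t : R) : (s, t) != 0 -> (\row_(i < 2) (if i == 0 then s else t)) != 0.
Proof.
apply: contraNN => /eqP/rowP h; apply/eqP; congr (_, _).
  by have := h 0; rewrite !mxE.
by have := h 1; rewrite !mxE.
Qed.

Lemma qform_dot (p q : V) s t : qform (dot p p, dot p q, dot q q) s t =
  dot (s *: p + t *: q) (s *: p + t *: q).
Proof. by rewrite !(dotDl, dotDr, dotZl, dotZr) (dotC q p) /qform /=; ring. Qed.

Lemma row_free_qform (y : P -> V) x s t : row_free (\matrix_(i < 2) pd i y x) -> (s, t) != 0 ->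
  0 < qform (met (pd 0 y) (pd 1 y) x) s t.
Proof.
move=> rf st; pose w := s *: pd 0 y x + t *: pd 1 y x.
have -> : qform (met (pd 0 y) (pd 1 y) x) s t = dot w w by exact: qform_dot.
rewrite lt_neqAle dot_ge0 andbT eq_sym; apply/eqP => w0.
have {}w0 : w = 0.
  by apply/eqP; rewrite -normr_eq0 -sqrf_eq0 eq_le sqr_ge0 andbT -w0 norm_dot.
pose xi := \row_(i < 2) (if i == 0 then s else t).
have : xi *m (\matrix_(i < 2) pd i y x) = 0 *m (\matrix_(i < 2) pd i y x).
  by rewrite mul0mx mulmx_sum_row sum2 !rowK !mxE.
by move/(row_free_inj rf) => /eqP; apply/negP; exact: pair_row.
Qed.

Lemma lt_form_posdef (A : R) ubar (y : P -> V) x : lt_form (metric y x) (gstar A ubar x) ->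
  posdef (gform A ubar x - met (pd 0 y) (pd 1 y) x).
Proof.
move=> h; apply: posdef_qform => s t st; have := h _ (pair_row st).
have e1 : metric y x 0 1 = metric y x 1 0 by rewrite !mxE; exact: dotC.
have e2 : gstar A ubar x 0 1 = gstar A ubar x 1 0 by rewrite !mxE.
rewrite (mx_qform _ e1) (mx_qform _ e2) metric_met gstar_gform.
have -> : (\row_(i < 2) (if i == 0 then s else t)) 0 0 = s by rewrite mxE.
have -> : (\row_(i < 2) (if i == 0 then s else t)) 0 1 = t by rewrite mxE.
move: (met _ _ x) (gform A ubar x) => m g; rewrite -subr_gt0.
by have -> : qform (g - m) s t = qform g s t - qform m s t by rewrite /qform /=; ring.
Qed.

Lemma lin_lower (p q : V) : 0 < disc (dot p p, dot p q, dot q q) -> exists2 l : R, 0 < l &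
  forall x k : P, l * `|k| <= `|lin (fun=> p) (fun=> q) x k|.
Proof.
move=> D0; pose c := 1 + `|p| + `|q| + (disc (dot p p, dot p q, dot q q))^-1.
have i0 : 0 < (disc (dot p p, dot p q, dot q q))^-1 by rewrite invr_gt0.
have n1 := normr_ge0 p; have n2 := normr_ge0 q.
have c1 : 1 <= c by rewrite /c; lra.
have c0 : 0 < c by lra.
have nd : nondeg c (fun _ : P => p) (fun _ => q).
  split=> x; [by rewrite /c; lra|by rewrite /c; lra|].
  rewrite dot_cross_cross -[leRHS]invrK lef_pV2 ?posrE ?invr_gt0 //.
  by rewrite /c; move: i0; rewrite /disc /=; lra.
exists (3 * c ^+ 2)^-1; first by rewrite invr_gt0 mulr_gt0 // exprn_gt0.
move=> x k; rewrite mulrC ler_pdivrMr; last by rewrite mulr_gt0 // exprn_gt0.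
have c2 : 0 <= `|lin (fun=> p) (fun=> q) x k| * (3 * c ^+ 2).
  by apply: mulr_ge0 => //; apply: mulr_ge0 => //; exact: sqr_ge0.
rewrite -ler_sqr ?nnegrE //.
apply: (le_trans (quadratic_lower x k c1 nd)).
set l := lin _ _ x k; have h := dot_norm l l.
have := le_trans (ler_norm _) h => {}h.
have c34 : c ^+ 3 <= c ^+ 4 by rewrite ler_weXn2l.
have c30 : 0 <= 3 * c ^+ 3 by apply: mulr_ge0 => //; apply: exprn_ge0; exact: ltW.
apply: (le_trans (ler_wpM2l c30 h)).
by have := ler_wpM2r (mulr_ge0 (normr_ge0 l) (normr_ge0 l)) c34; lra.
Qed.

Lemma norm_pairE (x : P) (e : R) : (`|x| < e) = (`|x.1| < e) && (`|x.2| < e).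
Proof. by rewrite prod_normE gt_max. Qed.

Lemma open_norm_ball (U : set P) : open U -> U 0 -> exists2 r, 0 < r & forall x, `|x| < r -> U x.
Proof.
move=> oU U0; have /nbhs_ballP[r /= r0 H] : nbhs (0 : P) U by exact: open_nbhs_nbhs.
exists r => // x hx; apply: H; rewrite -ball_normE /= sub0r normrN; exact: hx.
Qed.

Record short_family (A : R) (ubar : R -> R) (delta T : R) (U : set P) (yg : R -> P -> V) : Prop :=
  ShortFamily {
  sf_A : 1 < A;
  sf_shear : shear_profile A delta ubar;
  sf_delta : 0 < delta;
  sf_open : open U;
  sf_0 : U 0;
  sf_analytic : forall k : 'I_3, analytic_on T U (fun t x => yg t x 0 k);
  sf_embedding : forall t, 0 <= t <= T -> embedding U (yg t);
  sf_short : forall t x, 0 <= t <= T -> U x -> lt_form (metric (yg t) x) (gstar A ubar x) }.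

Lemma yg_estimates A ubar delta T U yg (S : short_family A ubar delta T U yg) t0 : 0 <= t0 <= T -> exists rho C : R, [/\ 0 < rho, 0 <= C,
  forall t, 0 <= t <= T -> `|t - t0| < rho -> forall x z, `|x| < rho -> `|z| < rho ->
    [/\ `|pd 0 (yg t) z - pd 0 (yg t) x| <= C * `|z - x|,
        `|pd 1 (yg t) z - pd 1 (yg t) x| <= C * `|z - x| &
        `|yg t z - yg t x - lin (pd 0 (yg t)) (pd 1 (yg t)) x (z - x)| <= C * `|z - x| ^+ 2] &
  forall t t' x, 0 <= t <= T -> 0 <= t' <= T -> `|t - t0| < rho -> `|t' - t0| < rho ->
    `|x| < rho -> `|yg t' x - yg t x| <= C * `|t' - t| ].
Proof.
move=> ht0.
have H (k : 'I_3) : exists rc : R * R, [/\ 0 < rc.1, 0 <= rc.2,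
    forall t x a b, 0 <= t <= T -> `|t - t0| < rc.1 -> `|x| < rc.1 -> `|x + a| < rc.1 ->
      `|x + b| < rc.1 -> `|x + a + b| < rc.1 ->
      `|mixed (fun x => yg t x 0 k) x a b| <= rc.2 * (`|a| * `|b|) &
    forall t t' x, 0 <= t <= T -> 0 <= t' <= T -> `|t - t0| < rc.1 -> `|t' - t0| < rc.1 ->
      `|x| < rc.1 -> `|yg t' x 0 k - yg t x 0 k| <= rc.2 * `|t' - t|].
  by have [r [c hrc]] := analytic_estimates (sf_analytic S k) ht0 (sf_0 S); exists (r, c).
have [rc hrc] := choice H.
have [r2 r20 hr2] := open_norm_ball (sf_open S) (sf_0 S).
pose rho := Num.min r2 (Num.min (rc 0).1 (Num.min (rc 1).1 (rc 2).1)).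
pose C := (rc 0).2 + (rc 1).2 + (rc 2).2.
have [a1 a2 _ _] := hrc 0; have [b1 b2 _ _] := hrc 1; have [c1 c2 _ _] := hrc 2.
have rho0 : 0 < rho by rewrite !lt_min r20 a1 b1 c1.
have rhoU : rho <= r2 by rewrite ge_min lexx.
have rhok k : rho <= (rc k).1.
  by move: k; apply: ord3P; rewrite !ge_min lexx ?orbT.
have Ck k : (rc k).2 <= C by move: k; apply: ord3P; rewrite /C; clear -a2 b2 c2; lra.
have C0 : 0 <= C by rewrite /C; lra.
clearbody rho C; exists (rho / 4), C; have r4 : rho / 4 <= rho by lra.
split=> //; first by rewrite divr_gt0.
  move=> t ht htt; apply: local_gradient => //.
    move=> x hx; have [[dF _] _ _ _] := sf_embedding S ht; apply: dF; apply: hr2.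
    exact: lt_le_trans hx rhoU.
  move=> x a b hx hxa hxb hxc; apply: norm_leP => [|k].
    by apply: mulr_ge0 => //; exact: mulr_ge0.
  have [_ _ hm _] := hrc k; have up (y : R) : y < rho -> y < (rc k).1.
    by move=> h; exact: lt_le_trans h (rhok k).
  have := hm t x a b ht (up _ (lt_le_trans htt r4)) (up _ hx) (up _ hxa) (up _ hxb) (up _ hxc).
  rewrite /mixed !mxE => h; apply: (le_trans h); rewrite ler_wpM2r //; exact: mulr_ge0.
move=> t t' x ht ht' htt htt' hx; apply: norm_leP => [|k]; first exact: mulr_ge0.
have [_ _ _ hm] := hrc k; have up (y : R) : y < rho / 4 -> y < (rc k).1.
  by move=> h; exact: lt_le_trans h (le_trans r4 (rhok k)).
have := hm t t' x ht ht' (up _ htt) (up _ htt') (up _ hx); rewrite !mxE => h.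
by apply: (le_trans h); rewrite ler_wpM2r.
Qed.

(** Difference quotients at scale [k] are compared: each is within [C k] of the gradient by the
    quadratic remainder, and they differ by at most [2 C |t - t0| / k] since the values are
    Lipschitz in time. First [k] is taken of order [eta], then [|t - t0|] of order [k eta]. *)
Lemma yg_gradient_cvg A ubar delta T U yg (S : short_family A ubar delta T U yg) t0 : 0 <= t0 <= T -> forall eta, 0 < eta -> exists2 nu, 0 < nu &
  forall t, 0 <= t <= T -> `|t - t0| < nu ->
    `|pd 0 (yg t) 0 - pd 0 (yg t0) 0| <= eta /\ `|pd 1 (yg t) 0 - pd 1 (yg t0) 0| <= eta.
Proof.
move=> ht0 eta e0; have [rho [C [r0 C0 hg ht]]] := yg_estimates S ht0.
pose k := Num.min (rho / 2) (eta / (4 * C + 1)).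
have c41 : 0 < 4 * C + 1 by lra.
have k0 : 0 < k by rewrite lt_min !divr_gt0.
have kr : k < rho by have : k <= rho / 2 by [rewrite ge_min lexx]; lra.
have kC : 4 * C * k <= eta.
  have : k <= eta / (4 * C + 1) by rewrite ge_min lexx orbT.
  by rewrite ler_pdivlMr // => h; lra.
clearbody k; pose nu := Num.min rho (k * eta / (4 * C + 1)).
exists nu; first by rewrite lt_min r0 divr_gt0 // mulr_gt0.
move=> t hT htt.
have t1 : `|t - t0| < rho by apply: lt_le_trans htt _; rewrite ge_min lexx.
have t2 : 4 * C * `|t - t0| <= k * eta.
  have : `|t - t0| <= k * eta / (4 * C + 1).
    by apply: (le_trans (ltW htt)); rewrite ge_min lexx orbT.
  by rewrite ler_pdivlMr // => h; have := normr_ge0 (t - t0); lra.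
have t00 : `|t0 - t0| < rho by rewrite subrr normr0.
have z0 : `|0 : P| < rho by rewrite normr0.
have fin (h : P) : `|h| = 1 ->
    `|lin (pd 0 (yg t)) (pd 1 (yg t)) 0 h - lin (pd 0 (yg t0)) (pd 1 (yg t0)) 0 h| <= eta.
  move=> h1; have kh : `|k *: h| = k by rewrite pairZ_norm ?h1 ?mulr1 // ltW.
  have khr : `|k *: h| < rho by rewrite kh.
  have lk (p q : P -> V) : lin p q 0 (k *: h) = k *: lin p q 0 h by rewrite /lin scalerDr !scalerA.
  pose a1 := lin (pd 0 (yg t)) (pd 1 (yg t)) 0 h; pose a2 := lin (pd 0 (yg t0)) (pd 1 (yg t0)) 0 h.
  have g1 : `|yg t (k *: h) - yg t 0 - k *: a1| <= C * k ^+ 2.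
    by have [_ _] := hg t hT t1 0 (k *: h) z0 khr; rewrite subr0 kh lk.
  have g2 : `|yg t0 (k *: h) - yg t0 0 - k *: a2| <= C * k ^+ 2.
    by have [_ _] := hg t0 ht0 t00 0 (k *: h) z0 khr; rewrite subr0 kh lk.
  have f1 := ht t0 t 0 ht0 hT t00 t1 z0; have f2 := ht t0 t (k *: h) ht0 hT t00 t1 khr.
  rewrite -/a1 -/a2; clearbody a1 a2.
  rewrite -(ler_pM2l k0) -{1}(gtr0_norm k0) -normrZ.
  have -> : k *: (a1 - a2) = - (yg t (k *: h) - yg t 0 - k *: a1)
     + (yg t0 (k *: h) - yg t0 0 - k *: a2)
     + (yg t (k *: h) - yg t0 (k *: h)) - (yg t 0 - yg t0 0).
    by apply: row3P; rewrite !mxE; ring.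
  rewrite (le_trans (ler_normB _ _)) // (le_trans (lerD (ler_normD _ _) f1)) //.
  rewrite (le_trans (lerD (lerD (ler_normD _ _) f2) (lexx _))) // normrN.
  rewrite (le_trans (lerD (lerD (lerD g1 g2) (lexx _)) (lexx _))) //.
  have := ler_wpM2l (ltW k0) kC; clear -t2; lra.
have l0 (f : P -> V) : lin (pd 0 f) (pd 1 f) 0 (axis R 0) = pd 0 f 0.
  by rewrite /lin /axis /= scale1r scale0r addr0.
have l1 (f : P -> V) : lin (pd 0 f) (pd 1 f) 0 (axis R 1) = pd 1 f 0.
  by rewrite /lin /axis /= scale1r scale0r add0r.
split; [rewrite -!l0|rewrite -!l1]; apply: fin; rewrite /axis /= prod_normE /= normr1 normr0.
  by rewrite max_l.
by rewrite max_r.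
Qed.

Lemma scale_choice (rho r4 eta l sigma C Lg : R) : 0 < rho -> 0 < r4 -> 0 < eta -> 0 < l ->
  0 < sigma -> 0 <= C -> 0 <= Lg -> exists r, [/\ 0 < r, 2 * r < rho, 2 * r <= r4 &
    [/\ 2 * C * r <= eta / 2, 32 * C * r <= l / 4 & Lg * (2 * r) <= sigma]].
Proof.
move=> r0 r40 eta0 l0 s0 C0 Lg0.
pose b := 1 + 4 / rho + 4 / r4 + 4 * C / eta + 128 * C / l + 2 * Lg / sigma.
have q1 : 0 <= 4 / rho by rewrite divr_ge0 // ltW.
have q2 : 0 <= 4 / r4 by rewrite divr_ge0 // ltW.
have q3 : 0 <= 4 * C / eta by rewrite divr_ge0 ?mulr_ge0 // ltW.
have q4 : 0 <= 128 * C / l by apply: divr_ge0; [apply: mulr_ge0|exact: ltW].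
have q5 : 0 <= 2 * Lg / sigma by rewrite divr_ge0 ?mulr_ge0 // ltW.
have bp : 0 < b by rewrite /b; lra.
pose r := b^-1; have rp : 0 < r by rewrite invr_gt0.
have br k : k <= b -> k * r <= 1.
  by move=> kb; rewrite -[leRHS](mulfV (lt0r_neq0 bp)) ler_wpM2r // ltW.
have rr : 2 * r < rho.
  have : 4 / rho * r <= 1 by apply: br; rewrite /b; lra.
  by rewrite mulrAC ler_pdivrMr //; lra.
have rr4 : 2 * r <= r4.
  have : 4 / r4 * r <= 1 by apply: br; rewrite /b; lra.
  by rewrite mulrAC ler_pdivrMr //; lra.
have rC : 2 * C * r <= eta / 2.
  have : 4 * C / eta * r <= 1 by apply: br; rewrite /b; lra.
  by rewrite mulrAC ler_pdivrMr //; lra.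
have rl : 32 * C * r <= l / 4.
  have : 128 * C / l * r <= 1 by apply: br; rewrite /b; lra.
  by rewrite mulrAC ler_pdivrMr //; lra.
have rs : Lg * (2 * r) <= sigma.
  have : 2 * Lg / sigma * r <= 1 by apply: br; rewrite /b; lra.
  by rewrite mulrAC ler_pdivrMr //; lra.
by exists r.
Qed.

(** The forms [G] and [H] are frozen at time [t0] and at the origin, so [sigma] and the radius are
    common to all [t] near [t0]. Continuity of the gradient in time and the small radius keep the
    extended map within [sigma] of [G] and the target within [sigma] of [G + H]. *)
Lemma near_time A ubar delta T U yg (S : short_family A ubar delta T U yg) t0 : 0 <= t0 <= T -> exists rho C : R, [/\ 0 < rho, 0 <= C &
  forall t, 0 <= t <= T -> `|t - t0| < rho ->
  (forall eps, 0 < eps -> exists tau y y1 y2, [/\ forall x, `|x| <= rho -> tau x = gform A ubar x,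
     rough_immersion 32^-1 tau y y1 y2 & forall x, `|x| <= rho -> `|y x - yg t x| <= eps]) /\
  (forall t' x, 0 <= t' <= T -> `|t' - t0| < rho -> `|x| <= rho ->
     `|yg t' x - yg t x| <= C * `|t' - t|)].
Proof.
move=> ht0; have [rho [C [r0 C0 hg ht]]] := yg_estimates S ht0.
have [r4 [Lg [r40 Lg0 hL]]] := fprime_sqr_lip (sf_A S) (sf_shear S) (sf_delta S).
pose G := met (pd 0 (yg t0)) (pd 1 (yg t0)) 0; pose H := gform A ubar 0 - G.
have pG : posdef G.
  apply: posdef_qform => s t st; apply: row_free_qform => //.
  by have [_ rf _ _] := sf_embedding S ht0; exact: (rf 0 (sf_0 S)).
have pH : posdef H by apply: lt_form_posdef; exact: (sf_short S ht0 (sf_0 S)).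
have [sigma s0 nash] := convex_integration pG pH.
have GH : G + H = gform A ubar 0 by rewrite /H addrC subrK.
have [p0 ep] : exists v : V, v = pd 0 (yg t0) 0 := ex_intro _ _ erefl.
have [q0 eq] : exists v : V, v = pd 1 (yg t0) 0 := ex_intro _ _ erefl.
have eG : G = (dot p0 p0, dot p0 q0, dot q0 q0) by rewrite ep eq.
clearbody H; clearbody G.
have [l l0 hl] : exists2 l : R, 0 < l & forall x k : P, l * `|k| <= `|lin (fun=> p0) (fun=> q0) x k|.
  by apply: lin_lower; rewrite -eG; have [_] := pG.
pose B := `|p0| + `|q0|.
have B0 : 0 <= B by exact: addr_ge0.
have bp0 : `|p0| <= B by rewrite lerDl.
have bq0 : `|q0| <= B by rewrite lerDr.
(* The bound [l / 4] and the one on [32 C r] leave half of the lower bound [l] of the linear part;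
   the third term keeps the metric within [sigma] of [G]. *)
pose eta := Num.min 1 (Num.min (l / 4) (sigma / (3 * (2 * B + 1)))).
have eta0 : 0 < eta by rewrite !lt_min ltr01 !divr_gt0 // mulr_gt0 //; lra.
have eta1 : eta <= 1 by rewrite ge_min lexx.
have etal : eta <= l / 4 by rewrite !ge_min lexx orbT.
have etas : 3 * (eta * (2 * B + 1)) <= sigma.
  have : eta <= sigma / (3 * (2 * B + 1)) by rewrite !ge_min lexx !orbT.
  by rewrite ler_pdivlMr; lra.
clearbody eta.
have eta2 : 0 < eta / 2 by rewrite divr_gt0.
have [nu nu0 hnu] := yg_gradient_cvg S ht0 eta2.
rewrite -ep -eq in hnu; clear ep eq.
have [r [rp rr rr4 [rC rl rs]]] := scale_choice r0 r40 eta0 l0 s0 C0 Lg0.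
exists (Num.min r nu), C; split=> //; first by rewrite lt_min rp.
have rho'r : Num.min r nu <= r by rewrite ge_min lexx.
have rho'n : Num.min r nu <= nu by rewrite ge_min lexx orbT.
have rho'rho : Num.min r nu < rho by apply: (le_lt_trans rho'r); clear -rp rr; lra.
move=> t hT htt; have tr := lt_trans htt rho'rho; have tn := lt_le_trans htt rho'n.
split; last first.
  move=> t' x hT' htt' hx; apply: ht => //; first exact: lt_trans htt' rho'rho.
  exact: le_lt_trans hx rho'rho.
move=> eps eps0.
have [u [p' [q' [ru ur hpq hu]]]] := extension C0 rp rr (hg t hT tr).
have [n1 n2] := hnu t hT tn.
(* Truncation makes the target globally Lipschitz and close to [G + H] on the whole plane, unchanged
   on the ball of radius [r]. *)
pose tau x := gform A ubar (truncate2 r x).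
have gl (x z : P) : `|x| <= r4 -> `|z| <= r4 -> `|gform A ubar z - gform A ubar x| <= Lg * `|z - x|.
  move=> hx hz; have zl : 0 <= Lg * `|z - x| by rewrite mulr_ge0.
  apply: sqform_norm_le => /=; rewrite ?subrr ?normr0 //.
  have -> : fprime A ubar z.2 ^+ 2 + A ^+ 2 - (fprime A ubar x.2 ^+ 2 + A ^+ 2) =
    fprime A ubar z.2 ^+ 2 - fprime A ubar x.2 ^+ 2 by ring.
  apply: (le_trans (hL _ _ (le_trans (norm2_le x) hx) (le_trans (norm2_le z) hz))).
  by rewrite ler_wpM2l //; exact: norm2_le (z - x).
have tr4 x : `|truncate2 r x| <= r4 by apply: le_trans rr4; exact: truncate2_le.
have z4 : `|0 : P| <= r4 by rewrite normr0 ltW.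
pose K := 1 + 20 * C + 4 * Lg.
have K1 : 1 <= K by rewrite /K; clear -C0 Lg0; lra.
have pq' x : `|p' x - p0| <= eta /\ `|q' x - q0| <= eta.
  have [m1 m2] := hpq x.
  have add3 (w w' w2 : V) : `|w - w'| <= 2 * C * r -> `|w' - w2| <= eta / 2 -> `|w - w2| <= eta.
    move=> k1 k2; have -> : w - w2 = (w - w') + (w' - w2) by rewrite addrA subrK.
    by rewrite (le_trans (ler_normD _ _)) // (le_trans (lerD k1 k2)) //; clear -rC; lra.
  by split; [exact: add3 m1 n1|exact: add3 m2 n2].
have metG x : `|met p' q' x - G| <= sigma.
  rewrite eG.
  have [m1 m2] := pq' x.
  have dd (w1 w2 v1 v2 : V) : `|w1 - v1| <= eta -> `|w2 - v2| <= eta -> `|v1| <= B -> `|v2| <= B ->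
      `|dot w1 w2 - dot v1 v2| <= sigma.
    move=> k1 k2 k3 k4; have k5 : `|w2| <= B + 1.
      have -> : w2 = (w2 - v2) + v2 by rewrite subrK.
      by rewrite (le_trans (ler_normD _ _)) // (le_trans (lerD k2 k4)) //; clear -eta1; lra.
    have -> : dot w1 w2 - dot v1 v2 = dot (w1 - v1) w2 + dot v1 (w2 - v2).
      by rewrite dotDl dotNl dotDr dotNr addrA subrK.
    have three : (0 : R) <= 3 by [].
    have j1 := le_trans (dot_norm _ _) (ler_wpM2l three (ler_pM (normr_ge0 _) (normr_ge0 _) k1 k5)).
    have j2 := le_trans (dot_norm _ _) (ler_wpM2l three (ler_pM (normr_ge0 _) (normr_ge0 _) k3 k2)).
    rewrite (le_trans (ler_normD _ _)) // (le_trans (lerD j1 j2)) //; clear -etas; lra.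
  by apply: sqform_norm_le; apply: dd.
have [||||||y [y1 [y2 [hy dy]]]] := nash K u p' q' tau (l / 2) eps K1 _ metG.
- by apply: regular_le ru; rewrite /K; clear -C0 Lg0; lra.
- move=> x; rewrite GH; apply: (le_trans (gl _ _ z4 (tr4 x))); rewrite subr0.
  by apply: (le_trans _ rs); rewrite ler_wpM2l // truncate2_le.
- move=> x z; apply: (le_trans (gl _ _ (tr4 x) (tr4 z))).
  have := ler_wpM2l Lg0 (truncate2_lip x z rp); have := mulr_ge0 C0 (normr_ge0 (z - x)).
  by have := normr_ge0 (z - x); rewrite /K; clear; lra.
- by rewrite divr_gt0.
- move=> x z; have h1 := hl 0 (z - x); have h2 := hu x z.
  have h3 : `|lin (pd 0 (yg t)) (pd 1 (yg t)) 0 (z - x) - lin (fun=> p0) (fun=> q0) 0 (z - x)|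
      <= 2 * (eta / 2) * `|z - x|.
    have -> : lin (pd 0 (yg t)) (pd 1 (yg t)) 0 (z - x) - lin (fun=> p0) (fun=> q0) 0 (z - x) =
      lin (fun=> pd 0 (yg t) 0 - p0) (fun=> pd 1 (yg t) 0 - q0) 0 (z - x).
      rewrite /lin; move: (pd 0 (yg t) 0) (pd 1 (yg t) 0) => v1 v2; clear.
      by apply: row3P; rewrite !mxE; ring.
    exact: lin_le.
  move: h1 h2 h3; set l1 := lin (fun=> p0) _ _ _; set l2 := lin _ _ _ _ => h1 h2 h3; clearbody l1 l2.
  have : `|l1| <= `|u z - u x| + 32 * C * r * `|z - x| + 2 * (eta / 2) * `|z - x|.
    have -> : l1 = (u z - u x) - (u z - u x - l2) - (l2 - l1) by apply: row3P; rewrite !mxE; ring.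
    rewrite (le_trans (ler_normB _ _)) // lerD // (le_trans (ler_normB _ _)) // lerD2l //.
  have m1 := ler_wpM2r (normr_ge0 (z - x)) rl; have m2 := ler_wpM2r (normr_ge0 (z - x)) etal.
  move/(le_trans h1); clear -m1 m2; lra.
- exact: eps0.
exists tau, y, y1, y2; split; [move=> x hx|exact: hy|move=> x hx].
  by rewrite /tau truncate2_id // (le_trans hx).
by rewrite -ur ?dy // (le_trans hx).
Qed.

End NearTime.

(** * Differentiability of the limit maps *)

Section Wrinkled.
Variable R : realType.
Local Notation P := (R * R)%type.
Local Notation V := 'rV[R]_3.
Local Notation sqform := (sqform R).

Lemma differentiable_quadratic (X Y : normedModType R) (df : {linear X -> Y}) (F : X -> Y) x :
  continuous df ->
  (forall k, 0 < k -> exists K, forall z, `|F z - F x - df (z - x)| <= k * `|z - x| + K * `|z - x| ^+ 2) ->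
  differentiable F x /\ 'd F x = df :> (X -> Y).
Proof.
move=> cdf H.
have E : F \o shift x = cst (F x) + df +o_0 id.
  apply/eqaddoP => e e0; have e2 : 0 < e / 2 by rewrite divr_gt0.
  have [K hK] := H _ e2.
  have d0 : 0 < (e / 2) / (1 + `|K|) by rewrite divr_gt0 // ltr_wpDr.
  near=> h.
  have hh : `|h| < (e / 2) / (1 + `|K|).
    by near: h; apply: nbhs0_lt.
  have := hK (h + x); rewrite addrK.
  rewrite ltr_pdivlMr ?ltr_wpDr // in hh.
  have -> : (F \o shift x - (cst (F x) + df)) h = F (h + x) - F x - df h.
    by rewrite !fctE /= opprD addrA.
  move=> h1; apply: (le_trans h1).
  have n0 := normr_ge0 h; have Kn := ler_norm K.
  have : K * `|h| <= e / 2.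
    apply: (le_trans _ (ltW hh)); rewrite [leRHS]mulrC ler_wpM2r //; move: Kn; clear; lra.
  by move/(ler_wpM2r n0); clear; lra.
have dE := diff_unique cdf E.
by split=> //; apply/diff_locallyP; rewrite dE.
Unshelve. all: by end_near. Qed.

Section Differential.
Variables v w : V.

Definition linmap (h : P) : V := h.1 *: v + h.2 *: w.

Lemma linmap_linear : linear linmap.
Proof.
move=> a x y; rewrite /linmap scalerDr !scalerA.
change ((a * x.1 + y.1) *: v + (a * x.2 + y.2) *: w =
  (a * x.1) *: v + (a * x.2) *: w + (y.1 *: v + y.2 *: w)).
by rewrite !scalerDl addrACA.
Qed.
HB.instance Definition _ := GRing.isLinear.Build R P V _ linmap linmap_linear.

Lemma linmap_continuous : continuous linmap.
Proof. by move=> x; apply: cvgD; apply: cvgZr_tmp; [exact: cvg_fst|exact: cvg_snd]. Qed.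

Lemma differentiable_linmap (F : P -> V) x :
  (forall k, 0 < k -> exists K, forall z, `|F z - F x - linmap (z - x)| <= k * `|z - x| + K * `|z - x| ^+ 2) ->
  differentiable F x /\ forall h, 'D_h F x = linmap h.
Proof.
move=> H.
have [dF dE] := @differentiable_quadratic P V linmap F x linmap_continuous H.
by split=> // h; rewrite deriveE // dE.
Qed.

End Differential.

(** The translation [w] is carried along because the different families are translates of each
    other. *)
Lemma rough_pd alpha tau (y p q : P -> V) : rough_immersion alpha tau y p q ->
  forall (w : V) x, [/\ differentiable (fun x => y x + w) x, pd 0 (fun x => y x + w) x = p x &
    pd 1 (fun x => y x + w) x = q x].
Proof.
move=> hy w x; have [|dF hD] := @differentiable_linmap (p x) (q x) (fun x => y x + w) x.
  move=> k k0; have [K hK] := rough_tay hy k0; exists K => z.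
  have -> : y z + w - (y x + w) = y z - y x by rewrite opprD addrACA subrr addr0.
  exact: hK.
by split=> //; rewrite /pd hD /linmap /axis /= ?scale1r ?scale0r ?addr0 ?add0r.
Qed.

Lemma holder_continuous (F : P -> V) (K alpha : R) x : 0 < alpha ->
  (forall z, `|F z - F x| <= K * `|z - x| `^ alpha) -> {for x, continuous F}.
Proof.
move=> a0 h; apply/cvgrPdist_le => e e0; have K0 : 0 < 1 + `|K| by rewrite ltr_wpDr.
pose d := (e / (1 + `|K|)) `^ (alpha^-1).
have d0 : 0 < d by rewrite powR_gt0 // divr_gt0.
near=> z; have hz : `|z - x| < d.
  by rewrite distrC; near: z; apply: cvgr_dist_lt => //; exact: cvg_id.
rewrite distrC; apply: (le_trans (h z)).
have : `|z - x| `^ alpha <= e / (1 + `|K|).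
  apply: (@le_trans _ _ (d `^ alpha)).
    by rewrite ge0_ler_powR ?nnegrE ?(ltW a0) // ltW.
  by rewrite /d -powRrM mulVf ?gt_eqF // powRr1 // ltW // divr_gt0.
rewrite ler_pdivlMr // => h1; have := ler_norm K; have := powR_ge0 (`|z - x|) alpha.
by move: h1; set s := _ `^ _; clear; nra.
Unshelve. all: by end_near. Qed.

End Wrinkled.

(** * Rough immersions are wrinkled embeddings *)

Section WrinkledEmbedding.
Variable R : realType.
Local Notation P := (R * R)%type.
Local Notation V := 'rV[R]_3.
Local Notation sqform := (sqform R).

Lemma ord2P (Q : 'I_2 -> Prop) : Q 0 -> Q 1 -> forall i, Q i.
Proof.
move=> q0 q1 i; have [->//|n] := eqVneq i 0.
by have -> : i = 1 by case: i n => -[|[|]] //= h _; exact/val_inj.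
Qed.

Lemma differentiable_lipschitz_at (X Y : normedModType R) (F : X -> Y) x : differentiable F x ->
  exists2 d, 0 < d & forall h, `|h| < d -> `|F (h + x) - F x - 'd F x h| <= `|h|.
Proof.
move=> /diff_locallyP[_ /eqaddoP /(_ 1 ltr01)] /nbhs_ballP[d /= d0 H].
exists d => // h hd.
have /H : ball (0 : X) d h by rewrite -ball_normE /= sub0r normrN.
by rewrite mul1r !fctE /= opprD addrA.
Qed.

Lemma gram_row_free (p q : V) (a b : R) (y : P -> V) x : 0 < a -> 0 < b ->
  (dot p p, dot p q, dot q q) = (a, 0, b) -> pd 0 y x = p -> pd 1 y x = q ->
  row_free (\matrix_(i < 2) pd i y x).
Proof.
move=> a0 b0 hg ep eq; apply: inj_row_free => v.
rewrite mulmx_sum_row sum2 !rowK ep eq => h.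
have := qform_dot p q (v 0 0) (v 0 1); rewrite h hg /qform /= mulr0 addr0.
have -> : dot (0 : V) 0 = 0 by rewrite dotE !mxE; ring.
move=> e; have s0 := sqr_ge0 (v 0 0); have t0 := sqr_ge0 (v 0 1).
have e1 : 0 <= v 0 0 ^+ 2 * a by rewrite mulr_ge0 // ltW.
have e2 : 0 <= v 0 1 ^+ 2 * b by rewrite mulr_ge0 // ltW.
have z0 : v 0 0 = 0.
  apply/eqP; rewrite -sqrf_eq0 -(inj_eq (mulIf (lt0r_neq0 a0))) mul0r; apply/eqP.
  by move: e e1 e2; clear; lra.
have z1 : v 0 1 = 0.
  apply/eqP; rewrite -sqrf_eq0 -(inj_eq (mulIf (lt0r_neq0 b0))) mul0r; apply/eqP.
  by move: e e1 e2; clear; lra.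
by apply/rowP => i; rewrite mxE; move: i; apply: ord2P.
Qed.

Record wrinkled_patch (A : R) (ubar : R -> R) (Omega : set P) (r : R) (tau : P -> sqform)
    (y p q : P -> V) : Prop := WrinkledPatch {
  patch_A : 1 < A;
  patch_0 : Omega 0;
  patch_r : forall x, Omega x -> `|x| <= r;
  patch_tau : forall x, `|x| <= r -> tau x = gform A ubar x;
  patch_rough : rough_immersion 32^-1 tau y p q }.

Lemma rough_pdE A ubar Omega r tau y p q (H : wrinkled_patch A ubar Omega r tau y p q) (w : V) :
  let F x := y x + w in pd 0 F = p /\ pd 1 F = q.
Proof.
move=> F; have [A1 Omega0 Omega_r htau hy] := H. by split; apply/funext => x; have [] := rough_pd hy w x. Qed.

Lemma rough_Ck1 A ubar Omega r tau y p q (H : wrinkled_patch A ubar Omega r tau y p q) (w : V) :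
  let F x := y x + w in Ck 1 Omega F.
Proof.
move=> F; have [A1 Omega0 Omega_r htau hy] := H.
have [ep eq] := rough_pdE H w; have [K hK] := rough_holder hy.
have a0 : (0 : R) < 32^-1 by rewrite invr_gt0.
split=> [x _|]; first by have [] := rough_pd hy w x.
apply: ord2P => x _; rewrite ?ep ?eq; apply: (holder_continuous (K := K) a0) => z;
  by case: (hK x z).
Qed.

Lemma rough_metric A ubar Omega r tau y p q (H : wrinkled_patch A ubar Omega r tau y p q) (w : V) x :
  let F x := y x + w in Omega x -> metric F x = gstar A ubar x.
Proof.
move=> F; have [A1 Omega0 Omega_r htau hy] := H.
move=> Ox; have := metric_met F x; have [-> ->] := rough_pdE H w.
rewrite (rough_met hy) (htau _ (Omega_r _ Ox)) -(gstar_gform A ubar x) => -[e1 e2 e3].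
have s1 : metric F x 1 0 = metric F x 0 1 by rewrite !mxE; exact: dotC.
have s2 : gstar A ubar x 1 0 = gstar A ubar x 0 1 by rewrite !mxE.
apply/matrixP; apply: ord2P; apply: ord2P => //.
by rewrite s1 s2.
Qed.

(** The lower bound [bil] gives injectivity and the continuity of the inverse at once; the rank
    comes from the Gram matrix, diagonal with positive entries. *)
Lemma rough_embedding A ubar Omega r tau y p q (H : wrinkled_patch A ubar Omega r tau y p q) (w : V) :
  let F x := y x + w in embedding Omega F.
Proof.
move=> F; have [A1 Omega0 Omega_r htau hy] := H.
have [ep eq] := rough_pdE H w; have [c c0 hb] := rough_bil hy.
have hF x z : c * `|z - x| <= `|F z - F x|.
  have -> : F z - F x = y z - y x by rewrite /F opprD addrACA subrr addr0.
  exact: hb.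
split; first exact: (rough_Ck1 H).
- move=> x Ox; apply: (@gram_row_free (p x) (q x) (A ^+ 2) (fprime A ubar x.2 ^+ 2 + A ^+ 2)).
  + by rewrite exprn_gt0 //; apply: lt_trans A1.
  + by rewrite ltr_wpDl ?sqr_ge0 // exprn_gt0 //; apply: lt_trans A1.
  + exact: etrans (rough_met hy x) (htau _ (Omega_r _ Ox)).
  + by rewrite ep.
  + by rewrite eq.
- move=> x z _ _ e; have := hF z x; rewrite e subrr normr0 => h.
  apply/eqP; rewrite -subr_eq0 -normr_eq0 eq_le normr_ge0 andbT.
  by rewrite -(ler_pM2l c0) mulr0.
- move=> x _ N /nbhs_ballP[e /= e0 He].
  exists (ball (F x) (c * e)); first by apply: nbhsx_ballx; rewrite mulr_gt0.
  move=> z [_ /=]; rewrite -ball_normE /= distrC => hz; apply: He.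
  rewrite -ball_normE /= distrC -(ltr_pM2l c0); exact: le_lt_trans (hF x z) hz.
Qed.

Lemma rough_C1holder A ubar Omega r tau y p q (H : wrinkled_patch A ubar Omega r tau y p q) (w : V) :
  let F x := y x + w in C1holder 32^-1 Omega F.
Proof.
move=> F; have [A1 Omega0 Omega_r htau hy] := H.
split; first exact: (rough_Ck1 H).
have [ep eq] := rough_pdE H w; have [K hK] := rough_holder hy.
(* Bounds [y] itself on [Omega], by expansion at the origin. *)
have [L hL] := rough_tay hy ltr01.
have r0 : 0 <= r by apply: le_trans (Omega_r _ Omega0).
have a0 : (0 : R) <= 32^-1 by rewrite invr_ge0.
have ra : 0 <= r `^ 32^-1 by exact: powR_ge0.
pose B := `|p 0| + `|q 0| + `|K| * r `^ 32^-1.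
pose B1 := `|y 0| + `|w| + (`|p 0| + `|q 0|) * r + r + `|L| * r ^+ 2.
have n1 := normr_ge0 (p 0); have n2 := normr_ge0 (q 0).
have n3 := normr_ge0 (y 0); have n4 := normr_ge0 w.
have n5 := normr_ge0 K; have n6 := normr_ge0 L.
have m1 : 0 <= `|K| * r `^ 32^-1 by exact: mulr_ge0.
have m2 : 0 <= (`|p 0| + `|q 0|) * r by apply: mulr_ge0 => //; exact: addr_ge0.
have m3 : 0 <= `|L| * r ^+ 2 by apply: mulr_ge0 => //; exact: sqr_ge0.
have hol (f : P -> V) : `|f 0| <= `|p 0| + `|q 0| ->
    (forall x z, `|f z - f x| <= K * `|z - x| `^ 32^-1) -> forall x, Omega x -> `|f x| <= B.
  move=> h0 h x Ox; have -> : f x = f 0 + (f x - f 0) by rewrite addrC subrK.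
  apply: (le_trans (ler_normD _ _)); apply: lerD => //; apply: (le_trans (h 0 x)).
  rewrite subr0; apply: (@le_trans _ _ (`|K| * `|x| `^ 32^-1)).
    by apply: ler_wpM2r; [exact: powR_ge0|exact: ler_norm].
  apply: ler_wpM2l => //; apply: ge0_ler_powR; rewrite ?nnegrE //; exact: Omega_r.
have Bp : 0 <= B by rewrite /B; move: m1 n1 n2; clear; lra.
have B1p : 0 <= B1 by rewrite /B1; move: m2 m3 n3 n4 r0; clear; lra.
have [hp hq] : (forall x, Omega x -> `|p x| <= B) /\ (forall x, Omega x -> `|q x| <= B).
  by split; apply: hol; rewrite ?lerDl ?lerDr // => x z; have [] := hK x z.
exists (B + B1 + `|K|); clearbody B; split.
- move=> x Ox; apply: (@le_trans _ _ B1); last by move: Bp n5; clear; lra.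
  have := hL 0 x; rewrite subr0 mul1r => h; rewrite /F /B1.
  have -> : y x + w = (y 0 + w) + lin p q 0 x + (y x - y 0 - lin p q 0 x).
    by move: (lin p q 0 x) => l; apply: row3P; rewrite !mxE; ring.
  have xr := Omega_r _ Ox.
  have h1 : `|lin p q 0 x| <= (`|p 0| + `|q 0|) * r.
    rewrite /lin (le_trans (ler_normD _ _)) // !normrZ mulrDl.
    by apply: lerD; rewrite mulrC ler_wpM2l // (le_trans _ xr) ?norm1_le ?norm2_le.
  have h2 : L * `|x| ^+ 2 <= `|L| * r ^+ 2.
    apply: (@le_trans _ _ (`|L| * `|x| ^+ 2)).
      by apply: ler_wpM2r; [exact: sqr_ge0|exact: ler_norm].
    by apply: ler_wpM2l => //; rewrite ler_sqr ?nnegrE.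
  rewrite (le_trans (ler_normD _ _)) //.
  rewrite (le_trans (lerD (ler_normD _ _) h)) //.
  rewrite (le_trans (lerD (lerD (ler_normD _ _) h1) (lerD xr h2))) //.
  by rewrite addrA.
- apply: ord2P => x Ox; rewrite ?ep ?eq.
    by apply: (le_trans (hp x Ox)); move: B1p n5; clear; lra.
  by apply: (le_trans (hq x Ox)); move: B1p n5; clear; lra.
- have kk (s : R) : 0 <= s -> K * s <= (B + B1 + `|K|) * s.
    by move=> s0; apply: ler_wpM2r => //; have := ler_norm K; move: Bp B1p; clear; lra.
  apply: ord2P => x z _ _; rewrite ?ep ?eq; have [h1 h2] := hK z x.
    by apply: (le_trans h1); apply: kk; exact: powR_ge0.
  by apply: (le_trans h2); apply: kk; exact: powR_ge0.
Qed.

(** A map of class C^2 would have its second partial derivative differentiable at the origin, hence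
    with increments from the origin bounded by a multiple of [|z|] for small [z]; [rough_osc]
    excludes this. *)
Lemma rough_not_Ck2 A ubar Omega r tau y p q (H : wrinkled_patch A ubar Omega r tau y p q) (w : V) :
  let F x := y x + w in ~ Ck 2 Omega F.
Proof.
move=> F; have [A1 Omega0 Omega_r htau hy] := H.
move=> [_ /(_ 1)[/(_ 0 Omega0) dq _]]; have [_ eq] := rough_pdE H w; rewrite eq in dq.
have [d d0 hd] := differentiable_lipschitz_at dq.
have [a ea] : exists a : V, a = pd 0 q 0 := ex_intro _ _ erefl.
have [b eb] : exists b : V, b = pd 1 q 0 := ex_intro _ _ erefl.
(* Through [M |z| <= 1] the last term forces [|z| < d]; the others beat the bound
   [(1 + |a| + |b|) |z|]. *)
pose M := 2 + `|a| + `|b| + d^-1.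
have na := normr_ge0 a; have nb := normr_ge0 b.
have i0 : 0 < d^-1 by rewrite invr_gt0.
have M1 : 1 <= M by rewrite /M; move: na nb i0; clear; lra.
have [z [z0 z1 z2]] := rough_osc hy M1.
have zd : `|z| < d.
  rewrite -(ltr_pM2l i0) mulVf ?gt_eqF //; apply: lt_le_trans z1.
  by rewrite ltr_pM2r // /M; move: na nb; clear; lra.
have := hd z zd; rewrite addr0 -deriveE // (differentiable_lin z dq).
have -> : lin (pd 0 q) (pd 1 q) 0 z = z.1 *: a + z.2 *: b by rewrite ea eb.
move=> h.
have h1 : `|z.1 *: a + z.2 *: b| <= (`|a| + `|b|) * `|z|.
  rewrite (le_trans (ler_normD _ _)) // !normrZ mulrDl.
  by apply: lerD; rewrite mulrC ler_wpM2l // ?norm1_le ?norm2_le.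
have h2 : `|q z - q 0| <= `|z| + (`|a| + `|b|) * `|z|.
  have -> : q z - q 0 = (q z - q 0 - (z.1 *: a + z.2 *: b)) + (z.1 *: a + z.2 *: b).
    by rewrite subrK.
  by rewrite (le_trans (ler_normD _ _)) // lerD.
have := le_trans z2 h2; have := mulr_gt0 i0 z0; rewrite /M; move: z0.
by clear; lra.
Qed.

Lemma rough_wrinkled A ubar Omega r tau y p q (H : wrinkled_patch A ubar Omega r tau y p q) (w : V) :
  let F x := y x + w in wrinkled_embedding 32^-1 Omega (gstar A ubar) F.
Proof.
move=> F; have [A1 Omega0 Omega_r htau hy] := H.
split; [exact: (rough_embedding H)|exact: (rough_C1holder H)|exact: (rough_not_Ck2 H)|exact: (rough_metric H)].
Qed.

End WrinkledEmbedding.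

(** * Finiteness of the energy *)

Section Energy.
Variable R : realType.
Local Notation P := (R * R)%type.
Local Notation V := 'rV[R]_3.

(* Neither [D] nor [f] is assumed measurable. *)
Lemma integral_box_fin (D : set P) (f : P -> R) (r C : R) :
  (forall x, D x -> `|x| < r) -> (forall x, D x -> 0 <= f x <= C) ->
  exists E : R, (\int[(lebesgue_measure \x lebesgue_measure)%E]_(x in D) (f x)%:E = E%:E)%E.
Proof.
move=> Dr hf; pose mu := ((@lebesgue_measure R) \x (@lebesgue_measure R))%E.
pose I : set R := `]-r, r[%classic; pose B : set P := I `*` I.
have DB x : D x -> B x.
  move=> /Dr; rewrite norm_pairE => /andP[h1 h2].
  by split; rewrite /I /= in_itv /= -ltr_norml.
have mB : measurable B by apply: measurableX; exact: measurable_itv.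
have C0 : (forall x, ~ D x) \/ 0 <= C.
  have [[x Dx]|n] := pselect (exists x, D x); last by left=> x Dx; apply: n; exists x.
  by right; have /andP[h1 h2] := hf x Dx; exact: le_trans h2.
have f0 x : D x -> (0 <= (f x)%:E)%E by move=> /hf /andP[]; rewrite lee_fin.
suff : (\int[mu]_(x in D) (f x)%:E < +oo)%E.
  move=> h; exists (fine (\int[mu]_(x in D) (f x)%:E)%E); rewrite fineK // ge0_fin_numE //.
  exact: integral_ge0.
case: C0 => [D0|C0].
  have -> : D = set0 by apply/seteqP; split=> // x /D0.
  by rewrite integral_set0.
apply: (@le_lt_trans _ _ (\int[mu]_(x in B) C%:E)%E).
  (* Both integrals are suprema over simple functions lying below, so the comparison of the extended
     integrands is enough. *)
  rewrite ge0_integralE // ge0_integralE => [|x _]; last by rewrite lee_fin.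
  apply: ereal_sup_le => _ [h /= hh <-]; exists h => //= x; apply: (le_trans (hh x)).
  rewrite !patchE; case: ifPn => [/set_mem xD|_]; last by case: ifP; rewrite lee_fin.
  by rewrite ifT ?lee_fin; [have /andP[] := hf x xD|apply/mem_set/DB].
have -> : (\int[mu]_(x in B) C%:E = C%:E * mu B)%E by exact: integral_cst.
have -> : mu B = (lebesgue_measure I * lebesgue_measure I)%E.
  by apply: product_measure1E; exact: measurable_itv.
rewrite !lebesgue_measure_itv /=.
by case: ifP => _; rewrite -?EFinB -?EFinM ?ltry ?mule0.
Qed.

End Energy.

(** * One neighbourhood for all times *)

Section Uniform.
Variable R : realType.
Local Notation P := (R * R)%type.
Local Notation V := 'rV[R]_3.
Local Notation sqform := (sqform R).

(** The preimage is a countable union of level sets of the truncated time, which is nondecreasing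
    and hence measurable; so [g] may be arbitrary. *)
Lemma measurable_step (s c : R) (g : nat -> R) : 0 <= c ->
  measurable_fun (`[0, s] : set R) (fun t => g (Num.truncn (t * c))).
Proof.
move=> c0 _ Y mY.
have mf : measurable_fun (`[0, s] : set R) (fun t => (Num.truncn (t * c))%:R : R).
  apply: measurable_realfun.nondecreasing_measurable; first exact: measurable_itv.
  by move=> x z xz; rewrite ler_nat; apply: le_truncn; exact: ler_wpM2r.
have -> : `[0, s]%classic `&` (fun t => g (Num.truncn (t * c))) @^-1` Y =
    \bigcup_(n in [set n | Y (g n)])
      (`[0, s]%classic `&` (fun t => (Num.truncn (t * c))%:R : R) @^-1` [set n%:R]).
  apply/seteqP; split=> [t [ht Yt]|t [n Yn [ht /= /eqP]]].
    by exists (Num.truncn (t * c)).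
  by rewrite eqr_nat => /eqP e; split=> //=; rewrite e.
apply: bigcup_measurable => n _.
by apply: mf; [exact: measurable_itv|exact: measurable_set1].
Qed.

(** A single integer gives both the radius [1 / (N + 1)] and the Lipschitz constant [N + 1] in time.
    Every clause persists for larger [N], so the compactness of [[0, T]] yields one [N] for all
    times. *)
Definition approximable A ubar T (yg : R -> P -> V) (N : nat) t :=
  (forall eps, 0 < eps -> exists tau y y1 y2, [/\ forall x, `|x| <= N.+1%:R^-1 -> tau x = gform A ubar x,
     rough_immersion 32^-1 tau y y1 y2 & forall x, `|x| <= N.+1%:R^-1 -> `|y x - yg t x| <= eps]) /\
  (forall t' x, 0 <= t' <= T -> `|t' - t| < N.+1%:R^-1 -> `|x| <= N.+1%:R^-1 ->
     `|yg t' x - yg t x| <= N.+1%:R * `|t' - t|).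

Lemma uniform_approximation A ubar delta T U yg (S : short_family A ubar delta T U yg) :
  exists N, forall t, 0 <= t <= T -> approximable A ubar T yg N t.
Proof.
have cK : compact (`[0, T] : set R) by exact: segment_compact.
move/compact_near_coveringP : cK => cK.
have := @cK nat \oo (fun N t => 0 <= t <= T -> approximable A ubar T yg N t) _.
case=> [t0|M _ HM]; last first.
  by exists M => t ht; apply: (HM M (leqnn M) t) => //=; rewrite in_itv.
rewrite /= in_itv /= => ht0.
have [rho [C [r0 C0 H]]] := near_time S ht0.
have r2 : 0 < rho / 2 by rewrite divr_gt0.
pose M := Num.Def.archi_bound (C + (rho / 2)^-1).
have hM : C + (rho / 2)^-1 < M%:R.
  by apply: archi_boundP; apply: addr_ge0 => //; rewrite invr_ge0 ltW.
have i0 : 0 < (rho / 2)^-1 by rewrite invr_gt0.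
exists (ball t0 (rho / 2), [set N | (M <= N)%N]) => /=.
  by split; [exact: nbhsx_ballx|exists M].
move=> [t N] /= [bt MN] ht.
have tt : `|t - t0| < rho / 2 by move: bt; rewrite -ball_normE /= distrC.
have MN' : M%:R <= N.+1%:R :> R by rewrite ler_nat ltnW.
have NC : C <= N.+1%:R by move: hM i0 MN'; clear; lra.
have N0 : (0 : R) < N.+1%:R by rewrite ltr0n.
have Nr : N.+1%:R^-1 < rho / 2.
  by rewrite -[ltRHS]invrK ltf_pV2 ?posrE //; move: hM C0 MN'; clear; lra.
have Nrho : N.+1%:R^-1 <= rho.
  by apply: ltW; apply: (lt_le_trans Nr); move: r0; clear; lra.
have tr : `|t - t0| < rho by move: tt r0; clear; lra.
have [h1 h2] := H t ht tr; split.
  move=> eps e0; have [tau [y [y1 [y2 [k1 k2 k3]]]]] := h1 eps e0.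
  exists tau, y, y1, y2; split=> // x hx; [apply: k1|apply: k3];
    exact: (le_trans hx).
move=> t' x ht' htt hx; apply: (@le_trans _ _ (C * `|t' - t|)); last by rewrite ler_wpM2r.
apply: h2 => //; last exact: (le_trans hx).
have -> : t' - t0 = (t' - t) + (t - t0) by rewrite addrA subrK.
apply: (le_lt_trans (ler_normD _ _)); rewrite (splitr rho); apply: ltrD => //; exact: lt_trans htt Nr.
Qed.

End Uniform.

(** * Step functions of time and the infinitely many families *)

Section Families.
Variable R : realType.
Local Notation P := (R * R)%type.
Local Notation V := 'rV[R]_3.
Local Notation sqform := (sqform R).

Lemma norm_const1 (c : R) : `|c *: (const_mx 1 : V)| <= `|c|.
Proof. by apply: norm_leP => // k; rewrite !mxE mulr1. Qed.

(** The integrand is the trace of the induced metric, that is of [gstar]; the value is therefore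
    fixed before the map. *)
Lemma energy_gstar (A : R) ubar (Omega : set P) (r B : R) : (forall x, Omega x -> `|x| < r) ->
  (forall x, Omega x -> fprime A ubar x.2 ^+ 2 <= B) ->
  exists E : R, forall y, (forall x, Omega x -> metric y x = gstar A ubar x) ->
    energy Omega y = E%:E.
Proof.
move=> Or hB.
have gE x : \sum_(i < 2) gstar A ubar x i i = A ^+ 2 + (fprime A ubar x.2 ^+ 2 + A ^+ 2).
  by rewrite sum2 !mxE.
have [|E hE] := @integral_box_fin R Omega (fun x => \sum_(i < 2) gstar A ubar x i i) r
  (A ^+ 2 + (B + A ^+ 2)) Or.
  move=> x Ox; rewrite gE lerD2l lerD2r hB // andbT.
  by apply: addr_ge0; [|apply: addr_ge0]; exact: sqr_ge0.
exists E => y hy; rewrite -hE /energy; apply: eq_integral => x /set_mem Ox.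
by congr (_%:E); apply: eq_bigr => i _; rewrite -hy // mxE.
Qed.

Lemma gradient_bound (A : R) ubar (y : P -> V) x B : metric y x = gstar A ubar x ->
  fprime A ubar x.2 ^+ 2 <= B -> forall i, `|pd i y x| <= A ^+ 2 + B + 1.
Proof.
move=> hm hB i.
have A2 := sqr_ge0 A; have f2 := sqr_ge0 (fprime A ubar x.2).
have : `|pd i y x| ^+ 2 <= A ^+ 2 + B.
  apply: (le_trans (norm_dot _)).
  have -> : dot (pd i y x) (pd i y x) = gstar A ubar x i i by rewrite -hm mxE.
  move: i; apply: ord2P; rewrite !mxE /=; move: hB A2 f2; clear; lra.
have := normr_ge0 (pd i y x); move: (`|pd i y x|) => s s0 h.
have B0 : 0 <= A ^+ 2 + B by apply: le_trans h; exact: sqr_ge0.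
have [s1|s1] := leP s 1; first by move: s1 B0; clear; lra.
apply: (@le_trans _ _ (s ^+ 2)); last by move: h; clear; lra.
by rewrite expr2 ler_peMr // ltW.
Qed.

(** At [t = T] the index is [m] itself, so that [m + 1] nodes occur. *)
Lemma step_time (T t : R) (m : nat) : 0 < T -> (0 < m)%N -> 0 <= t <= T ->
  let k := Num.truncn (t * (m%:R / T)) in
  (k <= m)%N /\ `|t - k%:R * (T / m%:R)| <= T / m%:R.
Proof.
move=> T0 m0 /andP[t0 tT] k; have m1 : (0 : R) < m%:R by rewrite ltr0n.
have s0 : 0 <= t * (m%:R / T) by rewrite mulr_ge0 // divr_ge0 // ltW.
have c0 : 0 < T / m%:R by rewrite divr_gt0.
have et : t = t * (m%:R / T) * (T / m%:R) by field; rewrite !gt_eqF.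
have /andP[k1 k2] := truncn_itv s0.
split.
  rewrite -(ler_nat R); apply: (le_trans k1).
  by rewrite mulrA ler_pdivrMr // mulrC ler_wpM2l // ltW.
rewrite {1}et -mulrBl normrM (gtr0_norm c0) ger_pMl // ler_norml.
by move: k1 k2; rewrite -/k -natr1; clear; lra.
Qed.

Lemma wrinkled_families A ubar delta T U yg (S : short_family A ubar delta T U yg) : 0 < T ->
  exists2 r : R, 0 < r & forall Omega : set P, Omega 0 -> (forall x, Omega x -> `|x| < r) ->
  forall eps : R, 0 < eps -> exists (y0 : P -> V) (Y : nat -> R -> P -> V),
    (forall m n : nat, m <> n ->
       exists t x, [/\ 0 <= t <= T, Omega x & Y m t x <> Y n t x]) /\
    forall n : nat,
    [/\ evolving_manifold T Omega (gstar A ubar) (Y n),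
        forall x, Omega x -> Y n 0 x = y0 x,
        forall t x, 0 <= t <= T -> Omega x -> `|Y n t x - yg t x| < eps
      & [/\ exists E : R, forall t, 0 <= t <= T -> energy Omega (Y n t) = E%:E,
            forall t x, 0 <= t <= T -> Omega x ->
              \sum_(i < 2) dot (pd i (Y n t) x) (pd i (Y n t) x)
              = \sum_(i < 2) gstar A ubar x i i
          & gradient_Linfty T Omega (Y n)]].
Proof.
move=> T0; have [N hN] := uniform_approximation S.
have [rf [L [rf0 L0 hL]]] := fprime_sqr_lip (sf_A S) (sf_shear S) (sf_delta S).
have [r0 er0] : exists r0 : R, r0 = N.+1%:R^-1 by exists (N.+1%:R^-1).
have [C eC] : exists C : R, C = N.+1%:R by exists (N.+1%:R).
have C0 : 0 < C by rewrite eC.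
have r00 : 0 < r0 by rewrite er0 invr_gt0.
exists (Num.min r0 rf); first by rewrite lt_min r00.
move=> Omega O0 Or eps e0.
have Or0 x : Omega x -> `|x| <= r0.
  by move/Or/ltW => h; apply: (le_trans h); rewrite ge_min lexx.
have Orf x : Omega x -> `|x| <= rf.
  by move/Or/ltW => h; apply: (le_trans h); rewrite ge_min lexx orbT.
have [B hB] : exists B, forall x, Omega x -> fprime A ubar x.2 ^+ 2 <= B.
  exists (fprime A ubar 0 ^+ 2 + L * rf) => x Ox.
  have xr := le_trans (norm2_le x) (Orf x Ox).
  have z0 : `|0 : R| <= rf by rewrite normr0 ltW.
  have := hL _ _ z0 xr; rewrite subr0 => h.
  have := le_trans (ler_norm _) h; have := ler_wpM2l L0 xr; clear; lra.
(* A quarter of [eps] each for the error at the nodes, for the motion of [yg] during one time step,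
   and for the translation. *)
have e4 : 0 < eps / 4 by rewrite divr_gt0.
have [m [m0 m1 m2]] : exists m, [/\ (0 < m)%N, T / m%:R < r0 & C * (T / m%:R) <= eps / 4].
  pose b := T / r0 + C * T / (eps / 4); have b1 : 0 < T / r0 by rewrite divr_gt0.
  have b2 : 0 < C * T / (eps / 4) by rewrite divr_gt0 // mulr_gt0.
  have bb : b < (Num.Def.archi_bound b)%:R.
    by apply: archi_boundP; rewrite /b; move: b1 b2; clear; lra.
  have b0 : (0 : R) < (Num.Def.archi_bound b)%:R.
    by apply: lt_trans bb; rewrite /b; move: b1 b2; clear; lra.
  exists (Num.Def.archi_bound b); split; first by rewrite -(ltr_nat R).
    rewrite ltr_pdivrMr // mulrC -ltr_pdivrMr //; apply: lt_trans bb.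
    by rewrite /b; move: b2; clear; lra.
  rewrite mulrA ler_pdivrMr // [leRHS]mulrC -ler_pdivrMr //; apply: ltW; apply: lt_trans bb.
  by rewrite /b; move: b1; clear; lra.
have mp : (0 : R) < m%:R by rewrite ltr0n.
have tk k : 0 <= (minn k m)%:R * (T / m%:R) <= T.
  apply/andP; split; first by rewrite mulr_ge0 // divr_ge0 // ltW.
  by rewrite mulrA ler_pdivrMr // [leRHS]mulrC ler_wpM2r ?ler_nat ?geq_minr // ltW.
(* [minn k m] gives every natural number a node inside [[0, T]], so that the choice can range over
   [nat]. *)
have /choice[z hz] : forall k, exists z : (P -> sqform) * (P -> V) * (P -> V) * (P -> V),
    wrinkled_patch A ubar Omega r0 z.1.1.1 z.1.1.2 z.1.2 z.2 /\
    forall x, `|x| <= r0 -> `|z.1.1.2 x - yg ((minn k m)%:R * (T / m%:R)) x| <= eps / 4.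
  move=> k; have [h _] := hN _ (tk k); have [tau [y [p [q [h1 h2 h3]]]]] := h _ e4.
  exists (tau, y, p, q); split=> /=; last by move=> x; rewrite er0; exact: h3.
  by split=> //; [exact: (sf_A S)|move=> x; rewrite er0; exact: h1].
pose k t := Num.truncn (t * (m%:R / T)).
(* Pairwise different lengths; the translation vanishes at [t = 0], where all families start from
   the map chosen for node 0. *)
pose c n : R := eps / 4 / n.+1%:R.
have cp n : 0 < c n by rewrite divr_gt0.
have ce n : c n <= eps / 4 by rewrite ler_pdivrMr // ler_peMr ?ler1n // ltW.
pose w n (t : R) : V := (if 0 < t then c n else 0) *: const_mx 1.
pose Y n (t : R) (x : P) := (z (k t)).1.1.2 x + w n t.
have wr n t : wrinkled_embedding 32^-1 Omega (gstar A ubar) (Y n t).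
  exact: (rough_wrinkled (hz (k t)).1).
have hm n t x : Omega x -> metric (Y n t) x = gstar A ubar x.
  by have [_ _ _ h] := wr n t; exact: h.
have Ylt n t x : 0 <= t <= T -> Omega x -> `|Y n t x - yg t x| < eps.
  move=> ht Ox; have [kt1 kt2] := step_time T0 m0 ht.
  have [_ h1] := hz (k t); have {}h1 := h1 x (Or0 x Ox).
  have := tk (k t); move: h1; rewrite (minn_idPl kt1) => h1 ht'.
  have [_ h2] := hN _ ht'.
  have {}h2 : `|yg t x - yg ((k t)%:R * (T / m%:R)) x| <= eps / 4.
    apply: (@le_trans _ _ (C * `|t - (k t)%:R * (T / m%:R)|)).
      rewrite eC; apply: h2 => //; last by rewrite -er0; exact: Or0.
      by rewrite -er0; exact: le_lt_trans kt2 m1.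
    by apply: (le_trans _ m2); rewrite ler_wpM2l // ltW.
  have h3 : `|w n t| <= eps / 4.
    apply: (le_trans (norm_const1 _)); case: ifP => _; last by rewrite normr0 ltW.
    by rewrite gtr0_norm.
  have -> : Y n t x - yg t x = ((z (k t)).1.1.2 x - yg ((k t)%:R * (T / m%:R)) x) -
      (yg t x - yg ((k t)%:R * (T / m%:R)) x) + w n t.
    by rewrite /Y opprB addrA subrK addrAC.
  apply: (le_lt_trans (ler_normD _ _)).
  apply: (le_lt_trans (lerD (ler_normB _ _) (lexx _))).
  apply: (le_lt_trans (lerD (lerD h1 h2) h3)); move: e0; clear; lra.
have [E hE] := energy_gstar Or hB.
exists (z 0%N).1.1.2, Y; split.
  (* At time [T] the translation is on and the underlying map is the same for all indices, so only
     the lengths [c] are compared. *)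
  move=> n n' nn'; exists T, 0; split=> //; first by rewrite lexx ltW.
  move=> /addrI; rewrite /w T0 => /rowP/(_ 0); rewrite !mxE !mulr1 => e.
  apply: nn'; move: e; rewrite /c => /(mulfI (lt0r_neq0 e4))/invr_inj/eqP.
  by rewrite eqr_nat => /eqP[].
move=> n; split.
- exists 32^-1 => [|t _]; last exact: wr.
  by rewrite invr_gt0 invf_lt1 // ltr1n ltr0n.
- by move=> x Ox; rewrite /Y /w /k ltxx mul0r truncn0 scale0r addr0.
- by move=> t x ht Ox; exact: Ylt.
split.
- by exists E => t _; apply: hE => x Ox; exact: hm.
- by move=> t x _ Ox; apply: eq_bigr => i _; rewrite -(hm n t x Ox) mxE.
split.
  move=> i j x Ox.
  have cT : 0 <= m%:R / T by rewrite divr_ge0 // ltW.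
  have ms := @measurable_step R T (m%:R / T)
    (fun l => (if i == 0 then (z l).1.2 x else (z l).2 x) 0 j) cT.
  rewrite [X in measurable_fun _ X](_ : _ = fun t => (if i == 0 then (z (k t)).1.2 x else (z (k t)).2 x) 0 j).
    exact: ms.
  apply/funext => t; have [e1 e2] := rough_pdE (hz (k t)).1 (w n t).
  by clear ms; move: i; apply: ord2P; rewrite /= ?e1 ?e2.
exists (A ^+ 2 + B + 1) => i t x _ Ox.
by apply: (gradient_bound (hm n t x Ox)); exact: hB.
Qed.

End Families.

Unset Implicit Arguments.

Theorem theorem7p3 (R : realType)
  (A : R) (hA : 1 < A)
  (ubar : R -> R) (delta : R) (hubar : shear_profile A delta ubar)
  (T : R) (hT : 0 < T)
  (U : set (R * R)) (hUo : open U) (hU0 : U 0)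
  (hUdelta : forall x, U x -> `|x.2| < delta)
  (u v p : R -> R * R -> R)
  (hu : analytic_on T U u) (hv : analytic_on T U v) (hp : analytic_on T U p)
  (heuler : euler_solution T U u v p)
  (huv : forall t x, 0 <= t <= T -> U x -> u t x * v t x != 0)
  (yg : R -> R * R -> 'rV[R]_3)
  (hyg_an : forall k : 'I_3, analytic_on T U (fun t x => yg t x 0 k))
  (hyg_emb : forall t, 0 <= t <= T -> embedding U (yg t))
  (hyg_euler : euler_image T U u v p yg)
  (hyg_short : forall t x, 0 <= t <= T -> U x ->
     lt_form (metric (yg t) x) (gstar A ubar x)) :
  exists2 r : R, 0 < r &
  forall Omega : set (R * R),
    open Omega -> Omega 0 -> Omega `<=` ball (0 : R * R) r ->
  forall eps : R, 0 < eps ->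
  exists (y0 : R * R -> 'rV[R]_3) (Y : nat -> R -> R * R -> 'rV[R]_3),
    (forall m n : nat, m <> n ->
       exists t x, [/\ 0 <= t <= T, Omega x & Y m t x <> Y n t x]) /\
    forall n : nat,
    [/\ evolving_manifold T Omega (gstar A ubar) (Y n),
        forall x, Omega x -> Y n 0 x = y0 x,
        forall t x, 0 <= t <= T -> Omega x -> `|Y n t x - yg t x| < eps
      & [/\ exists E : R, forall t, 0 <= t <= T -> energy Omega (Y n t) = E%:E,
            forall t x, 0 <= t <= T -> Omega x ->
              \sum_(i < 2) dot (pd i (Y n t) x) (pd i (Y n t) x)
              = \sum_(i < 2) gstar A ubar x i i
          & gradient_Linfty T Omega (Y n)]].
Proof.
have d0 : 0 < delta by apply: le_lt_trans (hUdelta 0 hU0); exact: normr_ge0.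
have S := ShortFamily hA hubar d0 hUo hU0 hyg_an hyg_emb hyg_short.
have [r r0 H] := wrinkled_families S hT.
exists r => // Omega _ O0 Or eps e0; apply: H => // x /Or.
by rewrite -ball_normE /= sub0r normrN.
Qed.
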